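(* There is a morphism of differential graded operads from $\mathrm{Com}$, equipped with the zero differential, to $\Pi$, and it is a quasi-isomorphism. (The complexes underlying $\Pi$ are the cellular cochain complexes of the permutohedra, so that the homology is in degree $0$ with trivial action of the symmetric groups.)
   Context: $\mathrm{Com}$ is the operad of commutative associative algebras over $\mathbb{Z}$. Operads are symmetric operads in complexes of $\mathbb{Z}$-modules, viewed as functors on the groupoid of finite non-empty sets; a morphism is a quasi-isomorphism if it is one in each arity. Definition of the differential graded operad $\Pi$. For a finite non-empty set $I$, $\Pi(I)$ is the free $\mathbb{Z}$-module generated by expressions $\pi=\pi_1\otimes\pi_2\otimes\dots\otimes\pi_p$, where $\pi_j=i_{j,1}\wedge\dots\wedge i_{j,p_j}$ ($p_j\ge 1$, $i_{j,k}\in I$), every element of $I$ appearing in exactly one $\pi_j$ and exactly once, modulo the antisymmetry relations of the exterior products. These expressions correspond to ordered partitions of $I$, which are in bijection with the faces of the permutohedron associated with $I$. Bijections act by relabelling. Set $\dim(\pi_j)=p_j-1$ and $\dim(\pi)=\sum_j\dim(\pi_j)$; this is the grading. The differential is $$d(\pi)=\sum_{j=1}^{p-1}(-1)^{\dim(\pi_1)+\dots+\dim(\pi_j)}\,\pi_1\otimes\dots\otimes \pi_j\wedge\pi_{j+1}\otimes\dots\otimes\pi_p .$$ Composition: let $\pi=\pi_1\otimes\dots\otimes\pi_p\in\Pi(I)$, $\mu=\mu_1\otimes\dots\otimes\mu_q\in\Pi(J)$, $i\in I$, and let $\ell$ be the unique index such that $i$ appears in $\pi_\ell$. Up to a sign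 write $\pi_\ell=\pi'_\ell\wedge i$ (if $\pi_\ell=i$, the convention is $\pi'_\ell\wedge\nu=\nu$ for all $\nu$). Then $\pi\circ_i\mu\in\Pi(I\setminus\{i\}\sqcup J)$ is $$\pi\circ_i\mu=\sum_\sigma\varepsilon(\sigma)\,\pi_1\otimes\dots\otimes\pi_{\ell-1}\otimes\pi'_\ell\wedge\mu_1\otimes\sigma(\pi_{\ell+1}\otimes\dots\otimes\pi_p\,,\,\mu_2\otimes\dots\otimes\mu_q),$$ where $\sigma$ runs over the shuffles of $\pi_{\ell+1},\dots,\pi_p$ with $\mu_2,\dots,\mu_q$, $\sigma(\cdots)$ is the tensor product of these blocks in the order specified by $\sigma$, and $\varepsilon(\sigma)$ is the Koszul sign (for the grading by $\dim$) for passing from $\pi_{\ell+1}\otimes\dots\otimes\pi_p\otimes\mu_1\otimes\dots\otimes\mu_q$ to $\mu_1\otimes\sigma(\pi_{\ell+1}\otimes\dots\otimes\pi_p,\mu_2\otimes\dots\otimes\mu_q)$. The unit is $1\in\Pi(\{1\})$. *)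

(* Defs.v *)
(* MathComp, with the free modules of multinomials and the boolean reflection  *)
(* of propositions of mathcomp-classical.                                      *)
From HB Require Import structures.
From mathcomp Require Import all_boot all_order all_algebra.
From mathcomp Require Import boolp.
From mathcomp Require Import freeg.

Set Implicit Arguments.
Unset Strict Implicit.
Unset Printing Implicit Defensive.

Import Order.TTheory GRing.Theory Num.Theory.

Local Open Scope ring_scope.
Local Open Scope quotient_scope.

(** * Complexes of abelian groups *)

(* Grading by Z, presented internally: one abelian group together with the     *)
(* subgroups of homogeneous elements; no axioms at this stage.                 *)
Record cplxData := CplxData {
  cplx_mod :> zmodType;
  cdeg : int -> cplx_mod -> Prop;
  cdiff : cplx_mod -> cplx_mod
}.

Definition additive_fun (M N : zmodType) (f : M -> N) : Prop :=
  forall x y, f (x + y) = f x + f y.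

Record is_complex (C : cplxData) : Prop := IsComplex {
  cdeg0 : forall n, cdeg n (0 : C);
  cdegB : forall n (x y : C), cdeg n x -> cdeg n y -> cdeg n (x - y);
  cdeg_span : forall x : C, exists (s : seq int) (c : int -> C),
    (forall n, cdeg n (c n)) /\ x = \sum_(n <- s) c n;
  cdeg_direct : forall (s : seq int) (c : int -> C),
    uniq s -> (forall n, cdeg n (c n)) -> \sum_(n <- s) c n = 0 ->
    forall n, n \in s -> c n = 0;
  cdiffD : additive_fun (@cdiff C);
  cdiff_deg : forall n (x : C), cdeg n x -> cdeg (n + 1) (cdiff x);
  cdiffK : forall x : C, cdiff (cdiff x) = 0
}.

Definition cocycle (C : cplxData) (n : int) (x : C) : Prop :=
  cdeg n x /\ cdiff x = 0.

Definition coboundary (C : cplxData) (n : int) (x : C) : Prop :=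
  exists2 y : C, cdeg (n - 1) y & cdiff y = x.

Record chain_map (C D : cplxData) (f : C -> D) : Prop := ChainMap {
  chain_mapD : additive_fun f;
  chain_map_deg : forall n (x : C), cdeg n x -> cdeg n (f x);
  chain_map_diff : forall x : C, f (cdiff x) = cdiff (f x)
}.

(* The map induced by [f] on each homology group is injective and surjective.  *)
Definition quasi_iso (C D : cplxData) (f : C -> D) : Prop :=
  forall n : int,
    (forall x : C, cocycle n x -> coboundary n (f x) -> coboundary n x) /\
    (forall y : D, cocycle n y ->
       exists2 x : C, cocycle n x & coboundary n (y - f x)).

(** * Operads in complexes, as functors on finite non-empty sets *)

Record neFin := NeFin { ne_sort :> finType; ne_card : (0 < #|ne_sort|)%N }.

(* I \ {i} *)
Definition del (I : finType) (i : I) : finType := {x : I | x != i}.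

Lemma subst_card (I : finType) (i : I) (J : neFin) :
  (0 < #|(del i + J)%type : finType|)%N.
Proof. by rewrite card_sum addn_gt0 ne_card orbT. Qed.

(* (I \ {i}) + J *)
Definition subst (I : neFin) (i : I) (J : neFin) : neFin :=
  NeFin (subst_card i J).

Lemma pt_card : (0 < #|unit : finType|)%N.
Proof. by rewrite card_unit. Qed.

Definition pt : neFin := NeFin pt_card.

Record operadData := OperadData {
  ocplx :> neFin -> cplxData;
  opmap : forall (I J : neFin) (f : I -> J), bijective f -> ocplx I -> ocplx J;
  opcomp : forall (I J : neFin) (i : I),
    ocplx I -> ocplx J -> ocplx (subst i J);
  opunit : ocplx pt
}.

Arguments opmap P {I J f} fbij x : rename.
Arguments opcomp P {I J} i x y : rename.
Arguments opunit P : rename.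

(* The canonical bijections entering the axioms are quantified over by their   *)
(* values, so that no partial inverse of the inclusion of I \ {i} into I       *)
(* is needed.                                                                  *)

(* (I \ {i}) + J -> (I' \ {f i}) + J' induced by f : I -> I' and g : J -> J'   *)
Definition subst_map_spec (I J I' J' : neFin) (i : I) (f : I -> I')
    (g : J -> J') (h : subst i J -> subst (f i) J') : Prop :=
  (forall (u : del i) (u' : del (f i)), val u' = f (val u) ->
     h (inl u) = inl u') /\
  (forall j : J, h (inr j) = inr (g j)).

(* ((I \ {i}) + J) \ {j} + K -> (I \ {i}) + ((J \ {j}) + K) *)
Definition subst_seq_spec (I J K : neFin) (i : I) (j : J)
    (h : @subst (subst i J) (inr j) K -> subst i (subst j K)) : Prop :=
  [/\ forall (u : @del (subst i J) (inr j)) (v : del i),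
        val u = inl v -> h (inl u) = inl v,
      forall (u : @del (subst i J) (inr j)) (w : del j),
        val u = inr (val w) -> h (inl u) = inr (inl w)
    & forall k : K, h (inr k) = inr (inr k)].

(* ((I \ {i}) + J) \ {i'} + K -> ((I \ {i'}) + K) \ {i} + J, where [a] and [b] *)
(* are i' and i seen in I \ {i} and in I \ {i'}                                *)
Definition subst_par_spec (I J K : neFin) (i i' : I) (a : del i) (b : del i')
    (h : @subst (subst i J) (inl a) K -> @subst (subst i' K) (inl b) J) : Prop :=
  [/\ forall (u : @del (subst i J) (inl a)) (u' : @del (subst i' K) (inl b))
             (v : del i) (v' : del i'),
        val u = inl v -> val u' = inl v' -> val v = val v' ->
        h (inl u) = inl u',
      forall (u : @del (subst i J) (inl a)) (j : J),
        val u = inr j -> h (inl u) = inr j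
    & forall (u' : @del (subst i' K) (inl b)) (k : K),
        val u' = inr k -> h (inr k) = inl u'].

Arguments subst_map_spec {I J I' J'} i f g h.
Arguments subst_seq_spec {I J K} i j h.
Arguments subst_par_spec {I J K i i'} a b h.

Record is_dgOperad (P : operadData) : Prop := IsDgOperad {
  op_complex : forall I : neFin, is_complex (P I);
  (* functor on finite non-empty sets and bijections *)
  op_map_chain : forall (I J : neFin) (f : I -> J) (fbij : bijective f),
    chain_map (opmap P fbij);
  op_map_id : forall (I : neFin) (f : I -> I) (fbij : bijective f),
    f =1 id -> forall x, opmap P fbij x = x;
  op_map_comp : forall (I J K : neFin) (f : I -> J) (g : J -> K) (h : I -> K)
      (fbij : bijective f) (gbij : bijective g) (hbij : bijective h),
    h =1 g \o f -> forall x, opmap P hbij x = opmap P gbij (opmap P fbij x);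
  (* partial compositions are maps of complexes P(I) (x) P(J) -> P(I \ i + J) *)
  op_compDl : forall (I J : neFin) (i : I) (y : P J),
    additive_fun (fun x : P I => opcomp P i x y);
  op_compDr : forall (I J : neFin) (i : I) (x : P I),
    additive_fun (fun y : P J => opcomp P i x y);
  op_comp_deg : forall (I J : neFin) (i : I) m n (x : P I) (y : P J),
    cdeg m x -> cdeg n y -> cdeg (m + n) (opcomp P i x y);
  op_comp_diff : forall (I J : neFin) (i : I) m (x : P I) (y : P J),
    cdeg m x ->
    cdiff (opcomp P i x y) =
      opcomp P i (cdiff x) y + opcomp P i x (cdiff y) *~ (-1) ^+ `|m|%N;
  op_comp_map : forall (I J I' J' : neFin) (i : I) (f : I -> I') (g : J -> J')
      (h : subst i J -> subst (f i) J')
      (fbij : bijective f) (gbij : bijective g) (hbij : bijective h),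
    subst_map_spec i f g h -> forall (x : P I) (y : P J),
    opmap P hbij (opcomp P i x y) = opcomp P (f i) (opmap P fbij x) (opmap P gbij y);
  (* associativity *)
  op_comp_seq : forall (I J K : neFin) (i : I) (j : J)
      (h : @subst (subst i J) (inr j) K -> subst i (subst j K))
      (hbij : bijective h),
    subst_seq_spec i j h -> forall (x : P I) (y : P J) (z : P K),
    opmap P hbij (@opcomp P (subst i J) K (inr j) (opcomp P i x y) z) =
      opcomp P i x (opcomp P j y z);
  op_comp_par : forall (I J K : neFin) (i i' : I) (a : del i) (b : del i')
      (h : @subst (subst i J) (inl a) K -> @subst (subst i' K) (inl b) J)
      (hbij : bijective h),
    val a = i' -> val b = i -> subst_par_spec a b h ->
    forall m n (x : P I) (y : P J) (z : P K), cdeg m y -> cdeg n z ->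
    opmap P hbij (@opcomp P (subst i J) K (inl a) (opcomp P i x y) z) =
      @opcomp P (subst i' K) J (inl b) (opcomp P i' x z) y *~ (-1) ^+ `|(m * n)%R|%N;
  (* unit *)
  op_unit_deg : cdeg 0 (opunit P);
  op_unit_diff : cdiff (opunit P) = 0;
  op_unitl : forall (J : neFin) (h : J -> @subst pt tt J) (hbij : bijective h),
    (forall j, h j = inr j) ->
    forall y : P J, @opcomp P pt J tt (opunit P) y = opmap P hbij y;
  op_unitr : forall (I : neFin) (i : I) (h : I -> subst i pt)
      (hbij : bijective h),
    (forall u : del i, h (val u) = inl u) -> h i = inr tt ->
    forall x : P I, opcomp P i x (opunit P) = opmap P hbij x
}.

Record operad_morphism (P Q : operadData) (f : forall I : neFin, P I -> Q I)
    : Prop := OperadMorphism {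
  opm_chain : forall I : neFin, chain_map (f I);
  opm_map : forall (I J : neFin) (g : I -> J) (gbij : bijective g) (x : P I),
    f J (opmap P gbij x) = opmap Q gbij (f I x);
  opm_comp : forall (I J : neFin) (i : I) (x : P I) (y : P J),
    f (subst i J) (opcomp P i x y) = opcomp Q i (f I x) (f J y);
  opm_unit : f pt (opunit P) = opunit Q
}.

(** * The operad Com, with zero differential *)

Definition Com_cplx : cplxData :=
  @CplxData int (fun n x => n = 0 \/ x = 0) (fun _ => 0).

Definition Com : operadData :=
  @OperadData (fun=> Com_cplx) (fun _ _ _ _ x => x)
    (fun _ _ _ (x y : int) => x * y) (1 : int).

(** * The operad Pi *)

(* [:: b1; ...; bp] stands for b1 (x) ... (x) bp, and a block [:: i1; ...; ik] *)
(* for i1 /\ ... /\ ik.                                                        *)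
Definition word (X : Type) := seq (seq X).

Definition is_expr (I : finType) (w : word I) : bool :=
  all (fun b => b != [::]) w && perm_eq (flatten w) (enum I).

Definition expr (I : finType) := {w : word I | is_expr w}.

Definition bdim (X : Type) (b : seq X) : nat := (size b).-1.
Definition wdim (X : Type) (w : word X) : nat := \sum_(b <- w) bdim b.

Notation freeE I := {freeg (expr I) / int}.

(* The generator given by [w]; all the words it is applied to below satisfy    *)
(* [is_expr].                                                                  *)
Definition gen (I : finType) (w : word I) : freeE I :=
  if insub w is Some e then << e >> else 0.

Definition swap_in_block (I : finType) (w w' : word I) : Prop :=
  exists (A B : word I) (u v : seq I) (a b : I),
    w = A ++ (u ++ a :: b :: v) :: B /\ w' = A ++ (u ++ b :: a :: v) :: B.

(* The subgroup generated by the antisymmetry relations.                       *)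
Inductive antisym (I : finType) : freeE I -> Prop :=
| antisym0 : antisym 0
| antisymB x y : antisym x -> antisym y -> antisym (x - y)
| antisym_swap (e e' : expr I) :
    swap_in_block (val e) (val e') -> antisym (<< e >> + << e' >>).

Definition antisym_pred (I : finType) : {pred freeE I} := fun x => `[< antisym x >].

Lemma antisym_zmod_closed (I : finType) : zmod_closed (@antisym_pred I).
Proof.
split=> [|x y /asboolP hx /asboolP hy]; apply/asboolP; first exact: antisym0.
exact: antisymB.
Qed.

HB.instance Definition _ (I : finType) :=
  GRing.isZmodClosed.Build (freeE I) (@antisym_pred I)
    (@antisym_zmod_closed I).

Definition PiM (I : finType) : zmodType := Quotient.quot (@antisym_pred I).

Definition clsPi (I : finType) (x : freeE I) : PiM I :=
  \pi_(Quotient.quot (@antisym_pred I)) x.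

Definition reprPi (I : finType) (x : PiM I) : freeE I :=
  @repr _ (Quotient.quot (@antisym_pred I)) x.

(* The operations are defined on expressions, extended (bi)linearly, and then  *)
(* transported to the quotient, where they do not depend on representatives.   *)

Definition dexpr (I : finType) (w : word I) : freeE I :=
  \sum_(j < (size w).-1)
    (-1) ^+ wdim (take j.+1 w) *:
      gen (take j w ++ (nth [::] w j ++ nth [::] w j.+1) :: drop j.+2 w).

Definition dfree (I : finType) (x : freeE I) : freeE I :=
  fglift (fun e : expr I => dexpr (val e)) x.

Definition dPi (I : finType) (x : PiM I) : PiM I := clsPi (dfree (reprPi x)).

Definition degPi (I : finType) (n : int) (x : PiM I) : Prop :=
  exists2 y : freeE I,
    forall e : expr I, e \in dom y -> (wdim (val e))%:Z = n & x = clsPi y.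

Definition Pi_cplx (I : finType) : cplxData := @CplxData (PiM I) (@degPi I) (@dPi I).

Definition mapPi (I J : finType) (f : I -> J) (x : PiM I) : PiM J :=
  clsPi (fglift (fun e : expr I => gen (map (map f) (val e))) (reprPi x)).

(* The shuffles of s and t. In [(n, u)], [u] is a shuffle and (-1)^n is the    *)
(* Koszul sign for passing from s (x) t to u: a block of t moving in front of  *)
(* the blocks of s which remain contributes the product of the dimensions.     *)
Fixpoint shuffles (X : Type) (s : word X) : word X -> seq (nat * word X) :=
  fix shuffles_s (t : word X) : seq (nat * word X) :=
    match s, t with
    | [::], _ => [:: (0%N, t)]
    | _, [::] => [:: (0%N, s)]
    | b :: s', c :: t' =>
        [seq (u.1, b :: u.2) | u <- shuffles s' t] ++
        [seq ((u.1 + bdim c * wdim s)%N, c :: u.2) | u <- shuffles_s t']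
    end.

(* A block with [i] removed, if present, relabelled in (I \ {i}) + J.          *)
Definition inlb (I J : finType) (i : I) (b : seq I) : seq (del i + J)%type :=
  [seq inl u | u <- pmap (insub : I -> option (del i)) b].

Definition inrb (I J : finType) (i : I) (b : seq J) : seq (del i + J)%type :=
  [seq inr j | j <- b].

(* pi o_i mu. The block pi_l = b equals (-1)^(size b - index i b - 1) times    *)
(* pi'_l /\ i, and (-1)^(dim mu_1 dim (pi_(l+1) ... pi_p)) is the Koszul sign  *)
(* for moving mu_1 to the front.                                               *)
Definition comp_expr (I J : finType) (i : I) (p : word I) (m : word J)
    : freeE (del i + J)%type :=
  let l := find (fun b => i \in b) p in
  let b := nth [::] p l in
  let P := [seq inlb J i c | c <- drop l.+1 p] in
  let m1 := inrb i (head [::] m) in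
  let M := [seq inrb i c | c <- behead m] in
  \sum_(u <- shuffles P M)
    (-1) ^+ ((size b - index i b).-1 + bdim m1 * wdim P + u.1) *:
      gen ([seq inlb J i c | c <- take l p] ++ (inlb J i b ++ m1) :: u.2).

Definition compPi (I J : finType) (i : I) (x : PiM I) (y : PiM J)
    : PiM (del i + J)%type :=
  clsPi (fglift (fun e : expr I =>
           fglift (fun e' : expr J => comp_expr i (val e) (val e')) (reprPi y))
         (reprPi x)).

Definition Pi : operadData :=
  @OperadData (fun I => Pi_cplx I) (fun I J f _ => @mapPi I J f)
    (fun I J i => @compPi I J i) (clsPi (gen [:: [:: tt]])).

(** * The permutohedra and their cellular cochain complexes *)

(* The vertices of the permutohedron in Q^I are the bijections from I to       *)
(* {0, ..., #|I| - 1}. A face is identified with the set of its vertices,      *)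
(* which are those maximizing some linear functional; the permutohedron itself *)
(* is a face and the empty set is not.                                         *)
Definition pvertex (I : finType) := {ffun I -> 'I_#|I|}.

Definition pairing (I : finType) (c : {ffun I -> rat}) (v : pvertex I) : rat :=
  \sum_i c i * (v i)%:R.

Definition is_face (I : finType) (F : {set pvertex I}) : Prop :=
  exists c : {ffun I -> rat},
    F = [set v : pvertex I | injectiveb v &
           [forall w : pvertex I, injectiveb w ==> (pairing c w <= pairing c v)]].

Definition pface (I : finType) := {F : {set pvertex I} | `[< is_face F >]}.

Definition ppoint (I : finType) (v : pvertex I) : {ffun I -> rat^o} :=
  [ffun i => (v i)%:R : rat^o].

(* The dimension of the affine span of a face.                                 *)
Definition pface_dim (I : finType) (F : pface I) : nat :=
  \dim <<[seq ppoint v - ppoint w | v <- enum (val F), w <- enum (val F)]>>%VS.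

Definition facet (I : finType) (F G : pface I) : bool :=
  (val F \subset val G) && (pface_dim G == (pface_dim F).+1).

(* [inc G F] is the incidence number [G : F]. For a regular cell complex these *)
(* conditions characterize the incidence numbers attached to the choices of    *)
(* orientations of the cells.                                                  *)
Record incidence_numbers (I : finType) (inc : pface I -> pface I -> int)
    : Prop := IncidenceNumbers {
  inc_facet : forall F G, `|inc G F| = (facet F G)%:R;
  inc_edge : forall F F' G, F != F' -> facet F G -> facet F' G ->
    pface_dim G = 1%N -> inc G F + inc G F' = 0;
  inc_diamond : forall F H, \sum_G inc H G * inc G F = 0
}.

(* [C] is the cellular cochain complex of the permutohedron of I: free on the  *)
(* faces, graded by dimension, with (d F) = sum_G [G : F] G.                   *)
Definition permutohedron_cochains (I : finType) (C : cplxData) : Prop :=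
  exists (b : pface I -> C) (inc : pface I -> pface I -> int),
    [/\ forall x : C, exists! c : {ffun pface I -> int}, x = \sum_F b F *~ c F,
        forall F, cdeg (pface_dim F)%:Z (b F),
        incidence_numbers inc
      & forall F, cdiff (b F) = \sum_G b G *~ inc G F].

(** * Homology in degree 0 with trivial action of the symmetric groups *)

Definition homology_in_degree0 (C : cplxData) : Prop :=
  forall n (x : C), n != 0 -> cocycle n x -> coboundary n x.

Definition trivial_action_on_homology (P : operadData) : Prop :=
  forall (I : neFin) (s : I -> I) (sbij : bijective s) n (x : P I),
    cocycle n x -> coboundary n (opmap P sbij x - x).

(* Main.v *)
From HB Require Import structures.
From mathcomp Require Import all_boot all_order all_algebra.
From mathcomp Require Import perm boolp freeg zify.
Require Import Defs.

Set Implicit Arguments.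
Unset Strict Implicit.
Unset Printing Implicit Defensive.

Import Order.TTheory GRing.Theory Num.Theory.

Local Open Scope ring_scope.
Local Open Scope quotient_scope.

(** Words are sequences of blocks, and the operations of Pi are handled in
    continuation-passing form: instead of a formal sum of words u, one carries
    the value sum of +-phi(u) for an arbitrary function phi on words with values
    in an abelian group. Shuffling [shuf], the differential [dword] and partial
    composition [cword] then become recursions on words, and each axiom becomes
    an identity between two such recursions, valid for every phi which is
    antisymmetric inside blocks and proved by induction with phi generalized.

    The shuffle product is associative and graded commutative ([shufA],
    [shufC]), and the differential is a derivation for it ([shuf_dword]); there
    the two ways of merging a block of one word with a block of the other cancel
    by antisymmetry. Composing inside one factor of a shuffle is the same as
    shuffling after the composition ([shuf_cword]), whence the Leibniz rule and
    the two associativity laws for composition ([cword_dword], [cword_seq],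
    [cword_par]). They are transported to Pi by the lemmas [dPi_push] and
    [compPi_push]: an additive map which is given on the class of u by psi(u)
    takes a differential or a composition to the corresponding recursion for
    psi. All letters at play are embedded in one disjoint union, so that no
    renaming is left in the identities to be checked.

    For the homology, fix a letter x of I. Shuffling with the one-letter block
    {x} is a chain map from Pi(I minus x) to Pi(I), restricting to the words
    ending with {x} is a left inverse of it, and pulling x out of its block and
    inserting it at all earlier places is a homotopy from the other composite to
    the identity ([homotopy]). By induction on the cardinal of I the homology is
    Z in degree 0, generated by the sum of all linear orders of I, which is the
    iterated shuffle of the letters. That element is invariant under bijections,
    and composing two of them gives the third because composing A shuffled with
    {i} at i with y is A shuffled with y ([compPi_sum_orders]); so it is the
    image of the generator of Com.

    For the permutohedra, twice the pairing of a functional c with a vertex v is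
    a sum over pairs (i, j) of terms at most max(c i, c j), and all the terms
    are maximal exactly when v is monotone for the preorder defined by c. Hence
    faces correspond to ordered partitions ([face_of_functional], [face_word]),
    inclusion of faces to coarsening, and facets to merging two adjacent blocks
    ([facetE]). Counting inversions inside blocks gives a signed coordinate for
    each face on the quotient, which shows that the classes of the faces form a
    basis in which the differential has coefficients 0, 1 and -1. *)

(** * Signs *)

Definition sg (V : zmodType) (n : nat) (x : V) : V := if odd n then - x else x.

Section Sign.
Variable V : zmodType.
Implicit Types x y : V.

Lemma sg_mod m n x : odd m = odd n -> sg m x = sg n x.
Proof. by rewrite /sg => ->. Qed.

Lemma sgD m n x : sg (m + n) x = sg m (sg n x).
Proof. by rewrite /sg oddD; case: odd; case: odd; rewrite /= ?opprK. Qed.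

Lemma sg_add n x y : sg n (x + y) = sg n x + sg n y.
Proof. by rewrite /sg; case: odd; rewrite ?opprD. Qed.

Lemma sg_opp n x : sg n (- x) = - sg n x.
Proof. by rewrite /sg; case: odd. Qed.

Lemma sg_0 n : sg n (0 : V) = 0.
Proof. by rewrite /sg; case: odd; rewrite ?oppr0. Qed.

Lemma sgK n x : sg n (sg n x) = x.
Proof. by rewrite /sg; case: odd; rewrite ?opprK. Qed.

Lemma sg_sum n (I : Type) (r : seq I) (F : I -> V) :
  sg n (\sum_(i <- r) F i) = \sum_(i <- r) sg n (F i).
Proof. by rewrite /sg; case: odd; rewrite ?sumrN. Qed.

Lemma sgE n x : x *~ (-1) ^+ n = sg n x.
Proof. by rewrite /sg -signr_odd; case: odd; rewrite ?expr1 ?mulrN1z ?expr0. Qed.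

Lemma sgS n x : sg n.+1 x = - sg n x.
Proof. by rewrite -addn1 addnC sgD. Qed.

Lemma sgM (W : zmodType) (f : V -> W) n x :
  additive_fun f -> f (sg n x) = sg n (f x).
Proof.
move=> fD; rewrite /sg; case: odd => //; apply/eqP; rewrite -subr_eq0 opprK.
have f0 : f 0 = 0 by apply: (@addrI _ (f 0)); rewrite -fD !addr0.
by rewrite -fD addNr f0.
Qed.

End Sign.

(** * Deciding identities between sums with symbolic signs *)

(** A reflexive decision procedure: the parities of the atomic exponents range
    over all assignments, and for each of them the integer coefficients of the
    two sides are compared. *)
Inductive parity := PVar of nat | PZero | PSucc of parity
  | PAdd of parity & parity | PMul of parity & parity.

Inductive zexp := ZVar of nat | ZZero | ZAdd of zexp & zexp | ZOpp of zexp
  | ZSign of parity & zexp.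

Fixpoint peval (env : seq nat) (p : parity) : nat :=
  match p with
  | PVar n => nth 0%N env n
  | PZero => 0
  | PSucc p1 => (peval env p1).+1
  | PAdd p1 p2 => peval env p1 + peval env p2
  | PMul p1 p2 => peval env p1 * peval env p2
  end.

Fixpoint podd (env : seq bool) (p : parity) : bool :=
  match p with
  | PVar n => nth false env n
  | PZero => false
  | PSucc p1 => ~~ podd env p1
  | PAdd p1 p2 => podd env p1 (+) podd env p2
  | PMul p1 p2 => podd env p1 && podd env p2
  end.

Fixpoint zeval (V : zmodType) (penv : seq nat) (env : seq V) (e : zexp) : V :=
  match e with
  | ZVar n => nth 0 env n
  | ZZero => 0
  | ZAdd e1 e2 => zeval penv env e1 + zeval penv env e2
  | ZOpp e1 => - zeval penv env e1
  | ZSign p e1 => sg (peval penv p) (zeval penv env e1)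
  end.

Fixpoint zcoef (penv : seq bool) (e : zexp) (n : nat) : int :=
  match e with
  | ZVar m => (m == n)%:R
  | ZZero => 0
  | ZAdd e1 e2 => zcoef penv e1 n + zcoef penv e2 n
  | ZOpp e1 => - zcoef penv e1 n
  | ZSign p e1 => if podd penv p then - zcoef penv e1 n else zcoef penv e1 n
  end.

Fixpoint assignments (n : nat) : seq (seq bool) :=
  if n is n'.+1 then
    [seq true :: s | s <- assignments n'] ++ [seq false :: s | s <- assignments n']
  else [:: [::]].

Lemma mem_assignments (s : seq bool) : s \in assignments (size s).
Proof.
elim: s => [|b s IH] //=; rewrite mem_cat; apply/orP.
by case: b; [left | right]; apply/mapP; exists s.
Qed.

Lemma peval_odd (env : seq nat) p : odd (peval env p) = podd (map odd env) p.
Proof.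
elim: p => [n||p IH|p1 IH1 p2 IH2|p1 IH1 p2 IH2] //=.
- have [lt_n|le_n] := ltnP n (size env); first by rewrite (nth_map 0%N).
  by rewrite !nth_default ?size_map.
- by rewrite IH.
- by rewrite oddD IH1 IH2.
- by rewrite oddM IH1 IH2.
Qed.

Lemma zevalE (V : zmodType) (penv : seq nat) (env : seq V) e :
  zeval penv env e = \sum_(n < size env) env`_n *~ zcoef (map odd penv) e n.
Proof.
elim: e => [m||e1 IH1 e2 IH2|e IH|p e IH] /=.
- have [lt_m|le_m] := ltnP m (size env).
    rewrite (bigD1 (Ordinal lt_m)) //= eqxx big1 ?addr0 // => i.
    by rewrite -val_eqE /= eq_sym => /negbTE->; rewrite mulr0z.
  rewrite nth_default // big1 // => i _.
  by rewrite gtn_eqF ?mulr0z // (leq_trans (ltn_ord i)).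
- by rewrite big1 // => i _; rewrite mulr0z.
- by rewrite IH1 IH2 -big_split; apply: eq_bigr => i _; rewrite mulrzDr.
- by rewrite IH -sumrN; apply: eq_bigr => i _; rewrite mulrNz.
- rewrite /sg peval_odd IH; case: podd => //.
  by rewrite -sumrN; apply: eq_bigr => i _; rewrite mulrNz.
Qed.

Lemma zeval_eq (V : zmodType) (penv : seq nat) (env : seq V) e1 e2 :
  all (fun s => all (fun n => zcoef s e1 n == zcoef s e2 n) (iota 0 (size env)))
    (assignments (size penv)) ->
  zeval penv env e1 = zeval penv env e2.
Proof.
move=> /allP h; rewrite !zevalE; apply: eq_bigr => i _.
congr (_ *~ _); apply/eqP.
have /h/allP : map odd penv \in assignments (size penv).
  by rewrite -(size_map odd) mem_assignments.
by apply; rewrite mem_iota /=.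
Qed.

Create HintDb atoms discriminated.
#[global] Hint Unfold word : atoms.

Ltac zmem x env :=
  lazymatch env with
  | nil => constr:(false)
  | ?y :: ?r =>
    match constr:(Set) with
    | _ => let _ := match constr:(Set) with _ => unify x y with atoms end in
           constr:(true)
    | _ => zmem x r
    end
  end.

Ltac zindex x env :=
  lazymatch env with
  | ?y :: ?r =>
    match constr:(Set) with
    | _ => let _ := match constr:(Set) with _ => unify x y with atoms end in
           constr:(0%N)
    | _ => let n := zindex x r in constr:(S n)
    end
  end.

Ltac zadd x env :=
  lazymatch zmem x env with true => env | false => constr:(x :: env) end.

Ltac penv env n :=
  lazymatch n with
  | addn ?a ?b => let e := penv env a in penv e b
  | muln ?a ?b => let e := penv env a in penv e b
  | S ?a => penv env a
  | O => env
  | _ => zadd n env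
  end.

Ltac pquote env n :=
  lazymatch n with
  | addn ?a ?b => let x := pquote env a in let y := pquote env b in constr:(PAdd x y)
  | muln ?a ?b => let x := pquote env a in let y := pquote env b in constr:(PMul x y)
  | S ?a => let x := pquote env a in constr:(PSucc x)
  | O => constr:(PZero)
  | _ => let i := zindex n env in constr:(PVar i)
  end.

Ltac zpenv env t :=
  lazymatch t with
  | ?a + ?b => let e := zpenv env a in zpenv e b
  | - ?a => zpenv env a
  | sg ?n ?a => let e := penv env n in zpenv e a
  | _ => env
  end.

Ltac zenv env t :=
  lazymatch t with
  | ?a + ?b => let e := zenv env a in zenv e b
  | - ?a => zenv env a
  | sg _ ?a => zenv env a
  | 0 => env
  | _ => zadd t env
  end.

Ltac zquote pe env t :=
  lazymatch t with
  | ?a + ?b =>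
    let x := zquote pe env a in let y := zquote pe env b in constr:(ZAdd x y)
  | - ?a => let x := zquote pe env a in constr:(ZOpp x)
  | sg ?n ?a =>
    let p := pquote pe n in let x := zquote pe env a in constr:(ZSign p x)
  | 0 => constr:(ZZero)
  | _ => let n := zindex t env in constr:(ZVar n)
  end.

(* compares two sums of signed terms by going through the possible parities    *)
Ltac signs :=
  lazymatch goal with
  | |- @eq ?T ?l ?r =>
    let p0 := zpenv (@nil nat) l in
    let pe := zpenv p0 r in
    let e0 := zenv (@nil T) l in
    let env := zenv e0 r in
    let x := zquote pe env l in let y := zquote pe env r in
    apply: (@zeval_eq _ pe env x y); vm_compute; reflexivity
  end.

(** * Dimensions of words *)

Section Dim.
Variable X : Type.
Implicit Types (b c : seq X) (w : word X).

Lemma wdim_nil : wdim ([::] : word X) = 0%N.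
Proof. by rewrite /wdim big_nil. Qed.

Lemma wdim_cons c w : wdim (c :: w) = (bdim c + wdim w)%N.
Proof. by rewrite /wdim big_cons. Qed.

Lemma wdim_cat w1 w2 : wdim (w1 ++ w2) = (wdim w1 + wdim w2)%N.
Proof. by rewrite /wdim big_cat. Qed.

Lemma bdim_map (Y : Type) (f : X -> Y) b : bdim (map f b) = bdim b.
Proof. by rewrite /bdim size_map. Qed.

Lemma wdim_map (Y : Type) (f : X -> Y) w : wdim (map (map f) w) = wdim w.
Proof. by rewrite /wdim big_map; apply: eq_bigr => b _; rewrite bdim_map. Qed.

End Dim.

(** Merging an empty block would not raise the dimension by one, so most
    identities below hold only for words without empty blocks. *)
Definition wne (X : eqType) (w : word X) := all (fun b => b != [::]) w.

Lemma size_bdim (X : eqType) (b : seq X) : b != [::] -> size b = (bdim b).+1.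
Proof. by case: b. Qed.

Lemma bdim_cat (X : eqType) (b c : seq X) : b != [::] -> c != [::] ->
  bdim (b ++ c) = (bdim b + bdim c).+1.
Proof. by case: b c => [|x b] [|y c] //= _ _; rewrite /bdim /= size_cat /= addnS. Qed.

Lemma cat_ne (X : eqType) (b c : seq X) : b != [::] -> b ++ c != [::].
Proof. by case: b. Qed.

(** * Shuffles *)

Section Shuffle.
Variables (X : eqType) (V : zmodType).
Implicit Types (phi psi : word X -> V) (s t r w : word X) (b c : seq X).

(** The value of phi, extended linearly, on the shuffle product of s and t. *)
Definition shuf phi s t : V := \sum_(u <- shuffles s t) sg u.1 (phi u.2).

Lemma shuf0s phi t : shuf phi [::] t = phi t.
Proof. by rewrite /shuf; case: t => [|c t]; rewrite /= big_seq1. Qed.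

Lemma shufs0 phi s : shuf phi s [::] = phi s.
Proof. by rewrite /shuf; case: s => [|c t]; rewrite /= big_seq1. Qed.

Lemma shufSS phi b c s t :
  shuf phi (b :: s) (c :: t) = shuf (phi \o cons b) s (c :: t)
    + sg (bdim c * wdim (b :: s)) (shuf (phi \o cons c) (b :: s) t).
Proof.
rewrite /shuf /= big_cat !big_map /=; congr (_ + _).
by rewrite sg_sum; apply: eq_bigr => u _ /=; rewrite addnC sgD.
Qed.

Lemma shufD phi psi s t :
  shuf (fun u => phi u + psi u) s t = shuf phi s t + shuf psi s t.
Proof. by rewrite /shuf -big_split; apply: eq_bigr => u _; rewrite sg_add. Qed.

Lemma shuf_sg n phi s t : shuf (fun u => sg n (phi u)) s t = sg n (shuf phi s t).
Proof.
by rewrite /shuf sg_sum; apply: eq_bigr => u _; rewrite -!sgD addnC.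
Qed.

Lemma shuf_opp phi s t : shuf (fun u => - phi u) s t = - shuf phi s t.
Proof. exact: (shuf_sg 1). Qed.

Lemma shuf_0 s t : shuf (fun=> 0) s t = 0.
Proof. by rewrite /shuf big1 // => u _; rewrite sg_0. Qed.

Lemma shuffles_perm s t u : u \in shuffles s t -> perm_eq u.2 (s ++ t).
Proof.
elim: s t u => [|b s IHs] t u.
  by case: t => [|c t] /=; rewrite inE => /eqP->.
elim: t u => [|c t IHt] u; first by rewrite inE cats0 => /eqP->.
rewrite mem_cat => /orP[] /mapP[u0 hu ->] /=.
  by rewrite perm_cons; apply: IHs.
by rewrite -cat_cons perm_sym perm_catC /= perm_cons perm_catC perm_sym IHt.
Qed.

Lemma eq_shuf phi psi s t :
  (forall u, perm_eq u (s ++ t) -> phi u = psi u) -> shuf phi s t = shuf psi s t.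
Proof.
move=> h; rewrite /shuf big_seq [RHS]big_seq; apply: eq_bigr => u hu.
by rewrite h // shuffles_perm.
Qed.

Lemma perm_wdim s t : perm_eq s t -> wdim s = wdim t.
Proof. by move=> h; rewrite /wdim; apply: perm_big. Qed.

Lemma perm_wne s t : perm_eq s t -> wne s = wne t.
Proof. by move=> h; rewrite /wne; apply: perm_all. Qed.

(** A block c of t which moves in front of the rest of s contributes
    the product of their dimensions, symmetrically in s and t. *)
Lemma shufC phi s t : shuf phi s t = sg (wdim s * wdim t) (shuf phi t s).
Proof.
elim: s t phi => [|b s IHs] t phi; first by rewrite shuf0s shufs0 wdim_nil.
elim: t phi => [|c t IHt] phi; first by rewrite shuf0s shufs0 wdim_nil muln0.
rewrite !shufSS IHs IHt !wdim_cons; signs.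
Qed.

(** Both sides are the sum of phi over the shuffles of three words: expanding
    by the first block gives three terms, and the induction hypothesis applies
    to each of them, with phi replaced by phi after prepending this block. *)
Lemma shufA phi s t r :
  shuf (fun u => shuf phi u r) s t = shuf (fun u => shuf phi s u) t r.
Proof.
elim: s t r phi => [|b s IHs] t r phi.
  rewrite shuf0s; apply: eq_shuf => u _; by rewrite shuf0s.
elim: t r phi => [|c t IHt] r phi; first by rewrite shuf0s shufs0.
elim: r phi => [|e r IHr] phi.
  by rewrite shufs0; apply: eq_shuf => u _; rewrite shufs0.
have E1 : shuf ((fun u => shuf phi u (e :: r)) \o cons b) s (c :: t) =
    shuf (fun u => shuf (phi \o cons b) u (e :: r)) s (c :: t)
    + sg (bdim e * (wdim (b :: s) + wdim (c :: t)))
       (shuf ((fun u => shuf (phi \o cons e) u r) \o cons b) s (c :: t)).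
  rewrite -shuf_sg -shufD; apply: eq_shuf => u /perm_wdim hu /=.
  by rewrite shufSS !wdim_cons hu wdim_cat wdim_cons addnA.
have E2 : shuf ((fun u => shuf phi u (e :: r)) \o cons c) (b :: s) t =
    shuf (fun u => shuf (phi \o cons c) u (e :: r)) (b :: s) t
    + sg (bdim e * (wdim (b :: s) + wdim (c :: t)))
       (shuf ((fun u => shuf (phi \o cons e) u r) \o cons c) (b :: s) t).
  rewrite -shuf_sg -shufD; apply: eq_shuf => u /perm_wdim hu /=.
  by rewrite shufSS !wdim_cons hu wdim_cat wdim_cons addnCA !addnA.
have E3 d : (fun u => shuf phi (b :: s) u) \o cons d =
    (fun u => shuf (phi \o cons b) s (d :: u)
      + sg (bdim d * wdim (b :: s)) (shuf (phi \o cons d) (b :: s) u)).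
  by apply/funext => u /=; rewrite shufSS.
rewrite shufSS E1 E2 [RHS]shufSS !E3 !shufD !shuf_sg.
rewrite IHs IHt -IHr [shuf _ (c :: t) (e :: r)]shufSS.
rewrite [X in _ = _ + sg _ (_ + sg _ X)]shufSS.
rewrite /comp !wdim_cons; signs.
Qed.

End Shuffle.

(** * Antisymmetric functions of words *)

Section Alternating.
Variables (X : Type) (V : zmodType).
Implicit Types (phi psi : word X -> V) (s t r w : word X) (b c : seq X).

(** Functions of words which factor through the antisymmetry relations; the two
    letters are allowed to coincide. *)
Definition alternating phi := forall (A B : word X) (u v : seq X) (x y : X),
  phi (A ++ (u ++ x :: y :: v) :: B) = - phi (A ++ (u ++ y :: x :: v) :: B).

Lemma alternating_cons phi c : alternating phi -> alternating (phi \o cons c).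
Proof. by move=> h A B u v x y /=; rewrite -!cat_cons h. Qed.

Lemma alternating_catl phi c :
  alternating phi -> forall B u v x y,
  phi ((c ++ u ++ x :: y :: v) :: B) = - phi ((c ++ u ++ y :: x :: v) :: B).
Proof. by move=> h B u v x y; rewrite !catA; apply: (h [::]). Qed.

Lemma alternating_move phi A B u v x b : alternating phi ->
  phi (A ++ (u ++ x :: b ++ v) :: B) =
  sg (size b) (phi (A ++ (u ++ b ++ x :: v) :: B)).
Proof.
move=> h; elim: b u => [|y b IH] u //=; rewrite h.
have := IH (rcons u y); rewrite !cat_rcons => ->.
by rewrite -[(size b).+1]addn1 sgD /= -sg_opp.
Qed.

(** Exchanging two factors of a block permutes size b * size c pairs of letters. *)
Lemma alternating_swap phi A B u v b c : alternating phi ->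
  phi (A ++ (u ++ b ++ c ++ v) :: B) =
  sg (size b * size c) (phi (A ++ (u ++ c ++ b ++ v) :: B)).
Proof.
move=> h; elim: b u => [|x b IH] u //=.
have := IH (rcons u x); rewrite !cat_rcons => ->.
by rewrite alternating_move // -sgD mulSn addnC.
Qed.

End Alternating.

Section ShuffleAlternating.
Variables (X : eqType) (V : zmodType).
Implicit Types (phi psi : word X -> V) (s t r w : word X) (b c : seq X).

Lemma wdim_swap (A B : word X) (u v : seq X) (x y : X) :
  wdim (A ++ (u ++ x :: y :: v) :: B) = wdim (A ++ (u ++ y :: x :: v) :: B).
Proof. by rewrite !wdim_cat !wdim_cons /bdim !size_cat. Qed.

Lemma shuf_altl phi t : alternating phi -> alternating (fun s => shuf phi s t).
Proof.
move=> h A B u v x y; elim: A t phi h => [|a A IH] t phi h.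
  elim: t phi h => [|c t IHt] phi h; first by rewrite !shufs0 (h [::]).
  rewrite !shufSS (IHt _ (alternating_cons c h)) sg_opp opprD.
  have := wdim_swap [::] B u v x y => /= ->; congr (_ - _).
  by rewrite [LHS]/shuf [in RHS]/shuf -sumrN; apply: eq_bigr => w _;
     rewrite /= (h [::]) sg_opp.
elim: t phi h => [|c t IHt] phi h; first by rewrite !shufs0 h.
rewrite !cat_cons !shufSS (IH _ _ (alternating_cons a h)) opprD.
by rewrite -!cat_cons (IHt _ (alternating_cons c h)) sg_opp wdim_swap.
Qed.

Lemma shuf_altr phi s : alternating phi -> alternating (shuf phi s).
Proof.
move=> h A B u v x y; rewrite shufC [in RHS]shufC wdim_swap.
by rewrite (shuf_altl s h) sg_opp.
Qed.

End ShuffleAlternating.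

(** * The differential *)

Section Differential.
Variables (X : eqType) (V : zmodType).
Implicit Types (phi psi : word X -> V) (s t r w : word X) (b c : seq X).

(** The contribution to the differential of merging c with the first block of w. *)
Definition merge_first c phi w : V :=
  if w is e :: w' then phi ((c ++ e) :: w') else 0.

(** The recursion peels off the first block: either it is merged with the next
    one, or a later pair is merged, and in both cases its dimension counts in
    the sign. *)
Fixpoint dword phi w : V :=
  if w is c :: w' then
    sg (bdim c) (merge_first c phi w' + dword (phi \o cons c) w')
  else 0.

Lemma dword_cons phi c w : dword phi (c :: w) =
  sg (bdim c) (merge_first c phi w + dword (phi \o cons c) w).
Proof. by []. Qed.

Lemma merge_firstD c phi psi w :
  merge_first c (fun u => phi u + psi u) w =
  merge_first c phi w + merge_first c psi w.
Proof. by case: w => [|e w] //=; rewrite addr0. Qed.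

Lemma dwordD phi psi w :
  dword (fun u => phi u + psi u) w = dword phi w + dword psi w.
Proof.
elim: w phi psi => [|c w IH] phi psi /=; first by rewrite addr0.
by rewrite merge_firstD (IH (phi \o cons c)) -sg_add; congr (sg _ _); signs.
Qed.

(** Records the invariants of the words occurring in the differential. *)
Lemma eq_dword phi psi w : wne w ->
  (forall u, wne u -> wdim u = (wdim w).+1 -> flatten u = flatten w ->
     phi u = psi u) ->
  dword phi w = dword psi w.
Proof.
elim: w phi psi => [|c w IH] phi psi //= /andP[cn wn] h; congr (sg _ (_ + _)).
  case: w wn h {IH} => [|e w] //= /andP[en wn] h; apply: h => /=.
  - by rewrite cat_ne.
  - by rewrite !wdim_cons bdim_cat // addSn addnA.
  - by rewrite catA.
apply: IH => // u un ud uf; apply: h => /=; rewrite ?cn ?un ?uf //.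
by rewrite !wdim_cons ud addnS.
Qed.

Lemma dword_sg n phi w : dword (fun u => sg n (phi u)) w = sg n (dword phi w).
Proof.
elim: w phi => [|c w IH] phi /=; first by rewrite sg_0.
rewrite (IH (phi \o cons c)) -!sgD addnC sgD; congr (sg _ _).
by rewrite sg_add; congr (_ + _); case: w {IH} => [|e w]; rewrite /= ?sg_0.
Qed.

Lemma dword_0 w : dword (fun=> 0) w = 0.
Proof.
elim: w => [|c w IH] //=; rewrite IH addr0.
by case: w {IH} => [|e w]; rewrite /= sg_0.
Qed.

Lemma dword_alt phi : alternating phi -> alternating (dword phi).
Proof.
move=> h A B u v x y; elim: A phi h => [|a A IH] phi h.
  rewrite /= -sg_opp /bdim !size_cat /=; congr (sg _ _).
  rewrite opprD; congr (_ + _).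
    by case: B => [|e B] /=; rewrite ?oppr0 // -!catA /= (h [::]).
  elim: B phi h => [|e B IHB] phi h /=; first by rewrite oppr0.
  rewrite -sg_opp opprD; congr (sg _ (_ + _)).
    by case: B {IHB} => [|f B] /=; rewrite ?oppr0 // (h [::]).
  suff -> : (phi \o cons (u ++ [:: x, y & v])) \o cons e =
      (fun w => - phi ((u ++ [:: y, x & v]) :: e :: w)).
    have : forall psi w, dword (fun w => - psi w) w = - dword psi w.
      move=> psi w; have := dword_sg 1 psi w; by rewrite /sg.
    by move=> ->.
  by apply/funext => w /=; rewrite (h [::]).
rewrite /= (IH _ (alternating_cons a h)) -sg_opp opprD.
congr (sg _ (_ + _)); case: A {IH} => [|e A] /=; last by rewrite -cat_cons h.
by rewrite (alternating_catl a h).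
Qed.

Lemma shuf_merge_first c phi s t :
  shuf (merge_first c phi) s t =
    (if s is e :: s' then shuf (phi \o cons (c ++ e)) s' t else 0)
    + (if t is f :: t' then
         sg (bdim f * wdim s) (shuf (phi \o cons (c ++ f)) s t') else 0).
Proof.
case: s => [|e s]; first by rewrite shuf0s add0r; case: t => [|f t] //=;
  rewrite shuf0s wdim_nil muln0.
by case: t => [|f t]; rewrite ?shufs0 ?addr0 ?shufSS.
Qed.

(** A merge inside a shuffle joins two blocks of s, two blocks of t, or a block
    of each; the terms of the last kind come in pairs b c and c b whose signs
    are opposite, since b and c anticommute like elements of degrees
    bdim b + 1 and bdim c + 1. *)
Lemma shuf_dword phi s t : alternating phi -> wne s -> wne t ->
  shuf (dword phi) s t =
    dword (fun u => shuf phi u t) s + sg (wdim s) (dword (shuf phi s) t).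
Proof.
elim: s t phi => [|b s IHs] t phi hphi sn tn.
  rewrite shuf0s /= add0r wdim_nil; apply: eq_dword => // u _ _ _.
  by rewrite shuf0s.
elim: t phi hphi tn => [|c t IHt] phi hphi tn.
  rewrite shufs0 [dword (shuf phi (b :: s)) _]/= sg_0 addr0.
  by apply: eq_dword => // u _ _ _; rewrite shufs0.
have /andP[bn sn'] := sn; have /andP[cn tn'] := tn.
have ED d : dword phi \o cons d =
    (fun u => sg (bdim d) (merge_first d phi u + dword (phi \o cons d) u)).
  by apply/funext => u.
rewrite shufSS (ED b) (ED c) !shuf_sg !shufD !shuf_merge_first.
rewrite (IHs _ _ (alternating_cons b hphi)) // (IHt _ (alternating_cons c hphi)) //.
have E1 : dword (fun u => shuf phi u (c :: t)) (b :: s) =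
    sg (bdim b) ((if s is e :: s' then shuf (phi \o cons (b ++ e)) s' (c :: t) else 0)
     + dword (fun u => shuf (phi \o cons b) u (c :: t)) s)
    + sg (bdim c * (wdim (b :: s)).+1)
       (dword (fun u => shuf (phi \o cons c) u t) (b :: s)).
  rewrite -[in RHS]dword_sg dword_cons.
  have -> : (fun u => shuf phi u (c :: t)) \o cons b = (fun u =>
      shuf (phi \o cons b) u (c :: t) +
      sg (bdim c * wdim (b :: u)) (shuf (phi \o cons c) (b :: u) t)).
    by apply/funext => u /=; rewrite shufSS.
  rewrite dwordD dword_cons.
  rewrite [dword (fun u => sg (bdim c * wdim (b :: u)) _) s](eq_dword
     (psi := (fun u => sg (bdim c * (wdim (b :: s)).+1) (shuf (phi \o cons c) u t)) \o cons b)) //; last first.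
    by move=> u _ hu _ /=; rewrite !wdim_cons hu addnS.
  rewrite -sg_add; congr (sg _ _).
  case: s sn sn' {IHs} IHt => [|e s] sn sn' IHt /=; first by signs.
  rewrite shufSS !wdim_cons bdim_cat //; first by rewrite /comp; signs.
  by case/andP: sn'.
have E2 : dword (shuf phi (b :: s)) (c :: t) =
    dword (fun u => shuf (phi \o cons b) s u) (c :: t)
    + sg (bdim c + bdim c * wdim (b :: s)) (
       (if t is f :: t' then
         sg (bdim f * wdim (b :: s) + wdim (b :: s)) (shuf (phi \o cons (c ++ f)) (b :: s) t') else 0)
       + dword (fun u => shuf (phi \o cons c) (b :: s) u) t).
  rewrite !dword_cons.
  have -> : shuf phi (b :: s) \o cons c = (fun u =>
      shuf (phi \o cons b) s (c :: u) +
      sg (bdim c * wdim (b :: s)) (shuf (phi \o cons c) (b :: s) u)).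
    by apply/funext => u /=; rewrite shufSS.
  rewrite dwordD dword_sg sgD -sg_add; congr (sg _ _).
  case: t tn tn' {IHt} IHs E1 => [|f t] tn tn' IHs E1 /=.
    by rewrite !(addr0, sg_0).
  rewrite shufSS bdim_cat //; last by case/andP: tn'.
  by rewrite /comp; signs.
have E3 : shuf (phi \o cons (c ++ b)) s t =
    sg (size b * size c) (shuf (phi \o cons (b ++ c)) s t).
  rewrite -shuf_sg; apply: eq_shuf => u _ /=.
  have := alternating_swap [::] u [::] [::] c b hphi.
  by rewrite /= !cats0 mulnC.
rewrite E1 E2 E3 !size_bdim // !wdim_cons.
set SE := match s with [::] => 0 | _ => _ end.
clear E1 E2 E3 ED IHs IHt.
case: t tn tn' @SE => [|f t] tn tn' SE; rewrite /comp ?wdim_cons; signs.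
Qed.

End Differential.

(** * Partial composition *)

Section Hole.
Variable X : eqType.
Implicit Types (b c e : seq X) (i : X).

(** The number of letters after i in c; moving i to the end of c costs this many
    transpositions. *)
Definition after i c := (size c - index i c).-1.

Lemma rem_cat i c e :
  rem i (c ++ e) = if i \in c then rem i c ++ e else c ++ rem i e.
Proof.
elim: c => [|x c IH] //=; rewrite in_cons IH eq_sym.
by case: eqP => //= _; case: ifP.
Qed.

Lemma after_catl i c e : i \in c -> after i (c ++ e) = (after i c + size e)%N.
Proof.
by move=> ic; rewrite /after index_cat ic size_cat; move: ic; rewrite -index_mem; lia.
Qed.

Lemma after_catr i c e : i \notin c -> after i (c ++ e) = after i e.
Proof. by move=> /negbTE ic; rewrite /after index_cat ic size_cat subnDl. Qed.

Lemma bdim_rem_cat i c e : i \in c -> e != [::] ->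
  bdim (rem i c ++ e) = (bdim c + bdim e)%N.
Proof.
by move=> ic; rewrite /bdim size_cat size_rem //; case: e => //= y e _; rewrite addnS.
Qed.

End Hole.

Section Composition.
Variables (X : eqType) (V : zmodType).
Implicit Types (phi psi : word X -> V) (p m n s t w : word X) (b c : seq X) (i j : X).

(** The value of phi on the composition of p with m at i. The letters of p other
    than i and those of m live in the same type. *)
Fixpoint cword i m phi p : V :=
  if p is c :: p' then
    if i \in c then
      sg (after i c + bdim (head [::] m) * wdim p')
        (shuf (fun u => phi ((rem i c ++ head [::] m) :: u)) p' (behead m))
    else cword i m (phi \o cons c) p'
  else 0.

Lemma cword_hit i m phi c p : i \in c -> cword i m phi (c :: p) =
  sg (after i c + bdim (head [::] m) * wdim p)
     (shuf (phi \o cons (rem i c ++ head [::] m)) p (behead m)).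
Proof. by move=> ic /=; rewrite ic. Qed.

Lemma cword_miss i m phi c p : i \notin c ->
  cword i m phi (c :: p) = cword i m (phi \o cons c) p.
Proof. by move=> /negbTE ic /=; rewrite ic. Qed.

Lemma cwordD i m phi psi p :
  cword i m (fun u => phi u + psi u) p = cword i m phi p + cword i m psi p.
Proof.
elim: p phi psi => [|c p IH] phi psi /=; first by rewrite addr0.
case: ifP => _; last exact: (IH (phi \o cons c)).
by rewrite -sg_add -shufD.
Qed.

Lemma cword_sg k i m phi p :
  cword i m (fun u => sg k (phi u)) p = sg k (cword i m phi p).
Proof.
elim: p phi => [|c p IH] phi /=; first by rewrite sg_0.
case: ifP => _; last exact: (IH (phi \o cons c)).
by rewrite shuf_sg -!sgD addnC.
Qed.

Lemma cword_opp i m phi p : cword i m (fun u => - phi u) p = - cword i m phi p.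
Proof. exact: (cword_sg 1). Qed.

(** Records the invariants of the words occurring in a composition. *)
Lemma eq_cword i m phi psi p : m != [::] -> wne m ->
  (forall u, wdim u = (wdim p + wdim m)%N ->
     perm_eq (i :: flatten u) (flatten p ++ flatten m) ->
     (wne p -> wne u) -> phi u = psi u) ->
  cword i m phi p = cword i m psi p.
Proof.
case: m => // m1 M _ /= /andP[m1n Mn].
elim: p phi psi => [|c p IH] phi psi //= h; case: ifP => ic; last first.
  apply: IH => u hu pu wu; apply: h => /=.
  - by rewrite !wdim_cons hu wdim_cons !addnA.
  - rewrite -catA -(perm_cat2l c) in pu *; apply: perm_trans pu.
    by rewrite -cat1s perm_catCA.
  - by move=> /andP[-> /wu].
congr sg; apply: eq_shuf => u pu; apply: h => /=.
- rewrite !wdim_cons bdim_rem_cat // (perm_wdim pu) wdim_cat; lia.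
- have := perm_flatten pu; rewrite flatten_cat => pf.
  rewrite -!catA -cat_cons; apply: perm_cat; first by rewrite perm_sym perm_to_rem.
  by rewrite perm_sym perm_catCA perm_cat2l perm_sym.
- move=> /andP[cn pn]; rewrite (perm_wne pu) /wne all_cat.
  rewrite -!/(wne _) pn Mn !andbT.
  by move: m1n; case: (m1) => // a l _; case: (rem _ _).
Qed.

Lemma cword_altr i phi p : alternating phi -> alternating (fun m => cword i m phi p).
Proof.
elim: p phi => [|c p IH] phi hphi A B u v x y /=; first by rewrite oppr0.
case: ifP => _; last by apply: IH; apply: alternating_cons.
case: A => [|a A] /=; last by rewrite (shuf_altr p (alternating_cons _ hphi)) sg_opp.
rewrite /bdim !size_cat /= -sg_opp -shuf_opp; congr sg.
by apply: eq_shuf => w _; rewrite /= (alternating_catl _ hphi).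
Qed.

(** The sign [after i c] compensates for the position of i in its block. *)
Lemma cword_altl i m phi (A B : word X) (u v : seq X) (x y : X) :
  alternating phi -> uniq (flatten (A ++ (u ++ x :: y :: v) :: B)) ->
  cword i m phi (A ++ (u ++ x :: y :: v) :: B) =
  - cword i m phi (A ++ (u ++ y :: x :: v) :: B).
Proof.
elim: A phi => [|a A IH] phi hphi; last first.
  move=> /= Uf; have U : uniq (flatten (A ++ (u ++ [:: x, y & v]) :: B)).
    by move: Uf; rewrite cat_uniq => /and3P[].
  case: ifP => _; last by rewrite IH //; apply: alternating_cons.
  have h := alternating_cons (rem i a ++ head [::] m) hphi.
  by rewrite (shuf_altl _ h) wdim_swap sg_opp.
rewrite /= cat_uniq => /andP[Ub _].
have -> : (i \in u ++ [:: y, x & v]) = (i \in u ++ [:: x, y & v]).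
  by rewrite !mem_cat !inE; do !bool_congr.
case: ifP => ib; last first.
  rewrite -cword_opp; congr cword; apply/funext => w /=.
  exact: (hphi [::]).
move: Ub; rewrite cat_uniq /= !inE negb_or => /and5P[Uu].
rewrite !negb_or => /and3P[xu yu vu] /andP[xy xv] yv Uv.
have [ix|nix] := eqVneq i x.
  subst i; rewrite /after !index_cat !rem_cat (negbTE xu) /=.
  rewrite !eqxx ?[y == x]eq_sym ?(negbTE xy) /= !size_cat /= !subnDl.
  by rewrite subn0 subn1 /= addSn sgS.
have [iy|niy] := eqVneq i y.
  subst i; rewrite /after !index_cat !rem_cat (negbTE yu) /=.
  rewrite !eqxx [x == y]eq_sym (negbTE nix) /= !size_cat /= !subnDl.
  by rewrite subn0 subn1 /= addSn sgS opprK.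
have -> : after i (u ++ [:: y, x & v]) = after i (u ++ [:: x, y & v]).
  by rewrite /after !index_cat /= !size_cat /= ![_ == i]eq_sym (negbTE nix) (negbTE niy).
rewrite -sg_opp; congr sg; rewrite -shuf_opp; apply: eq_shuf => w _.
rewrite /= !rem_cat /= ![_ == i]eq_sym (negbTE nix) (negbTE niy).
by case: ifP => _; rewrite -!catA /= (hphi [::]).
Qed.

(** The block of t containing j keeps its rank among the shuffled blocks, so one
    may compose before or after shuffling with s; associativity of shuffles
    moves s past the tail of n. *)
Lemma shuf_cword j n phi s t : n != [::] -> wne n ->
  j \notin flatten s -> j \in flatten t ->
  shuf (cword j n phi) s t = cword j n (shuf phi s) t.
Proof.
case: n => // n1 N _ /andP[n1n Nn].
elim: t s phi => [|c t IHt] s phi //=; rewrite mem_cat => js jt.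
elim: s phi js => [|b s IHs] phi /=.
  move=> _; rewrite shuf0s /=; case: ifP => jc.
    by congr sg; apply: eq_shuf => u _; rewrite shuf0s.
  by congr cword; apply/funext => u /=; rewrite shuf0s.
rewrite mem_cat negb_or => /andP[jb js].
have E k : cword k (n1 :: N) phi \o cons b =
  fun u => cword k (n1 :: N) phi (b :: u) by [].
rewrite shufSS; have -> : cword j (n1 :: N) phi \o cons b = cword j (n1 :: N) (phi \o cons b).
  by apply/funext => u /=; rewrite (negbTE jb).
rewrite IHs //; case: ifP => [jc|jc] /=.
  have -> : cword j (n1 :: N) phi \o cons c = (fun u =>
     sg (after j c + bdim n1 * wdim u)
       (shuf (phi \o cons (rem j c ++ n1)) u N)).
    by apply/funext => u /=; rewrite jc.
  rewrite [shuf _ (b :: s) t](eq_shuf (psi := fun u =>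
     sg (after j c + bdim n1 * (wdim (b :: s) + wdim t))
       (shuf (phi \o cons (rem j c ++ n1)) u N))); last first.
    by move=> u /perm_wdim hu; rewrite [in LHS]hu wdim_cat.
  rewrite shuf_sg shufA.
  rewrite [in RHS](eq_shuf (psi := fun u => shuf (phi \o cons b) s ((rem j c ++ n1) :: u)
     + sg ((bdim c + bdim n1) * wdim (b :: s)) (shuf (phi \o cons (rem j c ++ n1)) (b :: s) u)));
    last by move=> u _; rewrite shufSS bdim_rem_cat.
  by rewrite shufD shuf_sg !wdim_cons /comp; signs.
have -> : cword j (n1 :: N) phi \o cons c = cword j (n1 :: N) (phi \o cons c).
  by apply/funext => u /=; rewrite jc.
rewrite jc /= in jt; rewrite IHt //=; last by rewrite mem_cat negb_or jb.
rewrite -cword_sg -cwordD; congr cword; apply/funext => u /=.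
by rewrite shufSS.
Qed.

(** Deduced by commutativity; the composition raises the dimension of t by
    that of n, which explains the sign. *)
Lemma shuf_cwordl j n phi s t : n != [::] -> wne n ->
  j \notin flatten s -> j \in flatten t ->
  shuf (cword j n phi) t s =
  sg (wdim s * wdim n) (cword j n (fun u => shuf phi u s) t).
Proof.
move=> n0 nn js jt; rewrite shufC shuf_cword // -!cword_sg.
apply: eq_cword => // u hu _ _.
rewrite [in LHS]shufC hu; signs.
Qed.

(** In the block c holding i, a merge of the composed word joins c with a block
    of p or with a block of m, or is a merge inside the shuffled tail, to which
    [shuf_dword] applies. *)
Lemma cword_dword i m phi p : alternating phi -> m != [::] -> wne m -> wne p ->
  i \in flatten p -> uniq (flatten p) ->
  cword i m (dword phi) p =
    dword (cword i m phi) p + sg (wdim p) (dword (fun m' => cword i m' phi p) m).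
Proof.
move=> hphi; case: m => // m1 M _ mn; have /andP[m1n Mn] := mn.
elim: p phi hphi => [|c p IH] phi hphi // pn; have /andP[cn pn'] := pn.
rewrite [flatten _]/= mem_cat cat_uniq => /orP ip /and3P[Uc Ucp Up].
case ic: (i \in c); last first.
  have {}ip : i \in flatten p by case: ip => //; rewrite ic.
  have E1 psi : cword i (m1 :: M) psi \o cons c = cword i (m1 :: M) (psi \o cons c).
    by apply/funext => u /=; rewrite ic.
  have E2 : dword phi \o cons c =
     (fun u => sg (bdim c) (merge_first c phi u + dword (phi \o cons c) u)).
    by [].
  rewrite cword_miss ?ic // E2 cword_sg cwordD IH //; last exact: alternating_cons.
  rewrite [dword _ (c :: p)]dword_cons E1 wdim_cons.
  have -> : (fun m' => cword i m' phi (c :: p)) = (fun m' => cword i m' (phi \o cons c) p).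
    by apply/funext => m' /=; rewrite ic.
  suff -> : cword i (m1 :: M) (merge_first c phi) p = merge_first c (cword i (m1 :: M) phi) p.
    signs.
  case: p {IH pn pn' Ucp Up} ip => [|e p] //= ip.
  rewrite mem_cat ic /=; case: ifP => ie.
    by rewrite after_catr ?ic //; congr sg; apply: eq_shuf => u _; rewrite rem_cat ic catA.
  by congr cword; apply/funext.
have {ip} inp : i \notin flatten p.
  by apply: contra Ucp => ipp; apply/hasP; exists i.
clear IH Ucp Up; set k := rem i c ++ m1.
have E2 : dword phi \o cons k =
     (fun u => sg (bdim k) (merge_first k phi u + dword (phi \o cons k) u)).
  by [].
rewrite cword_hit // -/k [head _ _]/= [behead _]/= E2 shuf_sg shufD shuf_merge_first.
rewrite shuf_dword //; last exact: alternating_cons.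
rewrite [dword _ (c :: p)]dword_cons.
rewrite [dword (_ \o cons c) p](eq_dword (psi := fun u =>
   sg (after i c + bdim m1 * (wdim p).+1) (shuf (phi \o cons k) u M))) //; last first.
  by move=> u _ hu _ /=; rewrite ic hu.
rewrite dword_sg.
rewrite [dword _ (m1 :: M)]dword_cons.
rewrite [dword (_ \o cons m1) M](eq_dword (psi := fun M' =>
   sg (after i c + bdim m1 * wdim p) (shuf (phi \o cons k) p M'))) //; last first.
  by move=> u _ hu _ /=; rewrite ic.
rewrite dword_sg.
have -> : merge_first m1 (fun m' => cword i m' phi (c :: p)) M =
   (if M is f :: M' then
     sg (after i c + (bdim m1 + bdim f).+1 * wdim p) (shuf (phi \o cons (k ++ f)) p M')
    else 0).
  case: M mn Mn => [|f M] //= mn /andP[fn _].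
  by rewrite ic bdim_cat //; congr sg; apply: eq_shuf => u _; rewrite /k catA.
have -> : merge_first c (cword i (m1 :: M) phi) p =
   (if p is e :: p' then
     sg (after i c + size e + bdim m1 * wdim p' + size e * size m1)
        (shuf (phi \o cons (k ++ e)) p' M)
    else 0).
  case: p {pn inp} pn' => [|e p] //= /andP[en _].
  rewrite mem_cat ic /= after_catl // [in RHS]sgD -[sg (size e * _) _]shuf_sg.
  congr sg.
  apply: eq_shuf => u _ /=; rewrite rem_cat ic /k -!catA.
  by have := alternating_swap [::] u (rem i c) [::] e m1 hphi; rewrite !cats0.
have -> : bdim k = (bdim c + bdim m1)%N by rewrite bdim_rem_cat.
rewrite wdim_cons.
case: p pn pn' {inp} => [|e p] pn pn'; case: M mn Mn => [|f M] mn Mn;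
  rewrite ?wdim_cons ?wdim_nil ?sg_0;
  try (have -> : size e = (bdim e).+1 by apply: size_bdim; case/andP: pn');
  rewrite ?(size_bdim m1n) /=; signs.
Qed.

(** If j lies in the first block of m, both sides are a shuffle of the tails of
    p, m and n; if not, j stays in the tail of m and [shuf_cword] applies. *)
Lemma cword_seq i j m n phi p : m != [::] -> wne m -> n != [::] -> wne n ->
  i \in flatten p -> uniq (flatten p) ->
  j \notin flatten p -> j \in flatten m ->
  cword i m (cword j n phi) p = cword j n (fun v => cword i v phi p) m.
Proof.
case: m => // m1 M _ /andP[m1n Mn]; case: n => // n1 N _ nn; have /andP[n1n Nn] := nn.
elim: p phi => [|c p IH] phi //.
rewrite [flatten (c :: p)]/= ![_ \in c ++ _]mem_cat cat_uniq negb_or.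
move=> ip /and3P[Uc Ucp Up] /andP[jc jp] jm.
case ic: (i \in c); last first.
  rewrite cword_miss ?ic //.
  have -> : cword j (n1 :: N) phi \o cons c = cword j (n1 :: N) (phi \o cons c).
    by apply/funext => u /=; rewrite (negbTE jc).
  rewrite ic /= in ip; rewrite IH //; congr cword; apply/funext => v /=.
  by rewrite ic.
have jr : j \notin rem i c by apply: contra jc; apply: mem_rem.
rewrite cword_hit // [head _ _]/= [behead _]/=.
case jm1: (j \in m1); last first.
  have -> : cword j (n1 :: N) phi \o cons (rem i c ++ m1) =
     cword j (n1 :: N) (phi \o cons (rem i c ++ m1)).
    by apply/funext => u /=; rewrite mem_cat (negbTE jr) jm1.
  rewrite [flatten _]/= mem_cat jm1 in jm.
  rewrite shuf_cword // -cword_sg cword_miss ?jm1 //; congr cword.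
  by apply/funext => v /=; rewrite ic.
rewrite [RHS]cword_hit // [head _ _]/= [behead _]/=.
rewrite [LHS](_ : _ = sg (after i c + bdim m1 * wdim p)
  (shuf (fun u => sg (after j m1 + bdim n1 * (wdim p + wdim M))
     (shuf (phi \o cons (rem i c ++ rem j m1 ++ n1)) u N)) p M)); last first.
  congr sg; apply: eq_shuf => u pu /=.
  rewrite mem_cat jm1 orbT after_catr // rem_cat (negbTE jr) catA.
  by rewrite (perm_wdim pu) wdim_cat.
rewrite shuf_sg shufA.
have -> : (fun v => cword i v phi (c :: p)) \o cons (rem j m1 ++ n1) =
  (fun v => sg (after i c + (bdim m1 + bdim n1) * wdim p)
     (shuf (phi \o cons (rem i c ++ rem j m1 ++ n1)) p v)).
  by apply/funext => v /=; rewrite ic bdim_rem_cat.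
rewrite shuf_sg; signs.
Qed.

(** The hole j comes later than i, hence lies in the word which is shuffled with
    the tail of m. *)
Lemma cword_par_lt i j m n phi p c : m != [::] -> wne m -> n != [::] -> wne n ->
  i \in c -> j \notin c -> i \notin flatten n -> j \notin flatten m ->
  i \notin flatten p -> j \in flatten p ->
  cword i m (cword j n phi) (c :: p) =
  sg (wdim m * wdim n) (cword j n (cword i m phi) (c :: p)).
Proof.
case: m => // m1 M _ /andP[m1n Mn] n0 nn ic jc ni jm ip jp.
have /andP[jm1 jM] : (j \notin m1) && (j \notin flatten M).
  by move: jm; rewrite /= mem_cat negb_or.
rewrite cword_hit // [head _ _]/= [behead _]/= cword_miss //.
have jr : j \notin rem i c by apply: contra jc; apply: mem_rem.
have -> : cword j n phi \o cons (rem i c ++ m1) = cword j n (phi \o cons (rem i c ++ m1)).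
  by apply/funext => u /=; rewrite mem_cat (negbTE jr) (negbTE jm1).
rewrite shuf_cwordl // -!cword_sg; apply: eq_cword => // u hu _ _ /=.
rewrite ic hu wdim_cons; signs.
Qed.

(** The first blocks of m and n are inserted in the same block in two orders, and
    the tails are shuffled in two orders. *)
Lemma cword_par_same i j m n phi p b : alternating phi ->
  m != [::] -> wne m -> n != [::] -> wne n -> i != j ->
  i \notin b -> j \notin b -> i \notin flatten n -> j \notin flatten m ->
  i \notin flatten p -> j \notin flatten p ->
  let p' := (b ++ [:: j; i]) :: p in
  cword i m (cword j n phi) p' = sg (wdim m * wdim n) (cword j n (cword i m phi) p').
Proof.
move=> hphi; case: m => // m1 M _ /andP[m1n Mn]; case: n => // n1 N _ /andP[n1n Nn].
move=> nij ib jb /=; rewrite !mem_cat !negb_or => /andP[in1 iN] /andP[jm1 jM] ip jp.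
have nji : j != i by rewrite eq_sym.
rewrite !inE !eqxx !orbT /=.
have -> : after i (b ++ [:: j; i]) = 0%N.
  by rewrite after_catr // /after /= (negbTE nji) eqxx.
have -> : after j (b ++ [:: j; i]) = 1%N.
  by rewrite after_catr // /after /= eqxx.
rewrite !rem_cat (negbTE ib) (negbTE jb) /= !eqxx (negbTE nji) -!catA.
rewrite (eq_shuf (psi := fun u => sg (size m1 + bdim n1 * (wdim p + wdim M))
   (shuf (phi \o cons (b ++ m1 ++ n1)) u N))); last first.
  move=> u pu; rewrite !mem_cat inE eqxx orbT.
  rewrite (perm_wdim pu) wdim_cat !rem_cat (negbTE jb) /= eqxx.
  rewrite after_catr // /after /= eqxx subn0 cats0; congr sg.
  by apply: eq_shuf => w _ /=; rewrite catA.
rewrite [in RHS](eq_shuf (psi := fun u =>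
   sg (size n1 + bdim m1 * (wdim p + wdim N) + size m1 * size n1)
   (shuf (phi \o cons (b ++ m1 ++ n1)) u M))); last first.
  move=> u pu; rewrite !mem_cat inE eqxx orbT.
  rewrite (perm_wdim pu) wdim_cat !rem_cat (negbTE ib) /= eqxx.
  rewrite after_catr // /after /= eqxx subn0 cats0 [in RHS]sgD.
  congr sg.
  rewrite -shuf_sg; apply: eq_shuf => w _ /=; rewrite -catA.
  by have := alternating_swap [::] w b [::] n1 m1 hphi; rewrite !cats0 mulnC.
rewrite !shuf_sg !shufA.
have -> : shuf (shuf (phi \o cons (b ++ m1 ++ n1)) p) N M =
  sg (wdim N * wdim M) (shuf (shuf (phi \o cons (b ++ m1 ++ n1)) p) M N).
  by rewrite shufC.
rewrite !wdim_cons (size_bdim m1n) (size_bdim n1n); signs.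
Qed.

End Composition.

(** * The quotient and the maps out of it *)

Section Additive.
Variables (M N : zmodType) (f : M -> N).
Hypothesis fD : additive_fun f.

Lemma additive0 : f 0 = 0.
Proof. by apply: (@addrI _ (f 0)); rewrite -fD !addr0. Qed.

Lemma additiveN x : f (- x) = - f x.
Proof. by apply: (@addrI _ (f x)); rewrite -fD !subrr additive0. Qed.

Lemma additiveB x y : f (x - y) = f x - f y.
Proof. by rewrite fD additiveN. Qed.

Lemma additive_sg n x : f (sg n x) = sg n (f x).
Proof. exact: sgM. Qed.

Lemma additive_sum (J : Type) (r : seq J) (F : J -> M) :
  f (\sum_(j <- r) F j) = \sum_(j <- r) f (F j).
Proof.
elim: r => [|j r IH]; first by rewrite !big_nil additive0.
by rewrite !big_cons fD IH.
Qed.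

Lemma additiveMz x (n : int) : f (x *~ n) = f x *~ n.
Proof.
have hn (k : nat) : f (x *+ k) = f x *+ k.
  by elim: k => [|k IH]; rewrite ?additive0 // !mulrS fD IH.
by case: n => k; rewrite -?pmulrn ?hn // !NegzE !mulrNz -!pmulrn additiveN hn.
Qed.

End Additive.

Section Expressions.
Variable I : finType.
Implicit Types (w : word I) (x y : PiM I).

Lemma is_exprP w :
  reflect [/\ wne w, uniq (flatten w) & forall i, i \in flatten w] (is_expr w).
Proof.
apply: (iffP andP) => [[wn wp]|[wn wu wi]].
  split=> // [|i]; first by rewrite (perm_uniq wp) enum_uniq.
  by rewrite (perm_mem wp) mem_enum.
split=> //; apply: uniq_perm; rewrite ?enum_uniq // => i.
by rewrite wi mem_enum.
Qed.

Lemma is_expr_perm w1 w2 : (wne w1 -> wne w2) ->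
  perm_eq (flatten w1) (flatten w2) -> is_expr w1 -> is_expr w2.
Proof.
by move=> h p /andP[/h wn q]; apply/andP; split=> //; rewrite -(permPl p).
Qed.

Lemma is_expr_swap (A B : word I) (u v : seq I) a b :
  is_expr (A ++ (u ++ a :: b :: v) :: B) = is_expr (A ++ (u ++ b :: a :: v) :: B).
Proof.
suff h c d : is_expr (A ++ (u ++ c :: d :: v) :: B) ->
    is_expr (A ++ (u ++ d :: c :: v) :: B) by apply/idP/idP; apply: h.
apply: is_expr_perm; first by rewrite /wne !all_cat /=; case: u.
rewrite !flatten_cat perm_cat2l /= perm_cat2r perm_cat2l.
by rewrite -![_ :: _ :: v]/([:: _; _] ++ v) perm_cat2r; apply/seq.permP => q /=; lia.
Qed.

Definition cl w : PiM I := clsPi (gen w).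

Lemma clsPiD : additive_fun (@clsPi I).
Proof. by move=> x y; rewrite /clsPi raddfD. Qed.

Lemma clsPiK x : clsPi (reprPi x) = x.
Proof. exact: reprK. Qed.

Lemma clsPi_eq (x y : freeE I) : clsPi x = clsPi y <-> antisym (x - y).
Proof.
rewrite /clsPi; split=> [/eqP|h].
  by rewrite -Quotient.idealrBE => /asboolP.
by apply/eqP; rewrite -Quotient.idealrBE; apply/asboolP.
Qed.

Lemma gen_val (e : expr I) : gen (val e) = << e >>.
Proof. by rewrite /gen valK. Qed.

Lemma clE w (hw : is_expr w) : cl w = clsPi << (exist _ w hw : expr I) >>.
Proof. by rewrite /cl -[w in LHS]/(val (exist _ w hw : expr I)) gen_val. Qed.

Lemma cl_invalid w : ~~ is_expr w -> cl w = 0.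
Proof. by move=> h; rewrite /cl /gen insubN // (additive0 clsPiD). Qed.

Lemma cl_alternating : alternating cl.
Proof.
move=> A B u v a b; have [h|h] := boolP (is_expr (A ++ (u ++ a :: b :: v) :: B)).
  have h' := h; rewrite is_expr_swap in h'.
  rewrite !clE -(additiveN clsPiD); apply/clsPi_eq; rewrite opprK.
  by apply: antisym_swap; exists A, B, u, v, a, b.
by rewrite !cl_invalid ?oppr0 // -is_expr_swap.
Qed.

(** Signed sums of classes of words exhaust the quotient. *)
Lemma clsPi_ind (P : PiM I -> Prop) (y : freeE I) :
  P 0 -> (forall x x', P x -> P x' -> P (x - x')) ->
  (forall e, e \in dom y -> P (cl (val e))) -> P (clsPi y).
Proof.
move=> P0 PB Pcl.
have PN z : P z -> P (- z) by rewrite -sub0r => /(PB _ _ P0).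
have PD z t : P z -> P t -> P (z + t) by move=> Pz Pt; rewrite -[t]opprK; apply/PB/PN.
rewrite -(freeg_sumE y) (additive_sum clsPiD) big_seq.
elim/big_ind: _ => // e /Pcl Pe; set c := coeff e y.
have -> : << c *g e >> = << e >> *~ c :> freeE I.
  by rewrite freegU_mulz; congr << _ *g _ >>; rewrite intz.
rewrite (additiveMz clsPiD) -gen_val -/(cl _).
have Pn (n : nat) : P (cl (val e) *+ n) by elim: n => [//|n IH]; rewrite mulrS; apply: PD.
by case: c => n; rewrite -?pmulrn ?NegzE ?mulrNz -?pmulrn //; apply: PN.
Qed.

Lemma PiM_ind (P : PiM I -> Prop) :
  P 0 -> (forall x y, P x -> P y -> P (x - y)) ->
  (forall w, is_expr w -> P (cl w)) -> forall x, P x.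
Proof.
move=> P0 PB Pcl x; rewrite -(clsPiK x); apply: clsPi_ind => // e _.
exact/Pcl/valP.
Qed.

Lemma PiM_ext (V : zmodType) (f g : PiM I -> V) :
  additive_fun f -> additive_fun g ->
  (forall w, is_expr w -> f (cl w) = g (cl w)) -> f =1 g.
Proof.
move=> fD gD h; apply: PiM_ind => // [|x y hx hy].
  by rewrite !additive0.
by rewrite !additiveB // hx hy.
Qed.

(** Antisymmetry on the words which are expressions suffices for maps out of the
    quotient; counting inversions, for instance, is antisymmetric only for
    distinct letters. *)
Definition alternating_expr (V : zmodType) (F : word I -> V) :=
  forall (A B : word I) (u v : seq I) (a b : I),
    is_expr (A ++ (u ++ a :: b :: v) :: B) ->
    F (A ++ (u ++ a :: b :: v) :: B) = - F (A ++ (u ++ b :: a :: v) :: B).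

Section Lift.
Variables (V : zmodType) (L : freeE I -> V).
Hypothesis LD : additive_fun L.
Hypothesis L_alt : alternating_expr (L \o @gen I).

(** The operations are defined on a chosen representative; this is their
    independence of the choice. *)
Lemma lift_repr (y : freeE I) : L (reprPi (clsPi y)) = L y.
Proof.
suff h z : antisym z -> L z = 0.
  apply/eqP; rewrite -subr_eq0 -(additiveB LD); apply/eqP/h/clsPi_eq.
  exact: clsPiK.
elim=> [|x1 x2 _ h1 _ h2|e e' [A [B [u [v [a [b [E E']]]]]]]].
- exact: additive0.
- by rewrite (additiveB LD) h1 h2 subrr.
rewrite LD -!gen_val E E'.
by have /= -> := L_alt (_ : is_expr (A ++ (u ++ [:: a, b & v]) :: B));
  rewrite ?addNr // -E; apply: valP.
Qed.

Lemma lift_additive : additive_fun (fun x => L (reprPi x)).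
Proof.
by move=> x y; rewrite -LD -[RHS]lift_repr clsPiD !clsPiK.
Qed.

End Lift.

Section LiftWord.
Variables (V : zmodType) (F : word I -> V).

Definition lift_word x : V :=
  fglift (fun e : expr I => F (val e) : zmodule V) (reprPi x).

Lemma fglift_gen (M : lmodType int) (G : expr I -> M) w (hw : is_expr w) :
  fglift G (gen w) = G (exist _ w hw).
Proof.
by rewrite -[w in LHS]/(val (exist _ w hw : expr I)) gen_val liftU scale1r.
Qed.

Lemma fglift_additive (M : lmodType int) (G : expr I -> M) :
  additive_fun (fglift G : freeE I -> M).
Proof.
move=> x y; have h := @lift_is_additive int (expr I) M G.
have h0 : fglift G 0 = 0 by have := h 0 0; rewrite !subrr.
have hN z : fglift G (- z) = - fglift G z by have := h 0 z; rewrite !sub0r h0 sub0r.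
by rewrite -[y in LHS]opprK h hN opprK.
Qed.

Hypothesis F_alt : alternating_expr F.

Lemma F_gen_alt :
  alternating_expr ((fglift (fun e : expr I => F (val e) : zmodule V)) \o @gen I).
Proof.
move=> A B u v a b h; have h' := h; rewrite is_expr_swap in h'.
by rewrite [LHS](fglift_gen _ h) [X in - X](fglift_gen _ h'); apply: F_alt.
Qed.

Lemma lift_wordD : additive_fun lift_word.
Proof. exact: (lift_additive (fglift_additive _) F_gen_alt). Qed.

Lemma lift_wordE w : is_expr w -> lift_word (cl w) = F w.
Proof.
move=> hw; rewrite /lift_word /cl (lift_repr (fglift_additive _) F_gen_alt).
by rewrite fglift_gen.
Qed.

End LiftWord.

End Expressions.

Lemma alternatingW (I : finType) (V : zmodType) (F : word I -> V) :
  alternating F -> alternating_expr F.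
Proof. by move=> h A B u v a b _; apply: h. Qed.

(* An operation on the quotients induced by a linear map of the free modules.  *)
Section Induced.
Variables (I J : finType) (G : expr I -> freeE J) (F : word I -> PiM J).
Hypothesis GF : forall e, clsPi (G e) = F (val e).
Hypothesis F_alt : alternating_expr F.

Let L (x : freeE I) : PiM J := clsPi (fglift G x).

Let LD : additive_fun L.
Proof. by move=> x y; rewrite /L fglift_additive clsPiD. Qed.

Let L_alt : alternating_expr (L \o @gen I).
Proof.
move=> A B u v a b h; have h' := h; rewrite is_expr_swap in h'.
by rewrite /L /= (fglift_gen _ h) (fglift_gen _ h') !GF /= F_alt.
Qed.

Lemma inducedD : additive_fun (fun x => clsPi (fglift G (reprPi x))).
Proof. exact: (lift_additive LD L_alt). Qed.

Lemma inducedE w : is_expr w -> clsPi (fglift G (reprPi (cl w))) = F w.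
Proof.
move=> hw; have := lift_repr LD L_alt (gen w); rewrite /L => ->.
by rewrite fglift_gen GF.
Qed.

End Induced.

(** * The operations in terms of words *)

Lemma scale_sg (M : lmodType int) n (x : M) : (-1) ^+ n *: x = sg n x.
Proof. by rewrite /sg -signr_odd; case: odd; rewrite ?expr1 ?scaleN1r ?expr0 ?scale1r. Qed.

Definition merge_at (X : Type) (w : word X) j : word X :=
  take j w ++ (nth [::] w j ++ nth [::] w j.+1) :: drop j.+2 w.

Lemma dword_sum (X : eqType) (V : zmodType) (phi : word X -> V) w :
  \sum_(j < (size w).-1) sg (wdim (take j.+1 w)) (phi (merge_at w j)) = dword phi w.
Proof.
elim: w phi => [|c [|e w] IH] phi; first by rewrite big_ord0.
  by rewrite big_ord0 /= addr0 sg_0.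
rewrite dword_cons -IH big_ord_recl sg_add; congr (_ + _).
  by rewrite /merge_at /= drop0 ?take0 wdim_cons wdim_nil addn0.
rewrite sg_sum; apply: eq_bigr => j _.
by rewrite -sgD; congr (sg _ _); apply: wdim_cons.
Qed.

Lemma merge_flatten (X : Type) (w : word X) j :
  (j < (size w).-1)%N -> flatten (merge_at w j) = flatten w.
Proof.
elim: w j => [|c [|e w] IH] // [|j] /= h; first by rewrite /merge_at /= drop0 catA.
by have := IH j h; rewrite /merge_at /= => ->.
Qed.

Lemma merge_wne (X : eqType) (w : word X) j :
  (j < (size w).-1)%N -> wne w -> wne (merge_at w j).
Proof.
elim: w j => [|c [|e w] IH] // [|j] /= h /andP[cn hw].
  by case/andP: hw => _ ?; rewrite /merge_at /= drop0 cat_ne.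
by have := IH j h hw; rewrite /merge_at /= cn.
Qed.

Lemma merge_wdim (X : eqType) (w : word X) j :
  (j < (size w).-1)%N -> wne w -> wdim (merge_at w j) = (wdim w).+1.
Proof.
elim: w j => [|c [|e w] IH] // [|j] /= h /andP[cn hw].
  by case/andP: hw => ? _; rewrite /merge_at /= drop0 !wdim_cons bdim_cat // addSn addnA.
have := IH j h hw; rewrite /merge_at /= => E.
by rewrite wdim_cons E [in RHS]wdim_cons addnS.
Qed.

Lemma merge_is_expr (I : finType) (w : word I) j :
  (j < (size w).-1)%N -> is_expr w -> is_expr (merge_at w j).
Proof.
by move=> h; apply: is_expr_perm; [apply: merge_wne | rewrite merge_flatten].
Qed.

Lemma dword_map (X Y : eqType) (V : zmodType) (f : X -> Y) (phi : word Y -> V) w :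
  dword phi (map (map f) w) = dword (phi \o map (map f)) w.
Proof.
elim: w phi => [|c w IH] phi //=; rewrite bdim_map IH; congr (sg _ (_ + _)).
by case: w {IH} => [|e w] //=; rewrite map_cat.
Qed.

Lemma shuffles_map (X Y : Type) (f : X -> Y) s t :
  shuffles (map (map f) s) (map (map f) t) =
  [seq (u.1, map (map f) u.2) | u <- shuffles s t].
Proof.
elim: s t => [|b s IHs] t; first by case: t.
elim: t => [|c t IHt] //=; rewrite map_cat -!map_comp.
rewrite -[map f c :: _]/(map (map f) (c :: t)) IHs -map_comp.
rewrite /= in IHt; rewrite IHt -map_comp; congr (_ ++ _).
by apply: eq_map => u /=; rewrite -[map f b :: _]/(map (map f) (b :: s)) bdim_map wdim_map.
Qed.

Lemma shuf_map (X Y : eqType) (V : zmodType) (f : X -> Y) (phi : word Y -> V) s t :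
  shuf phi (map (map f) s) (map (map f) t) = shuf (phi \o map (map f)) s t.
Proof. by rewrite /shuf shuffles_map big_map. Qed.

Lemma map_rem (X Y : eqType) (f : X -> Y) x s :
  injective f -> map f (rem x s) = rem (f x) (map f s).
Proof.
by move=> fI; elim: s => [|y s IH] //=; rewrite inj_eq //; case: eqP => //= _; rewrite IH.
Qed.

Section Push.
Variables (V : zmodType).

Section Differential.
Variable I : finType.

Lemma dexprE (w : word I) : is_expr w -> clsPi (dexpr w) = dword (@cl I) w.
Proof.
move=> hw; rewrite -dword_sum /dexpr (additive_sum (@clsPiD I)).
apply: eq_bigr => j _; rewrite scale_sg (additive_sg (@clsPiD I)) //.
Qed.

Lemma dexprE_val (e : expr I) : clsPi (dexpr (val e)) = dword (@cl I) (val e).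
Proof. exact/dexprE/valP. Qed.

Lemma dPiD : additive_fun (@dPi I).
Proof.
exact: (inducedD dexprE_val (alternatingW (dword_alt (@cl_alternating I)))).
Qed.

Lemma dPi_cl (w : word I) : is_expr w -> dPi (cl w) = dword (@cl I) w.
Proof.
exact: (inducedE dexprE_val (alternatingW (dword_alt (@cl_alternating I)))).
Qed.

(** With theta additive and equal to psi on classes of words, the differential of
    Pi followed by theta is the word recursion for psi. The map f allows psi to
    live on words over another alphabet. *)
Lemma dPi_push (theta : PiM I -> V) (X : eqType) (psi : word X -> V) (f : I -> X) w :
  additive_fun theta ->
  (forall u, is_expr u -> theta (cl u) = psi (map (map f) u)) ->
  is_expr w -> theta (dPi (cl w)) = dword psi (map (map f) w).
Proof.
move=> tD h hw; rewrite dPi_cl // dword_map -!dword_sum (additive_sum tD).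
apply: eq_bigr => j _; rewrite (additive_sg tD); congr sg.
by rewrite h //; apply: merge_is_expr.
Qed.

End Differential.

Section Relabelling.
Variables (I J : finType) (f : I -> J).

Let mapF (w : word I) : PiM J := cl (map (map f) w).

Let mapF_alt : alternating mapF.
Proof. by move=> A B u v x y; rewrite /mapF !map_cat /= !map_cat /= cl_alternating. Qed.

Lemma mapPiD : additive_fun (mapPi f).
Proof.
exact: (@inducedD I J (fun e : expr I => gen (map (map f) (val e))) mapF
  (fun=> erefl) (alternatingW mapF_alt)).
Qed.

Lemma mapPi_cl w : is_expr w -> mapPi f (cl w) = cl (map (map f) w).
Proof.
exact: (@inducedE I J (fun e : expr I => gen (map (map f) (val e))) mapF
  (fun=> erefl) (alternatingW mapF_alt)).
Qed.

Lemma map_is_expr w : bijective f -> is_expr w -> is_expr (map (map f) w).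
Proof.
move=> fbij /is_exprP[wn wu wi]; have [g fK gK] := fbij.
apply/is_exprP; split.
- by rewrite /wne all_map; apply: sub_all wn => -[].
- by rewrite -map_flatten map_inj_uniq //; apply: bij_inj.
- by move=> j; rewrite -map_flatten -[j]gK map_f.
Qed.

End Relabelling.

Section Composition.
Variables (I J : finType) (i : I).
Implicit Types (p : word I) (m : word J).

Lemma inlb_cat (b c : seq I) : inlb J i (b ++ c) = inlb J i b ++ inlb J i c.
Proof. by rewrite /inlb pmap_cat map_cat. Qed.

Lemma inlb_flatten p : inlb J i (flatten p) = flatten [seq inlb J i c | c <- p].
Proof. by elim: p => [|c p IH] //=; rewrite inlb_cat IH. Qed.

Lemma inrb_flatten m : inrb i (flatten m) = flatten [seq inrb i c | c <- m].
Proof. by rewrite /inrb map_flatten. Qed.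

Lemma inlb_uniq (b : seq I) : uniq b -> uniq (inlb J i b).
Proof. by move=> bu; rewrite /inlb map_inj_uniq ?pmap_sub_uniq // => x y []. Qed.

Lemma mem_inlb u (b : seq I) : (inl u \in inlb J i b) = (val u \in b).
Proof.
rewrite /inlb mem_map; last by move=> x y [].
exact: mem_pmap_sub.
Qed.

Lemma inlb_nil (b : seq I) : i \notin b -> b != [::] -> inlb J i b != [::].
Proof.
case: b => // x b; rewrite inE negb_or => /andP[ix _] _.
by rewrite /inlb /=; case: insubP => //=; rewrite eq_sym ix.
Qed.

Lemma map_inlb (X : Type) (f : I -> X) (k : (del i + J)%type -> X) (b : seq I) :
  (forall u, k (inl u) = f (val u)) -> uniq b ->
  map k (inlb J i b) = map f (rem i b).
Proof.
move=> kl bu; rewrite rem_filter //.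
elim: b {bu} => [|x b IH] //=; rewrite /inlb /=.
case: insubP => [u /= -> <-|/negbTE -> //=] /=.
by rewrite -/(inlb J i b) IH kl.
Qed.

Definition comp_word p m (l := find (fun b => i \in b) p) (b := nth [::] p l)
    (u : word (del i + J)%type) : word (del i + J)%type :=
  [seq inlb J i c | c <- take l p] ++ (inlb J i b ++ inrb i (head [::] m)) :: u.

Lemma comp_word_is_expr p m u
    (l := find (fun b => i \in b) p) :
  is_expr p -> is_expr m -> m != [::] ->
  perm_eq u ([seq inlb J i c | c <- drop l.+1 p] ++ [seq inrb i c | c <- behead m]) ->
  is_expr (comp_word p m u).
Proof.
move=> /is_exprP[pn pu pi] /is_exprP[mn mu mj] m0 pe.
have hasi : has (fun b => i \in b) p.
  by have /flattenP[b bp ib] := pi i; apply/hasP; exists b.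
have lp : (l < size p)%N by rewrite -has_find.
have ib : i \in nth [::] p l by apply: (@nth_find _ [::] (fun b => i \in b)).
have E : p = take l p ++ nth [::] p l :: drop l.+1 p by rewrite -drop_nth // cat_take_drop.
rewrite /comp_word -/l.
set A := take l p in E *; set b := nth [::] p l in ib E *.
set B := drop l.+1 p in pe E *.
rewrite E in pn pu pi.
case: m m0 mn mu mj pe => // m1 M _ mn mu mj /= pe.
have pf : perm_eq (flatten ([seq inlb J i c | c <- A] ++ (inlb J i b ++ inrb i m1) :: u))
   (inlb J i (flatten (A ++ b :: B)) ++ inrb i (flatten (m1 :: M))).
  rewrite !flatten_cat /= !inlb_cat /= inlb_flatten -!catA !perm_cat2l.
  have := perm_flatten pe; rewrite flatten_cat -inlb_flatten -inrb_flatten => pe'.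
  rewrite /inrb map_cat -!/(inrb i _) perm_sym perm_catCA perm_cat2l perm_sym //.
have /and3P[Anb /= bne Bnb] : [&& wne A, b != [::] & wne B].
  by move: pn; rewrite /wne all_cat /=.
have niA : all (fun c => i \notin c) A.
  apply/allP => c cA; apply/negP => ic.
  have : (find (fun b => i \in b) (A ++ b :: B) < size A)%N.
    by rewrite find_cat; case: hasP => [_|[]]; [rewrite -has_find; apply/hasP; exists c|exists c].
  by rewrite -E -/l size_take lp ltnn.
have niB : all (fun c => i \notin c) B.
  apply/allP => c cB; apply/negP => ic.
  move: pu; rewrite flatten_cat cat_uniq /= cat_uniq => /and3P[_ _ /and3P[_ /hasPn h _]].
  have /h : i \in flatten B by apply/flattenP; exists c.
  by rewrite /= ib.
have wl Z : all (fun c => i \notin c) Z -> wne Z -> wne [seq inlb J i c | c <- Z].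
  move=> /allP h /allP hz; rewrite /wne all_map; apply/allP => c cZ /=.
  by rewrite inlb_nil ?h ?hz.
have /andP[m1n Mn] : (inrb i m1 != [::]) && wne [seq inrb i c | c <- M].
  have : wne [seq inrb i c | c <- m1 :: M] by rewrite /wne all_map; apply: sub_all mn => -[].
  by [].
apply/is_exprP; split.
- rewrite /wne all_cat /= -!/(wne _) wl // (perm_wne pe) {1}/wne all_cat -!/(wne _) wl //=.
  rewrite Mn !andbT /=; move: m1n.
  by case: (inrb i m1) => //; case: (inlb J i b).
- rewrite (perm_uniq pf) cat_uniq inlb_uniq //= /inrb map_inj_uniq ?mu ?andbT; last first.
    by move=> x y [].
  by apply/hasPn => x /mapP[j _ ->]; apply/negP => /mapP[].
- case=> x; rewrite (perm_mem pf) mem_cat; first by rewrite mem_inlb pi.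
  by apply/orP; right; apply: map_f.
Qed.

Lemma comp_exprE p m : clsPi (comp_expr i p m) =
  \sum_(u <- shuffles [seq inlb J i c | c <- drop (find (fun b => i \in b) p).+1 p]
                      [seq inrb i c | c <- behead m])
   sg (after i (nth [::] p (find (fun b => i \in b) p))
       + bdim (inrb i (head [::] m)) *
         wdim [seq inlb J i c | c <- drop (find (fun b => i \in b) p).+1 p] + u.1)
      (cl (comp_word p m u.2)).
Proof.
rewrite /comp_expr (additive_sum (@clsPiD _)); apply: eq_bigr => u _.
by rewrite scale_sg (additive_sg (@clsPiD _)).
Qed.

(** Identifies the explicit formula for the composition, after all letters are
    sent to a common alphabet X, with the recursion [cword]. *)
Lemma comp_word_push (X : eqType) (f : I -> X) (g : J -> X)
    (k : (del i + J)%type -> X) (psi : word X -> V) p m :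
  injective f -> (forall u, k (inl u) = f (val u)) -> (forall j, k (inr j) = g j) ->
  i \in flatten p -> uniq (flatten p) ->
  \sum_(u <- shuffles [seq inlb J i c | c <- drop (find (fun b => i \in b) p).+1 p]
                      [seq inrb i c | c <- behead m])
   sg (after i (nth [::] p (find (fun b => i \in b) p))
       + bdim (inrb i (head [::] m)) *
         wdim [seq inlb J i c | c <- drop (find (fun b => i \in b) p).+1 p] + u.1)
      (psi (map (map k) (comp_word p m u.2)))
  = cword (f i) (map (map g) m) psi (map (map f) p).
Proof.
move=> fI kl kr; have kinr (b : seq J) : map k (inrb i b) = map g b.
  by rewrite /inrb -map_comp; apply: eq_map.
have afterf (b : seq I) : after (f i) (map f b) = after i b.
  by rewrite /after size_map index_map.
have kM : map (map k) [seq inrb i c | c <- behead m] = behead (map (map g) m).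
  by rewrite -map_comp -behead_map; congr behead; apply: eq_map => b /=.
have headm : map k (inrb i (head [::] m)) = head [::] (map (map g) m).
  by rewrite kinr; case: m {kM}.
elim: p psi => [|c p IH] psi //= ip pu; move: ip.
rewrite /comp_word /= mem_cat (mem_map fI).
have /and3P[cu cp pu'] : [&& uniq c, ~~ has (in_mem^~ (mem c)) (flatten p) & uniq (flatten p)].
  by move: pu; rewrite cat_uniq.
case: ifP => [ic _|ic ip] /=.
  rewrite drop0.
  have niB : i \notin flatten p by apply: contra cp => h; apply/hasP; exists i.
  have kB : map (map k) [seq inlb J i b | b <- p] = map (map f) p.
    rewrite -map_comp; apply/eq_in_map => b bp /=.
    have nib : i \notin b by apply: contra niB => h; apply/flattenP; exists b.
    have bu : uniq b.
      elim: p bp pu' {pu cp niB IH} => // d p IH; rewrite inE /= cat_uniq.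
      by case/predU1P => [->|/IH h] /and3P[].
    by rewrite (map_inlb kl) // rem_id.
  rewrite -kB -kM shuf_map /shuf sg_sum afterf wdim_map.
  apply: eq_bigr => u _ /=; rewrite -headm bdim_map sgD map_cat (map_inlb kl) //.
  by rewrite (map_rem _ _ fI).
have nic : i \notin c by rewrite ic.
rewrite -(IH (psi \o cons (map f c))) //.
by apply: eq_bigr => u _; rewrite /comp_word /= (map_inlb kl) // rem_id.
Qed.

End Composition.
End Push.

(** * Composition on the quotient *)

Section Extension.
Variables (L : neFin) (X : eqType) (k : L -> X).

Definition ne_elt : L := enum_val (Ordinal (ne_card L)).
(** A left inverse of k, with an arbitrary value outside the image of k. *)
Definition retract (x : X) : L := odflt ne_elt [pick l | k l == x].
(** The class of a word, extended to words over a larger alphabet so that it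
    stays antisymmetric. *)
Definition cl_ext (w : word X) : PiM L := cl (map (map retract) w).

Lemma cl_ext_alternating : alternating cl_ext.
Proof. by move=> A B u v x y; rewrite /cl_ext !map_cat /= !map_cat /= cl_alternating. Qed.

Hypothesis kI : injective k.

Lemma retractK : cancel k retract.
Proof. by move=> l; rewrite /retract; case: pickP => [l' /eqP/kI //|/(_ l)]; rewrite eqxx. Qed.

Lemma cl_extE w : cl_ext (map (map k) w) = cl w.
Proof.
rewrite /cl_ext -map_comp -[in RHS](map_id w); congr cl; apply: eq_map => b /=.
by rewrite mapK //; apply: retractK.
Qed.

End Extension.

Lemma wne_map (X Y : eqType) (f : X -> Y) w : wne (map (map f) w) = wne w.
Proof. by rewrite /wne all_map; apply: eq_all => -[]. Qed.

Lemma is_expr_neq0 (I : neFin) (w : word I) : is_expr w -> w != [::].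
Proof. by move=> /is_exprP[_ _ /(_ (ne_elt I))]; case: w. Qed.

Section PiComposition.
Variables (I J : neFin) (i : I).

Let X : eqType := (I + J)%type.
Let k (l : subst i J) : X := match l with inl u => inl (val u) | inr j => inr j end.

Let kI : injective k.
Proof. by move=> [u|j] [u'|j'] //= [] => [/val_inj|] ->. Qed.

Let W (p : word I) (m : word J) : PiM (subst i J) :=
  cword (inl i : X) (map (map inr) m) (cl_ext k) (map (map inl) p).

Let comp_exprW p m : is_expr p -> is_expr m ->
  clsPi (comp_expr i p m) = W p m.
Proof.
move=> hp hm; have /is_exprP[_ pu pi] := hp; have m0 := is_expr_neq0 hm.
rewrite /W -(@comp_word_push _ I J i X inl inr k) // => [|x y []//].
rewrite comp_exprE /shuf big_seq [RHS]big_seq; apply: eq_bigr => u hu.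
congr (sg _ _); rewrite cl_extE //.
Qed.

Let W_altr p : alternating (W p).
Proof.
move=> A B u v x y; rewrite /W !map_cat /= !map_cat /=.
exact: (cword_altr (inl i : X) (map (map inl) p) (@cl_ext_alternating _ _ k)).
Qed.

Let W_altl m : alternating_expr (fun p => W p m).
Proof.
move=> A B u v x y /is_exprP[_ U _]; rewrite /W !map_cat /= !map_cat /=.
apply: (cword_altl _ _ (@cl_ext_alternating _ _ k)).
move: U; rewrite -(map_inj_uniq (f := inl : I -> X)); last by move=> a b [].
by rewrite map_flatten map_cat /= map_cat.
Qed.

Let Q (p : word I) (y : PiM J) : PiM (subst i J) :=
  clsPi (fglift (fun e' : expr J => comp_expr i p (val e')) (reprPi y)).

Let QG p (hp : is_expr p) (e : expr J) : clsPi (comp_expr i p (val e)) = W p (val e).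
Proof. exact/comp_exprW/valP. Qed.

Let QD p : is_expr p -> additive_fun (Q p).
Proof. by move=> hp; apply: (inducedD (QG hp) (alternatingW (W_altr p))). Qed.

Let QE p m : is_expr p -> is_expr m -> Q p (cl m) = W p m.
Proof. by move=> hp; apply: (inducedE (QG hp) (alternatingW (W_altr p))). Qed.

Let Q_alt y : alternating_expr (fun p => Q p y).
Proof.
move=> A B u v a b hp; have hp' := hp; rewrite is_expr_swap in hp'.
move: y; apply: PiM_ext; first exact: QD.
  by move=> y z; rewrite QD // opprD.
by move=> m hm; rewrite !QE // W_altl.
Qed.

Lemma compPiDl (y : PiM J) : additive_fun (fun x : PiM I => compPi i x y).
Proof. exact: (@inducedD _ _ _ (fun p => Q p y) (fun=> erefl) (Q_alt y)). Qed.

Let compPi_clQ p (y : PiM J) : is_expr p -> compPi i (cl p) y = Q p y.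
Proof. exact: (@inducedE _ _ _ (fun p => Q p y) (fun=> erefl) (Q_alt y)). Qed.

Lemma compPiDr (x : PiM I) : additive_fun (fun y : PiM J => compPi i x y).
Proof.
move=> y z; move: x; apply: PiM_ext => [x x'|x x'|p hp]; rewrite ?compPiDl //.
  by rewrite addrACA.
by rewrite !compPi_clQ // QD.
Qed.

Lemma compPi_cl (p : word I) (m : word J) : is_expr p -> is_expr m ->
  compPi i (cl p) (cl m) = clsPi (comp_expr i p m).
Proof. by move=> hp hm; rewrite compPi_clQ // QE // comp_exprW. Qed.

(** The bridge between Pi and the word calculus, for a composition followed by an
    additive map theta. *)
Lemma compPi_push (V : zmodType) (theta : PiM (subst i J) -> V) (Y : eqType)
    (f : I -> Y) (g : J -> Y) (h : subst i J -> Y) (psi : word Y -> V) (p : word I) (m : word J) :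
  additive_fun theta ->
  (forall u, is_expr u -> theta (cl u) = psi (map (map h) u)) ->
  injective f -> (forall u, h (inl u) = f (val u)) -> (forall j, h (inr j) = g j) ->
  is_expr p -> is_expr m ->
  theta (compPi i (cl p) (cl m)) = cword (f i) (map (map g) m) psi (map (map f) p).
Proof.
move=> tD ht fI hl hr hp hm; have /is_exprP[_ pu pi] := hp.
rewrite compPi_cl // comp_exprE (additive_sum tD) -(comp_word_push _ _ fI hl hr) //.
rewrite big_seq [RHS]big_seq; apply: eq_bigr => u hu.
rewrite (additive_sg tD) ht //; apply: comp_word_is_expr => //.
  exact: is_expr_neq0.
exact: shuffles_perm.
Qed.

End PiComposition.

(** * Degrees and the complex *)

Section Degrees.
Variable I : finType.
Implicit Types (x y : PiM I) (n : int) (w : word I).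
Local Notation degPi := (@degPi I).

Lemma degPi0 n : degPi n (0 : PiM I).
Proof. by exists 0; rewrite ?(additive0 (@clsPiD I)) // => e; rewrite dom0. Qed.

Lemma degPiB n x y : degPi n x -> degPi n y -> degPi n (x - y).
Proof.
case=> x' hx -> [y' hy ->]; exists (x' - y'); last by rewrite (additiveB (@clsPiD I)).
by move=> e /domB; rewrite mem_cat => /orP[/hx|/hy].
Qed.

Lemma degPiN n x : degPi n x -> degPi n (- x).
Proof. by move=> h; rewrite -sub0r; apply: degPiB => //; apply: degPi0. Qed.

Lemma degPiD n x y : degPi n x -> degPi n y -> degPi n (x + y).
Proof. by move=> hx hy; rewrite -[y]opprK; apply: degPiB => //; apply: degPiN. Qed.

Lemma degPi_sg n k x : degPi n x -> degPi n (sg k x).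
Proof. by rewrite /sg; case: odd => // /degPiN. Qed.

Lemma degPi_sum n (T : eqType) (r : seq T) (F : T -> PiM I) :
  (forall t, t \in r -> degPi n (F t)) -> degPi n (\sum_(t <- r) F t).
Proof.
move=> h; rewrite big_seq; elim/big_ind: _ => //; first exact: degPi0.
exact: degPiD.
Qed.

Lemma degPi_cl w : is_expr w -> degPi (wdim w)%:Z (cl w).
Proof.
move=> hw; exists (gen w) => // e.
by rewrite -[w in gen w]/(val (exist _ w hw : expr I)) gen_val domU1 inE => /eqP->.
Qed.

Lemma degPi_ind n (P : PiM I -> Prop) :
  P 0 -> (forall x y, P x -> P y -> P (x - y)) ->
  (forall w, is_expr w -> (wdim w)%:Z = n -> P (cl w)) ->
  forall x, degPi n x -> P x.
Proof.
move=> P0 PB Pcl _ [y hy ->]; apply: clsPi_ind => // e /hy he.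
by apply: Pcl => //; apply: valP.
Qed.

Definition degF n (w : word I) : PiM I := if (wdim w)%:Z == n then cl w else 0.

Lemma degF_alt n : alternating_expr (degF n).
Proof.
move=> A B u v a b _; rewrite /degF wdim_swap; case: ifP => _; rewrite ?oppr0 //.
exact: cl_alternating.
Qed.

Definition deg_part n : PiM I -> PiM I := lift_word (degF n).

Lemma deg_partD n : additive_fun (deg_part n).
Proof. exact/lift_wordD/degF_alt. Qed.

Lemma deg_part_cl n w : is_expr w -> deg_part n (cl w) = degF n w.
Proof. exact/lift_wordE/degF_alt. Qed.

Lemma deg_part_deg n x : degPi n (deg_part n x).
Proof.
move: x; apply: PiM_ind => [|x y hx hy|w hw].
- by rewrite (additive0 (deg_partD n)); apply: degPi0.
- by rewrite (additiveB (deg_partD n)); apply: degPiB.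
rewrite deg_part_cl // /degF; case: eqP => [<-|_]; last exact: degPi0.
exact: degPi_cl.
Qed.

Lemma deg_partE n m x : degPi m x -> deg_part n x = if m == n then x else 0.
Proof.
move: x; apply: degPi_ind => [|x y hx hy|w hw <-].
- by rewrite (additive0 (deg_partD n)); case: ifP.
- by rewrite (additiveB (deg_partD n)) hx hy; case: ifP; rewrite ?subrr.
by rewrite deg_part_cl // /degF.
Qed.

Lemma degPiP n x : degPi n x <-> deg_part n x = x.
Proof. by split=> [/deg_partE->|<-]; [rewrite eqxx | apply: deg_part_deg]. Qed.

Lemma wdim_le w : is_expr w -> (wdim w <= #|I|)%N.
Proof.
case/andP => _ /perm_size; rewrite -cardE => <-.
elim: w => [|c w IH]; first by rewrite wdim_nil.
rewrite wdim_cons /= size_cat leq_add //.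
exact: leq_pred.
Qed.

Lemma sum_deg_part x :
  x = \sum_(n <- map Posz (iota 0 #|I|.+1)) deg_part n x.
Proof.
have D : additive_fun (fun x => \sum_(n <- map Posz (iota 0 #|I|.+1)) deg_part n x).
  by move=> y z; rewrite -big_split; apply: eq_bigr => n _; rewrite deg_partD.
move: x; apply: PiM_ext => // w hw.
rewrite big_map (bigD1_seq (wdim w)) ?iota_uniq ?mem_iota ?ltnS ?wdim_le //=.
rewrite deg_part_cl // /degF eqxx big1 ?addr0 // => n /negbTE hn.
by rewrite deg_part_cl // /degF eqz_nat eq_sym hn.
Qed.

End Degrees.

(** Merging three consecutive blocks in two orders gives opposite signs. *)
Lemma dword_dword (X : eqType) (V : zmodType) (phi : word X -> V) w :
  wne w -> dword (dword phi) w = 0.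
Proof.
elim: w phi => [|c w IH] phi // /andP[cn wn].
have E : dword phi \o cons c =
  (fun u => sg (bdim c) (merge_first c phi u + dword (phi \o cons c) u)) by [].
rewrite dword_cons E dword_sg dwordD IH // addr0.
case: w wn {IH} => [|e w] wn; first by rewrite /= !(sg_0, addr0).
have /andP[en wn'] := wn.
have -> : merge_first c (dword phi) (e :: w) =
    sg (bdim c + bdim e).+1 (merge_first (c ++ e) phi w + dword (phi \o cons (c ++ e)) w).
  by rewrite -bdim_cat.
rewrite dword_cons.
have -> : merge_first e (merge_first c phi) w = merge_first (c ++ e) phi w.
  by case: w {wn wn'} => [|f w] //=; rewrite catA.
by rewrite -[merge_first c phi \o _]/(phi \o cons (c ++ e)); signs.
Qed.

Section PiComplex.
Variable I : finType.
Implicit Types (x : PiM I) (w : word I).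
Local Notation degPi := (@degPi I).
Local Notation dPi := (@dPi I).

Lemma dPi_deg n x : degPi n x -> degPi (n + 1) (dPi x).
Proof.
move: x; apply: degPi_ind => [|x y hx hy|w hw <-].
- by rewrite (additive0 (@dPiD I)); apply: degPi0.
- by rewrite (additiveB (@dPiD I)); apply: degPiB.
rewrite dPi_cl // -dword_sum; apply: degPi_sum => j _; apply: degPi_sg.
have -> : (wdim w)%:Z + 1 = (wdim (merge_at w j))%:Z.
  by rewrite merge_wdim ?intS 1?addrC //; case/andP: hw.
by apply/degPi_cl/merge_is_expr.
Qed.

Lemma dPi_dPi x : dPi (dPi x) = 0.
Proof.
move: x; apply: PiM_ext => [x y|x y|w hw]; rewrite ?dPiD ?addr0 //.
rewrite (@dPi_push _ I _ I (dword (@cl I)) id) //; first last.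
- by move=> u hu; rewrite dPi_cl //; congr dword; rewrite -[LHS]map_id; apply: eq_map => b; rewrite map_id.
- exact: dPiD.
by apply: dword_dword; rewrite wne_map; case/andP: hw.
Qed.

Lemma Pi_complex : is_complex (Pi_cplx I).
Proof.
split=> /=.
- exact: degPi0.
- exact: degPiB.
- move=> x; exists (map Posz (iota 0 #|I|.+1)), (fun n => deg_part n x).
  by split; [move=> n; apply: deg_part_deg | apply: sum_deg_part].
- move=> s c us hc s0 n ns; have := congr1 (deg_part n) s0.
  rewrite (additive_sum (deg_partD n)) (additive0 (deg_partD n)) (bigD1_seq n) //=.
  rewrite (deg_partE n (hc n)) eqxx big1 ?addr0 // => m /negbTE mn.
  by rewrite (deg_partE n (hc m)) mn.
- exact: dPiD.
- exact: dPi_deg.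
- exact: dPi_dPi.
Qed.

End PiComplex.

(** * The operad axioms *)

Lemma additive_comp (M N P : zmodType) (f : N -> P) (g : M -> N) :
  additive_fun f -> additive_fun g -> additive_fun (fun x => f (g x)).
Proof. by move=> fD gD x y; rewrite gD fD. Qed.

Lemma alternating_perm (X : eqType) (V : zmodType) (phi : word X -> V) A B u c c' :
  alternating phi -> perm_eq c c' ->
  exists n, phi (A ++ (u ++ c) :: B) = sg n (phi (A ++ (u ++ c') :: B)).
Proof.
move=> hphi; elim: c' u c => [|x c' IH] u c pc.
  by exists 0%N; rewrite (perm_nilP pc).
have xc : x \in c by rewrite (perm_mem pc) mem_head.
case/splitPr: xc pc => c1 c2 pc.
have {}pc : perm_eq (c1 ++ c2) c'.
  by rewrite -(perm_cons x) -(permPr pc) perm_sym -cat_rcons -cats1 -catA perm_catCA.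
have [n En] := IH (rcons u x) _ pc; rewrite !cat_rcons in En.
exists (size c1 + n)%N; rewrite sgD -En; have := alternating_move A B u c2 x c1 hphi.
by move=> ->; rewrite sgK.
Qed.

(** The blocks up to the first one meeting {i, j} are skipped; then i and j lie in
    the same block, or one of them lies in a later block. *)
Lemma cword_par (X : eqType) (V : zmodType) (phi : word X -> V) i j m n A B c :
  alternating phi -> m != [::] -> wne m -> n != [::] -> wne n -> i != j ->
  i \notin flatten n -> j \notin flatten m ->
  i \notin flatten A -> j \notin flatten A ->
  (i \in c) || (j \in c) ->
  i \in flatten (c :: B) -> j \in flatten (c :: B) -> uniq (flatten (c :: B)) ->
  ((i \in c) && (j \in c) -> exists b, c = b ++ [:: j; i]) ->
  cword i m (cword j n phi) (A ++ c :: B) =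
  sg (wdim m * wdim n) (cword j n (cword i m phi) (A ++ c :: B)).
Proof.
move=> hphi m0 mn n0 nn ij ni jm; elim: A phi hphi => [|a A IH] phi hphi; last first.
  rewrite [flatten (a :: A)]/= ![_ \in a ++ _]mem_cat !negb_or => /andP[ia iA] /andP[ja jA] hic hi hj hu hb.
  rewrite !cat_cons !cword_miss //.
  have E k p : k \notin a -> forall psi : word X -> V,
      cword k p psi \o cons a = cword k p (psi \o cons a).
    by move=> ka psi; apply/funext => u /=; rewrite (negbTE ka).
  by rewrite !E // (IH _ (alternating_cons a hphi)) //.
move=> _ _ hc; rewrite cat0s [flatten (c :: B)]/= ![_ \in c ++ _]mem_cat cat_uniq.
move=> hi hj /and3P[cu cB Bu] hb.
have notB x : x \in c -> x \notin flatten B.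
  by move=> xc; apply: contra cB => xB; apply/hasP; exists x.
have [ic|ic] := boolP (i \in c); have [jc|jc] := boolP (j \in c).
- have [|b Eb] := hb; first by rewrite ic jc.
  subst c; move: cu; rewrite cat_uniq /= !inE orbF negb_or.
  move=> /and3P[_ /andP[jb ib] _].
  exact: (cword_par_same hphi m0 mn n0 nn ij ib jb ni jm (notB _ ic) (notB _ jc)).
- apply: cword_par_lt => //; first exact: notB.
  by rewrite (negbTE jc) in hj.
- rewrite [in RHS]cword_par_lt // ?notB //; last by rewrite (negbTE ic) in hi.
  by rewrite mulnC sgK.
- by rewrite (negbTE ic) (negbTE jc) in hc.
Qed.

(** The hole is moved to the end of its block, renamed and moved back. *)
Lemma cword_unit (X : eqType) (V : zmodType) (phi : word X -> V) i j p :
  alternating phi -> i \in flatten p -> uniq (flatten p) ->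
  cword i [:: [:: j]] phi p =
  phi (map (map (fun x => if x == i then j else x)) p).
Proof.
set r := fun x => _; move=> hphi ip pu.
have rid b : i \notin b -> map r b = b.
  move=> ib; rewrite -[RHS]map_id; apply/eq_in_map => x xb.
  by rewrite /r; case: eqP => // xi; rewrite -xi xb in ib.
elim: p phi hphi ip pu => [|c p IH] phi hphi //=.
rewrite mem_cat cat_uniq => ip /and3P[cu cp pu].
case: ifP => ic; last first.
  by rewrite ic /= in ip; rewrite IH ?rid ?ic //; apply: alternating_cons.
have {}ip : i \notin flatten p by apply: contra cp => ip'; apply/hasP; exists i.
have -> : map (map r) p = p.
  rewrite -[RHS]map_id; apply/eq_in_map => b bp; apply: rid.
  by apply: contra ip => ib; apply/flattenP; exists b.
rewrite mul0n addn0 shufs0.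
case/splitPr: ic cu cp => c1 c2; rewrite cat_uniq /= negb_or.
move=> /and3P[_ /andP[ic1 _] /andP[ic2 _]] _.
rewrite rem_cat (negbTE ic1) /= eqxx map_cat /= (rid c1) // (rid c2) // /r eqxx.
rewrite after_catr // /after /= eqxx subn0 /=.
have := alternating_move [::] p c1 [::] j c2 hphi; rewrite cats0 /= => ->.
by rewrite -catA.
Qed.

Section PiOperad.

Lemma cl_map_id (I : finType) (f : I -> I) (w : word I) : f =1 id -> cl (map (map f) w) = cl w.
Proof.
move=> fid; congr cl; rewrite -[RHS]map_id; apply: eq_map => b.
by rewrite -[RHS]map_id; apply: eq_map.
Qed.

Lemma map_mapE (X Y Z : Type) (f : X -> Y) (g : Y -> Z) (w : word X) :
  map (map g) (map (map f) w) = map (map (g \o f)) w.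
Proof. by rewrite -map_comp; apply: eq_map => b /=; rewrite -map_comp. Qed.

Lemma eq_map_map (X Y : Type) (f g : X -> Y) (w : word X) :
  f =1 g -> map (map f) w = map (map g) w.
Proof. by move=> fg; apply: eq_map => b; apply: eq_map. Qed.

Lemma cl_ext_map (L : neFin) (X : eqType) (k : L -> X) (I : Type) (f : I -> X) (g : I -> L) w :
  injective k -> f =1 k \o g -> cl_ext k (map (map f) w) = cl (map (map g) w).
Proof. by move=> kI fg; rewrite (eq_map_map _ fg) -map_mapE cl_extE. Qed.

Lemma Pi_map_chain (I J : neFin) (f : I -> J) :
  bijective f -> @chain_map (Pi_cplx I) (Pi_cplx J) (mapPi f).
Proof.
move=> fbij; split=> /=.
- exact: mapPiD.
- move=> n; apply: degPi_ind => [|x y hx hy|w hw <-].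
  + by rewrite (additive0 (mapPiD f)); apply: degPi0.
  + by rewrite (additiveB (mapPiD f)); apply: degPiB.
  + by rewrite mapPi_cl // -(wdim_map f); apply/degPi_cl/map_is_expr.
- apply: PiM_ext => [x y|x y|w hw]; rewrite ?mapPiD ?dPiD ?mapPiD //.
  rewrite mapPi_cl // [RHS]dPi_cl; last exact: map_is_expr.
  apply: (@dPi_push _ I (mapPi f) J (@cl J) f) => //; first exact: mapPiD.
  by move=> u hu; rewrite mapPi_cl.
Qed.

Lemma Pi_map_id (I : neFin) (f : I -> I) : f =1 id -> forall x : PiM I, mapPi f x = x.
Proof.
move=> fid; apply: PiM_ext => // [|w hw]; first exact: mapPiD.
by rewrite mapPi_cl // cl_map_id.
Qed.

Lemma Pi_map_comp (I J K : neFin) (f : I -> J) (g : J -> K) (h : I -> K) :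
  bijective f -> h =1 g \o f ->
  forall x : PiM I, mapPi h x = mapPi g (mapPi f x).
Proof.
move=> fbij hgf; apply: PiM_ext => [||w hw]; first exact: mapPiD.
  exact: (additive_comp (mapPiD g) (mapPiD f)).
rewrite !mapPi_cl //; last exact: map_is_expr.
by rewrite map_mapE (eq_map_map _ hgf).
Qed.

Lemma Pi_comp_deg (I J : neFin) (i : I) m n (x : PiM I) (y : PiM J) :
  degPi m x -> degPi n y -> degPi (m + n) (compPi i x y).
Proof.
move=> hx hy; move: x hx; apply: degPi_ind => [|x x' hx hx'|p hp <-].
- by rewrite (additive0 (compPiDl _ _)); apply: degPi0.
- by rewrite (additiveB (compPiDl _ _)); apply: degPiB.
move: y hy; apply: degPi_ind => [|y y' hy hy'|q hq <-].
- by rewrite (additive0 (compPiDr _ _)); apply: degPi0.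
- by rewrite (additiveB (compPiDr _ _)); apply: degPiB.
apply/degPiP/eqP; rewrite -subr_eq0; apply/eqP.
pose k (l : subst i J) : (I + J)%type := match l with inl u => inl (val u) | inr j => inr j end.
have kI : injective k by move=> [u|j] [u'|j'] //= [] => [/val_inj|] ->.
pose N := (wdim p + wdim q)%N.
pose theta (z : PiM (subst i J)) := deg_part (Posz N) z - z.
have tD : additive_fun theta.
  by move=> z z'; rewrite /theta deg_partD opprD addrACA.
rewrite -PoszD -/(theta _).
rewrite (@compPi_push I J i _ theta _ inl inr k
  (fun w => if wdim w == N then 0 else - cl_ext k w)) //; last first.
- by move=> ? ? [].
- move=> u hu; rewrite /theta deg_part_cl // /degF wdim_map eqz_nat cl_extE //.
  by case: ifP; rewrite ?subrr ?sub0r.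
have /andP[qn _] := hq.
rewrite (@eq_cword _ _ _ _ _ (fun=> 0 - 0)).
- rewrite (cwordD _ _ (fun=> 0) (fun=> - 0)) cword_opp.
  by rewrite subrr.
- by rewrite -size_eq0 size_map size_eq0; apply: is_expr_neq0 hq.
- by rewrite wne_map.
- by move=> u hu _ _; rewrite hu !wdim_map eqxx subrr.
Qed.

End PiOperad.

Section PiAxioms.

Lemma map_neq0 (X Y : eqType) (f : X -> Y) (w : word X) :
  w != [::] -> map (map f) w != [::].
Proof. by case: w. Qed.

Lemma expr_wne (I : finType) (w : word I) : is_expr w -> wne w.
Proof. by case/andP. Qed.

Lemma map_uniq_flatten (X Y : eqType) (f : X -> Y) (w : word X) :
  injective f -> uniq (flatten (map (map f) w)) = uniq (flatten w).
Proof. by move=> fI; rewrite -map_flatten map_inj_uniq. Qed.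

Lemma mem_flatten_map (X Y : eqType) (f : X -> Y) (w : word X) x :
  injective f -> (f x \in flatten (map (map f) w)) = (x \in flatten w).
Proof. by move=> fI; rewrite -map_flatten mem_map. Qed.

Lemma notin_flatten_map (X Y : eqType) (f : X -> Y) (w : word X) y :
  (forall x, f x != y) -> y \notin flatten (map (map f) w).
Proof.
by move=> h; rewrite -map_flatten; apply/mapP => -[x _ E]; move: (h x); rewrite E eqxx.
Qed.

Lemma expr_in (I : finType) (w : word I) i : is_expr w -> i \in flatten w.
Proof. by case/is_exprP. Qed.

Lemma expr_uniq (I : finType) (w : word I) : is_expr w -> uniq (flatten w).
Proof. by case/is_exprP. Qed.

Definition subst_emb (I J : neFin) (i : I) (l : subst i J) : (I + J)%type :=
  match l with inl u => inl (val u) | inr j => inr j end.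

Lemma subst_emb_inj (I J : neFin) (i : I) : injective (@subst_emb I J i).
Proof. by move=> [u|j] [u'|j'] //= [] => [/val_inj|] ->. Qed.

Lemma inl_inj (X Y : Type) : injective (@inl X Y). Proof. by move=> x y []. Qed.
Lemma inr_inj (X Y : Type) : injective (@inr X Y). Proof. by move=> x y []. Qed.

Lemma Pi_comp_diff (I J : neFin) (i : I) m (x : PiM I) (y : PiM J) :
  degPi m x ->
  dPi (compPi i x y) = compPi i (dPi x) y + compPi i x (dPi y) *~ (-1) ^+ `|m|%N.
Proof.
rewrite sgE.
move: x; apply: degPi_ind => [|x x' hx hx'|p hp <-].
- rewrite (additive0 (compPiDl i y)) (additive0 (@dPiD I)) (additive0 (compPiDl i y)).
  by rewrite (additive0 (compPiDl i (dPi y))) (additive0 (@dPiD _)) sg_0 addr0.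
- rewrite (additiveB (compPiDl i y)) !(additiveB (@dPiD _)) hx hx'.
  rewrite (additiveB (compPiDl i y)) (additiveB (compPiDl i (dPi y))).
  by signs.
rewrite absz_nat; move: y; apply: PiM_ext => [y z|y z|q hq].
- by rewrite compPiDr dPiD.
- by rewrite dPiD !compPiDr sg_add addrACA.
have k_inj := @subst_emb_inj I J i; set k := @subst_emb I J i in k_inj.
rewrite (@compPi_push I J i _ (@dPi _) _ inl inr k (dword (cl_ext k))) //; first last.
- exact: inl_inj.
- move=> u hu; rewrite dPi_cl // dword_map; congr dword.
  by apply/funext => w /=; rewrite cl_extE.
- exact: dPiD.
have E p' q' : is_expr p' -> is_expr q' -> compPi i (cl p') (cl q') =
    cword (inl i) (map (map inr) q') (cl_ext k) (map (map inl) p').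
  move=> hp' hq'; apply: (@compPi_push I J i _ id _ inl inr k (cl_ext k)) => //.
    by move=> u _; rewrite cl_extE.
  exact: inl_inj.
rewrite cword_dword ?wne_map ?map_uniq_flatten ?mem_flatten_map //;
  try (by [exact: cl_ext_alternating | exact: map_neq0 (is_expr_neq0 hq)
     | exact: expr_wne | exact: expr_in | exact: expr_uniq | exact: inl_inj]).
congr (_ + _).
  rewrite (@dPi_push _ I (fun x => compPi i x (cl q)) _
    (cword (inl i) (map (map inr) q) (cl_ext k)) inl) //; first exact: compPiDl.
  by move=> u hu; rewrite E.
rewrite wdim_map (@dPi_push _ J (fun y => compPi i (cl p) y) _
    (fun m' => cword (inl i) m' (cl_ext k) (map (map inl) p)) inr) //; first exact: compPiDr.
by move=> u hu; rewrite E.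
Qed.

Lemma Pi_comp_map (I J I' J' : neFin) (i : I) (f : I -> I') (g : J -> J')
    (h : subst i J -> subst (f i) J') :
  bijective f -> bijective g -> bijective h ->
  subst_map_spec i f g h -> forall (x : PiM I) (y : PiM J),
  mapPi h (compPi i x y) = compPi (f i) (mapPi f x) (mapPi g y).
Proof.
move=> fbij gbij hbij [hl hr] x y; move: x; apply: PiM_ext => [x x'|x x'|p hp].
- by rewrite compPiDl mapPiD.
- by rewrite mapPiD compPiDl.
move: y; apply: PiM_ext => [y y'|y y'|q hq].
- by rewrite compPiDr mapPiD.
- by rewrite mapPiD compPiDr.
have fI := bij_inj fbij.
have k_inj := @subst_emb_inj I' J' (f i); set k := @subst_emb I' J' (f i) in k_inj.
rewrite !mapPi_cl //.
rewrite (@compPi_push I J i _ (mapPi h) _ (inl \o f) (inr \o g) (k \o h) (cl_ext k)) //; first last.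
- by move=> j /=; rewrite hr.
- move=> u /=; have hu : f (val u) != f i by rewrite inj_eq // (valP u).
  by rewrite (hl u (exist _ (f (val u)) hu)).
- by move=> a b [] /fI.
- by move=> u hu; rewrite mapPi_cl // -(map_mapE h k) cl_extE.
- exact: mapPiD.
rewrite (@compPi_push I' J' (f i) _ id _ inl inr k (cl_ext k)) //; first last.
- exact: map_is_expr.
- exact: map_is_expr.
- exact: inl_inj.
- by move=> u hu; rewrite cl_extE.
by rewrite !map_mapE.
Qed.

Section Associativity.
Variables (I J K : neFin).

Let X : eqType := (I + (J + K))%type.

(** All letters are placed in I + (J + K), the holes i and j included. *)
Lemma Pi_comp_seq (i : I) (j : J)
    (h : @subst (subst i J) (inr j) K -> subst i (subst j K)) :
  bijective h -> subst_seq_spec i j h ->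
  forall (x : PiM I) (y : PiM J) (z : PiM K),
  mapPi h (@compPi (subst i J) K (inr j) (compPi i x y) z) =
    @compPi I (subst j K) i x (compPi j y z).
Proof.
move=> hbij [h1 h2 h3] x y z; move: x; apply: PiM_ext => [x x'|x x'|p hp].
- by rewrite !compPiDl mapPiD.
- by rewrite compPiDl.
move: y; apply: PiM_ext => [y y'|y y'|q hq].
- by rewrite compPiDr compPiDl mapPiD.
- by rewrite compPiDl compPiDr.
move: z; apply: PiM_ext => [z z'|z z'|r hr].
- by rewrite compPiDr mapPiD.
- by rewrite !compPiDr.
pose k (l : subst i (subst j K)) : X := match l with
  | inl u => inl (val u) | inr (inl v) => inr (inl (val v)) | inr (inr c) => inr (inr c) end.
have k_inj : injective k.
  move=> [u|[v|c]] [u'|[v'|c']] //= []; first by move/val_inj->.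
    by move/val_inj->.
  by move=> ->.
pose k1 (l : subst i J) : X := match l with
  | inl u => inl (val u) | inr v => inr (inl v) end.
have k1_inj : injective k1.
  by move=> [u|v] [u'|v'] //= []; [move/val_inj-> | move->].
pose iJ : J -> X := inr \o inl; pose iK : K -> X := inr \o inr.
have iJ_inj : injective iJ by move=> a b [].
pose k2 (l : subst j K) : X := match l with
  | inl v => inr (inl (val v)) | inr c => inr (inr c) end.
rewrite (@compPi_push I J i _ (fun w => mapPi h (@compPi (subst i J) K (inr j) w (cl r)))
   X inl iJ k1 (cword (inr (inl j) : X) (map (map iK) r) (cl_ext k))) //; first last.
- exact: inl_inj.
- move=> u hu.
  rewrite (@compPi_push (subst i J) K (inr j) _ (mapPi h) X k1 iK (k \o h) (cl_ext k)) //.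
  + exact: mapPiD.
  + by move=> w hw; rewrite mapPi_cl // -(map_mapE h _) cl_extE.
  + case=> [[v|v] hv] /=; first by rewrite (h1 _ v).
    have vj : v != j by apply: contra hv => /eqP->.
    by rewrite (h2 _ (exist _ v vj)).
  + by move=> c /=; rewrite h3.
- exact: (additive_comp (mapPiD h) (compPiDl _ _)).
rewrite (@compPi_push J K j _ (fun w => @compPi I (subst j K) i (cl p) w) X iJ iK k2
   (fun v => cword (inl i : X) v (cl_ext k) (map (map inl) p))) //; first last.
- move=> u hu; rewrite (@compPi_push I (subst j K) i _ id X inl k2 k (cl_ext k)) //.
  + by move=> w hw; rewrite cl_extE.
  + exact: inl_inj.
- exact: compPiDr.
apply: cword_seq.
- exact: map_neq0 (is_expr_neq0 hq).
- by rewrite wne_map expr_wne.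
- exact: map_neq0 (is_expr_neq0 hr).
- by rewrite wne_map expr_wne.
- by rewrite mem_flatten_map ?expr_in //; apply: inl_inj.
- by rewrite map_uniq_flatten ?expr_uniq //; apply: inl_inj.
- exact: notin_flatten_map.
- by rewrite (mem_flatten_map (f := iJ)) ?expr_in.
Qed.

(** Antisymmetry brings two holes in the same block to its end. *)
Lemma par_normal_form (p : word I) (i i' : I) : is_expr p -> i != i' ->
  exists n A B c, [/\ cl p = sg n (cl (A ++ c :: B)), is_expr (A ++ c :: B),
    i \notin flatten A /\ i' \notin flatten A, (i \in c) || (i' \in c)
    & (i \in c) && (i' \in c) -> exists b, c = b ++ [:: i'; i]].
Proof.
move=> hp nii.
have : has (fun c => (i \in c) || (i' \in c)) p.
  by have /flattenP[b bp ib] := expr_in i hp; apply/hasP; exists b; rewrite ?ib.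
move: hp; rewrite has_find => hp; set l := find _ p => lp.
have E : p = take l p ++ nth [::] p l :: drop l.+1 p by rewrite -drop_nth // cat_take_drop.
have hc : (i \in nth [::] p l) || (i' \in nth [::] p l).
  by apply: (@nth_find _ [::] (fun c => (i \in c) || (i' \in c))); rewrite has_find.
set A := take l p in E; set c := nth [::] p l in E hc; set B := drop l.+1 p in E.
have hA : all (fun c => (i \notin c) && (i' \notin c)) A.
  apply/allP => d dA; rewrite -negb_or; apply/negP => id.
  have : (find (fun c => (i \in c) || (i' \in c)) p < size A)%N.
    rewrite E find_cat; case: hasP => [_|[]]; last by exists d.
    by rewrite -has_find; apply/hasP; exists d.
  by rewrite -/l size_take lp ltnn.
have notA x : (x == i) || (x == i') -> x \notin flatten A.
  move=> hx; apply/flattenP => -[d dA xd]; have /andP[h1 h2] := allP hA _ dA.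
  by case/orP: hx xd => /eqP->; apply/negP.
have hA2 : i \notin flatten A /\ i' \notin flatten A by rewrite !notA ?eqxx ?orbT.
have [/andP[ic i'c]|hii] := boolP ((i \in c) && (i' \in c)); last first.
  by exists 0%N, A, B, c; split=> //; rewrite -?E // => h; rewrite h in hii.
have pc : perm_eq c (rem i (rem i' c) ++ [:: i'; i]).
  have ir : i \in rem i' c by rewrite rem_mem.
  apply: (perm_trans (perm_to_rem i'c)).
  by rewrite perm_sym perm_catC /= perm_cons perm_sym perm_to_rem.
have [n En] := alternating_perm A B [::] (@cl_alternating I) pc.
exists n, A, B, (rem i (rem i' c) ++ [:: i'; i]); split=> //.
- by rewrite {1}E.
- have cn : c != [::] by case: (c) ic.
  move: hp; apply: is_expr_perm; rewrite E.
    rewrite /wne !all_cat /= => /and3P[-> _ ->]; rewrite andbT.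
    by case: (rem i _).
  by rewrite !flatten_cat /= perm_cat2l perm_cat2r.
- by rewrite !mem_cat !inE !eqxx !orbT.
by move=> _; exists (rem i (rem i' c)).
Qed.

Lemma Pi_comp_par (i i' : I) (a : del i) (b : del i')
    (h : @subst (subst i J) (inl a) K -> @subst (subst i' K) (inl b) J) :
  bijective h -> val a = i' -> val b = i -> subst_par_spec a b h ->
  forall m n (x : PiM I) (y : PiM J) (z : PiM K), degPi m y -> degPi n z ->
  mapPi h (@compPi (subst i J) K (inl a) (compPi i x y) z) =
    @compPi (subst i' K) J (inl b) (compPi i' x z) y *~ (-1) ^+ `|(m * n)%R|%N.
Proof.
move=> hbij ai' bi [h1 h2 h3] m n x y z; rewrite sgE => hy hz; move: y hy.
apply: degPi_ind => [|y y' hy hy'|q hq <-].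
- rewrite (additive0 (compPiDr _ _)) (additive0 (compPiDl _ _)) (additive0 (mapPiD h)).
  by rewrite (additive0 (compPiDr _ _)) sg_0.
- rewrite (additiveB (compPiDr _ _)) (additiveB (compPiDl _ _)) (additiveB (mapPiD h)).
  by rewrite (additiveB (compPiDr _ _)) hy hy' sg_add sg_opp.
move: z hz; apply: degPi_ind => [|z z' hz hz'|r hr <-].
- rewrite (additive0 (compPiDr _ _)) (additive0 (mapPiD h)).
  by rewrite (additive0 (compPiDr _ _)) (additive0 (compPiDl _ _)) sg_0.
- rewrite (additiveB (compPiDr _ _)) (additiveB (mapPiD h)) (additiveB (compPiDr _ _)).
  by rewrite (additiveB (compPiDl _ _)) hz hz' sg_add sg_opp.
rewrite -PoszM absz_nat.
have nii : i != i' by rewrite -ai' eq_sym (valP a).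
pose F x := mapPi h (@compPi (subst i J) K (inl a) (compPi i x (cl q)) (cl r)).
pose G x := @compPi (subst i' K) J (inl b) (compPi i' x (cl r)) (cl q).
have FD : additive_fun F by move=> s t; rewrite /F !compPiDl mapPiD.
have GD : additive_fun G by move=> s t; rewrite /G !compPiDl.
rewrite -/(F x) -/(G x); move: x; apply: PiM_ext => // [s t|p hp].
  by rewrite GD sg_add.
have [k [A [B [c [-> {}hp [iA i'A] hc hcb]]]]] := par_normal_form hp nii.
rewrite (additive_sg FD) (additive_sg GD) -sgD addnC sgD; congr sg.
set p' := A ++ c :: B in hp *; rewrite /F /G; clear FD GD F G.
pose kk (l : @subst (subst i' K) (inl b) J) : X := match l with
  | inl u => match val u with inl v => inl (val v) | inr c => inr (inr c) end
  | inr v => inr (inl v) end.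
have kk_inj : injective kk.
  move=> [[[u|u] hu]|v] [[[u'|u'] hu']|v'] //= [].
  - by move/val_inj => E; subst u'; congr (inl (exist _ _ _)); apply: eq_irrelevance.
  - by move=> E; subst u'; congr (inl (exist _ _ _)); apply: eq_irrelevance.
  - by move=> ->.
pose k1 (l : subst i J) : X := match l with
  | inl u => inl (val u) | inr v => inr (inl v) end.
have k1_inj : injective k1.
  by move=> [u|v] [u'|v'] //= []; [move/val_inj-> | move->].
pose k2 (l : subst i' K) : X := match l with
  | inl u => inl (val u) | inr v => inr (inr v) end.
have k2_inj : injective k2.
  by move=> [u|v] [u'|v'] //= []; [move/val_inj-> | move->].
pose iJ : J -> X := inr \o inl; pose iK : K -> X := inr \o inr.
have k1a : k1 (inl a) = inl i' by rewrite /= ai'.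
have k2b : k2 (inl b) = inl i by rewrite /= bi.
rewrite (@compPi_push I J i _ (fun w => mapPi h (@compPi (subst i J) K (inl a) w (cl r)))
   X inl iJ k1 (cword (inl i' : X) (map (map iK) r) (cl_ext kk))) //; first last.
- exact: inl_inj.
- move=> u hu.
  rewrite (@compPi_push (subst i J) K (inl a) _ (mapPi h) X k1 iK (kk \o h) (cl_ext kk)) //.
  + by rewrite k1a.
  + exact: mapPiD.
  + by move=> w hw; rewrite mapPi_cl // -(map_mapE h _) cl_extE.
  + case=> [[v|v] hv] /=; last by rewrite (h2 _ v).
    have vi' : val v != i' by rewrite -ai'; apply: contra hv => /eqP/val_inj->.
    pose v' : del i' := exist _ (val v) vi'.
    have hv' : (inl v' : subst i' K) != inl b.
      have vi := valP v; apply/eqP => -[vb].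
      have E : val v = i := etrans (congr1 val vb) bi.
      by move: vi => /=; rewrite E eqxx.
    by rewrite (h1 _ (exist _ (inl v') hv' : @del (subst i' K) (inl b)) v v').
  + move=> c' /=; have hc' : (inr c' : subst i' K) != inl b by [].
    by rewrite (h3 (exist _ (inr c') hc' : @del (subst i' K) (inl b)) c').
- exact: (additive_comp (mapPiD h) (compPiDl _ _)).
rewrite (@compPi_push I K i' _ (fun w => @compPi (subst i' K) J (inl b) w (cl q))
   X inl iK k2 (cword (inl i : X) (map (map iJ) q) (cl_ext kk))) //; first last.
- exact: inl_inj.
- move=> u hu.
  rewrite (@compPi_push (subst i' K) J (inl b) _ id X k2 iJ kk (cl_ext kk)) //.
  + by rewrite k2b.
  + by move=> w hw; rewrite cl_extE.
- exact: compPiDl.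
rewrite /p' in hp *; rewrite map_cat map_cons.
have linj := @inl_inj I (J + K)%type.
have U : uniq (flatten (c :: B)).
  by have := expr_uniq hp; rewrite flatten_cat cat_uniq => /and3P[].
have inB x : x \notin flatten A -> x \in flatten (c :: B).
  by move=> xA; have := expr_in x hp; rewrite flatten_cat mem_cat (negbTE xA).
rewrite -[wdim q](wdim_map iJ) -[wdim r](wdim_map iK).
apply: cword_par.
- exact: cl_ext_alternating.
- exact: map_neq0 (is_expr_neq0 hq).
- by rewrite wne_map expr_wne.
- exact: map_neq0 (is_expr_neq0 hr).
- by rewrite wne_map expr_wne.
- by rewrite inj_eq.
- exact: notin_flatten_map.
- exact: notin_flatten_map.
- by rewrite mem_flatten_map.
- by rewrite mem_flatten_map.
- by rewrite !mem_map.
- by rewrite -(map_cons (map inl)) mem_flatten_map // inB.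
- by rewrite -(map_cons (map inl)) mem_flatten_map // inB.
- by rewrite -(map_cons (map inl)) map_uniq_flatten.
- by rewrite !mem_map // => /hcb[d ->]; exists (map inl d); rewrite map_cat.
Qed.

End Associativity.

Lemma Pi_unitl (J : neFin) (h : J -> @subst pt tt J) :
  (forall j, h j = inr j) ->
  forall y : PiM J, @compPi pt J tt (cl [:: [:: tt]]) y = mapPi h y.
Proof.
move=> hE; have hu : @is_expr (pt : finType) [:: [:: tt]].
  by apply/is_exprP; split=> // -[].
apply: PiM_ext => [||q hq]; [exact: compPiDr | exact: mapPiD |].
have k_inj := @subst_emb_inj pt J tt; set k := @subst_emb pt J tt in k_inj.
rewrite (@compPi_push pt J tt _ id _ inl inr k (cl_ext k)) //; first last.
- exact: inl_inj.
- by move=> u _; rewrite cl_extE.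
rewrite mapPi_cl // [map _ [:: [:: tt]]]/= cword_hit ?mem_head // wdim_nil muln0 addn0 shuf0s.
have -> : after (inl tt : (pt + J)%type) [:: inl tt] = 0%N by rewrite /after /= ?eqxx.
rewrite -(cl_ext_map (f := inr) _ k_inj); last by move=> j /=; rewrite hE.
by have := is_expr_neq0 hq; case: (q) => // b w _; rewrite /sg /= ?eqxx.
Qed.

Lemma Pi_unitr (I : neFin) (i : I) (h : I -> subst i pt) :
  (forall u : del i, h (val u) = inl u) -> h i = inr tt ->
  forall x : PiM I, @compPi I pt i x (cl [:: [:: tt]]) = mapPi h x.
Proof.
move=> hl hr; have hu : @is_expr (pt : finType) [:: [:: tt]].
  by apply/is_exprP; split=> // -[].
apply: PiM_ext => [||p hp]; [exact: compPiDl | exact: mapPiD |].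
have k_inj := @subst_emb_inj I pt i; set k := @subst_emb I pt i in k_inj.
have linj := @inl_inj I pt.
rewrite (@compPi_push I pt i _ id _ inl inr k (cl_ext k)) //; last first.
- by move=> u _; rewrite cl_extE.
rewrite mapPi_cl // [map _ [:: [:: tt]]]/= cword_unit.
- rewrite map_mapE (cl_ext_map (g := h)) // => x /=.
  rewrite inj_eq //; case: eqP => [->|/eqP xi]; first by rewrite hr.
  by rewrite (hl (exist _ x xi : del i)).
- exact: cl_ext_alternating.
- by rewrite mem_flatten_map ?expr_in.
- by rewrite map_uniq_flatten ?expr_uniq.
Qed.

Lemma Pi_dgOperad : is_dgOperad Pi.
Proof.
have hu : @is_expr (pt : finType) [:: [:: tt]].
  by apply/is_exprP; split=> // -[].
split.
- by move=> I; apply: Pi_complex.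
- by move=> I J f fbij; apply: Pi_map_chain.
- by move=> I f fbij; apply: Pi_map_id.
- by move=> I J K f g h fbij gbij hbij hE; apply: Pi_map_comp.
- by move=> I J i y; apply: compPiDl.
- by move=> I J i x; apply: compPiDr.
- by move=> I J i m n x y; apply: Pi_comp_deg.
- by move=> I J i m x y; apply: Pi_comp_diff.
- by move=> I J I' J' i f g h fbij gbij hbij hE x y; apply: Pi_comp_map.
- by move=> I J K i j h hbij hE x y z; apply: Pi_comp_seq.
- by move=> I J K i i' a b h hbij ha hb hE m n x y z; apply: Pi_comp_par.
- by have := degPi_cl hu; rewrite wdim_cons wdim_nil.
- by have := dPi_cl hu; rewrite /= addr0 /sg /=.
- by move=> J h hbij hE y; apply: Pi_unitl.
- by move=> I i h hbij hl hr x; apply: Pi_unitr.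
Qed.

End PiAxioms.

(** * Contraction by a letter *)

Section Contraction.
Variables (X : eqType) (x : X).
Implicit Types (b c e : seq X) (w A u : word X).

Section Operators.
Variable V : zmodType.
Implicit Types (phi psi : word X -> V).

(** Contraction by x: x is moved to the front of its block and deleted. A word in
    which x is alone goes to 0, as blocks are not empty. *)
Fixpoint rword phi w : V :=
  if w is c :: w' then
    if x \in c then
      if c == [:: x] then 0 else sg (index x c) (phi (rem x c :: w'))
    else sg (bdim c) (rword (phi \o cons c) w')
  else 0.

(** Deletes an initial block {x}, the other words going to 0. *)
Definition tword phi w : V :=
  if w is c :: w' then if c == [:: x] then phi w' else 0 else 0.

(** Deletes a final block {x}, the other words going to 0. *)
Fixpoint pword phi w : V :=
  if w is c :: w' then
    if w' is [::] then if c == [:: x] then phi [::] else 0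
    else pword (phi \o cons c) w'
  else 0.

(** The homotopy: x is taken out of its block and inserted as a block at all
    places before it. *)
Fixpoint hword phi w : V :=
  if w is c :: w' then
    rword (phi \o cons [:: x]) w +
    (if x \in c then 0 else sg (bdim c) (hword (phi \o cons c) w'))
  else 0.

Lemma hword_cons phi c w : hword phi (c :: w) = rword (phi \o cons [:: x]) (c :: w) +
   (if x \in c then 0 else sg (bdim c) (hword (phi \o cons c) w)).
Proof. by []. Qed.

Lemma rwordD phi psi w : rword (fun u => phi u + psi u) w = rword phi w + rword psi w.
Proof.
elim: w phi psi => [|c w IH] phi psi /=; first by rewrite addr0.
case: ifP => _; last by rewrite (IH (phi \o cons c)) sg_add.
by case: ifP => _; rewrite ?addr0 ?sg_add.
Qed.

Lemma rword_sg n phi w : rword (fun u => sg n (phi u)) w = sg n (rword phi w).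
Proof.
elim: w phi => [|c w IH] phi /=; first by rewrite sg_0.
case: ifP => _; first by case: ifP => _; rewrite ?sg_0 // -!sgD addnC.
by rewrite (IH (phi \o cons c)) -!sgD addnC.
Qed.

Lemma hwordD phi psi w : hword (fun u => phi u + psi u) w = hword phi w + hword psi w.
Proof.
elim: w phi psi => [|c w IH] phi psi; first by rewrite /= addr0.
rewrite !hword_cons (rwordD (phi \o cons [:: x])) (IH (phi \o cons c)) sg_add.
by case: ifP => _; signs.
Qed.

Lemma hword_sg n phi w : hword (fun u => sg n (phi u)) w = sg n (hword phi w).
Proof.
elim: w phi => [|c w IH] phi; first by rewrite /= sg_0.
rewrite !hword_cons (rword_sg n (phi \o cons [:: x])) (IH (phi \o cons c)).
by case: ifP => _; signs.
Qed.

Lemma pwordD phi psi w : pword (fun u => phi u + psi u) w = pword phi w + pword psi w.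
Proof.
elim: w phi psi => [|c [|d w] IH] phi psi //=; first by rewrite addr0.
  by case: ifP; rewrite ?addr0.
by rewrite -(IH (phi \o cons c) (psi \o cons c)).
Qed.

Lemma pword_out phi w : x \notin flatten w -> pword phi w = 0.
Proof.
elim: w phi => [|c [|d w] IH] phi //=.
  by rewrite cats0; case: eqP => // ->; rewrite mem_head.
by rewrite mem_cat negb_or => /andP[_ h]; apply: IH.
Qed.

Lemma eq_rword phi psi w : wne w ->
  (forall u, wne u -> perm_eq (x :: flatten u) (flatten w) ->
     wdim w = (wdim u).+1 -> phi u = psi u) ->
  rword phi w = rword psi w.
Proof.
elim: w phi psi => [|c w IH] phi psi //= /andP[cn wn] h; case: ifP => xc.
  case: ifP => // cx; congr sg.
  have rn : rem x c != [::].
    have := size_rem xc; case: (rem x c) => // /esym sc.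
    move: cx; move: sc cn xc; case: (c) => [|y [|z d]] //= _ _.
    by rewrite inE => /eqP->; rewrite eqxx.
  apply: h => /=; rewrite ?rn //.
    by rewrite -cat_cons perm_cat2r perm_sym perm_to_rem.
  rewrite !wdim_cons -addSn -size_bdim // size_rem //.
congr sg; apply: IH => // u un pu du; apply: h => /=; rewrite ?cn //.
- rewrite -(perm_cat2l c) in pu; apply: perm_trans pu.
  by rewrite -cat1s perm_catCA.
- by rewrite !wdim_cons du addnS.
Qed.

Lemma eq_hword phi psi w : wne w ->
  (forall u, wne u -> perm_eq (flatten u) (flatten w) ->
     wdim w = (wdim u).+1 -> phi u = psi u) ->
  hword phi w = hword psi w.
Proof.
elim: w phi psi => [|c w IH] phi psi // wn h.
rewrite !hword_cons; congr (_ + _).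
  apply: eq_rword => // u un pu du; apply: h => //=.
  by rewrite du [X in _ = X.+1]wdim_cons.
case: ifP => _ //; congr sg; have /andP[cn wn'] := wn; apply: IH => // u un pu du.
by apply: h => /=; rewrite ?cn ?perm_cat2l // !wdim_cons du addnS.
Qed.

Lemma eq_pword phi psi w : wne w ->
  (forall u, wne u -> perm_eq (x :: flatten u) (flatten w) ->
     wdim u = wdim w -> phi u = psi u) ->
  pword phi w = pword psi w.
Proof.
elim: w phi psi => [|c w IH] phi psi // /andP[cn wn] h.
case: w wn IH h => [|d w] wn IH h.
  rewrite /=; case: eqP => // cx; apply: h => //=; first by rewrite cx.
  by rewrite cx wdim_cons.
have H F : pword F [:: c, d & w] = pword (F \o cons c) (d :: w) by [].
rewrite !H; apply: IH => // u un pu du; apply: h => /=.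
- by rewrite cn.
- rewrite -(perm_cat2l c) in pu; apply: perm_trans pu.
  by rewrite -cat1s perm_catCA.
- by rewrite !(wdim_cons c) du.
Qed.

End Operators.

Section Pushing.
Variables (V W : zmodType) (theta : V -> W) (tD : additive_fun theta).

Lemma rword_push (phi : word X -> V) w : theta (rword phi w) = rword (theta \o phi) w.
Proof.
elim: w phi => [|c w IH] phi /=; first exact: additive0.
case: ifP => _; last by rewrite (additive_sg tD) IH.
by case: ifP => _; rewrite ?(additive0 tD) ?(additive_sg tD).
Qed.

Lemma hword_push (phi : word X -> V) w : theta (hword phi w) = hword (theta \o phi) w.
Proof.
elim: w phi => [|c w IH] phi; first by rewrite /= (additive0 tD).
rewrite !hword_cons tD rword_push; congr (_ + _).
by case: ifP => _; rewrite ?(additive0 tD) ?(additive_sg tD) ?IH.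
Qed.

Lemma pword_push (phi : word X -> V) w : theta (pword phi w) = pword (theta \o phi) w.
Proof.
elim: w phi => [|c [|d w] IH] phi //=; first exact: additive0.
  by case: ifP => _ //; apply: additive0.
exact: (IH (phi \o cons c)).
Qed.

Lemma shuf_push (phi : word X -> V) s t : theta (shuf phi s t) = shuf (theta \o phi) s t.
Proof.
by rewrite /shuf (additive_sum tD); apply: eq_bigr => u _; rewrite (additive_sg tD).
Qed.

End Pushing.

Section Homotopy.
Variable V : zmodType.
Implicit Types (phi psi : word X -> V).

Lemma dword_consE phi c : dword phi \o cons c =
  (fun u => sg (bdim c) (merge_first c phi u + dword (phi \o cons c) u)).
Proof. by []. Qed.

Lemma rword_miss phi c w : x \notin c ->
  rword phi (c :: w) = sg (bdim c) (rword (phi \o cons c) w).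
Proof. by move=> /negbTE /= ->. Qed.

Lemma rword_hit phi c w : x \in c -> c != [:: x] ->
  rword phi (c :: w) = sg (index x c) (phi (rem x c :: w)).
Proof. by move=> /= -> /negbTE->. Qed.

Lemma rword_alone phi w : rword phi ([:: x] :: w) = 0.
Proof. by rewrite /= mem_head eqxx. Qed.

Lemma cat_alone c e : c != [::] -> e != [::] -> c ++ e != [:: x].
Proof. by case: c e => [|y [|z c]] // [|t e] // _ _; rewrite /= !eqseq_cons /= ?andbF. Qed.

Lemma rem_size2 c : x \in c -> c != [:: x] -> bdim c = (bdim (rem x c)).+1 /\ rem x c != [::].
Proof.
move=> xc cx; rewrite -size_eq0 /bdim (size_rem xc).
case: c xc cx => [|y [|z c]] //; by rewrite inE => /eqP ->; rewrite eqxx.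
Qed.

(** Contraction anticommutes with merging, except for the merges with a block
    {x}: its two neighbours give terms which cancel, unless {x} is at one of the
    ends of the word. *)
Lemma dword_rword phi w : wne w -> x \in flatten w -> uniq (flatten w) ->
  dword (rword phi) w + rword (dword phi) w = tword phi w - pword phi w.
Proof.
elim: w phi => [|c w IH] phi // /andP[cn wn].
rewrite [flatten _]/= mem_cat cat_uniq => xcw /and3P[cu cw wu].
have [xc|xc] := boolP (x \in c).
  have xw : x \notin flatten w by apply: contra cw => xw; apply/hasP; exists x.
  have p0 psi : w != [::] -> pword psi (c :: w) = 0.
    by case: (w) xw => // d w' h _; apply: (pword_out (psi \o cons c) h).
  have [cx|cx] := eqVneq c [:: x].
    rewrite cx rword_alone addr0 dword_cons.
    have -> : rword phi \o cons [:: x] = fun=> sg 0 0.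
      by apply/funext => u /=; rewrite mem_head eqxx.
    rewrite dword_sg dword_0 sg_0 addr0.
    have -> : tword phi ([:: x] :: w) = phi w by rewrite /= eqxx.
    rewrite cx in p0; case: w wn {xw wu cw IH xcw} p0 => [|e w] wn p0.
      by rewrite /= eqxx subrr sg_0.
    case/andP: wn => en _; rewrite p0 // subr0 /merge_first.
    by rewrite rword_hit ?mem_head ?cat_alone //= ?eqxx /sg.
  have [bc rn] := rem_size2 xc cx.
  rewrite rword_hit // dword_cons.
  have -> : rword phi \o cons c = fun u => sg (index x c) ((phi \o cons (rem x c)) u).
    by apply/funext => u /=; rewrite xc (negbTE cx).
  rewrite dword_sg dword_cons bc.
  have -> : merge_first c (rword phi) w = sg (index x c) (merge_first (rem x c) phi w).
    case: w wn {IH xcw cw wu xw p0} => [|e w] /=; first by rewrite sg_0.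
    case/andP => en _; rewrite mem_cat xc /= (negbTE (cat_alone cn en)).
    by rewrite index_cat xc rem_cat xc.
  have -> : tword phi (c :: w) = 0 by rewrite /= (negbTE cx).
  have -> : pword phi (c :: w) = 0.
    by case: (w) p0 => [|d w'] p0; [rewrite /= (negbTE cx) | apply: p0].
  signs.
have {}xcw : x \in flatten w by move: xcw; rewrite (negbTE xc).
have cx : c != [:: x] by apply: contra xc => /eqP->; rewrite mem_head.
have -> : tword phi (c :: w) = 0 by rewrite /= (negbTE cx).
have -> : pword phi (c :: w) = pword (phi \o cons c) w by case: (w) xcw.
rewrite rword_miss // dword_consE rword_sg rwordD dword_cons.
have -> : rword phi \o cons c = fun u => sg (bdim c) (rword (phi \o cons c) u).
  by apply/funext => u /=; rewrite (negbTE xc).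
rewrite dword_sg.
have E : sg (bdim c) (merge_first c (rword phi) w) + rword (merge_first c phi) w =
    - tword (phi \o cons c) w.
  case: w wn xcw {IH cw wu} => [|e w] //= /andP[en wn] xew.
  rewrite mem_cat (negbTE xc) /=; case: ifP => xe.
    rewrite (negbTE (cat_alone cn en)) index_cat rem_cat (negbTE xc).
    have [->|ex] := eqVneq e [:: x].
      by rewrite /= eqxx cats0 (size_bdim cn) addr0 addn0 /=; signs.
    by rewrite (size_bdim cn); signs.
  have -> : (e == [:: x]) = false by apply: contraFF xe => /eqP->; rewrite mem_head.
  rewrite bdim_cat //; have -> : merge_first c phi \o cons e = phi \o cons (c ++ e) by [].
  by signs.
have := IH (phi \o cons c) wn xcw wu; rewrite addrC => /(canRL (addrK _)) ->.
by move/(canRL (addKr _)): E => ->; signs.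
Qed.

(** If x is in a larger block of w, the block {x} which h inserts is merged back
    with the rest of that block, giving w, or with another block, giving terms
    that cancel against h(d w). If {x} is a block of w, then h w = 0, and the two
    merges of {x} with its neighbours give in h(d w) the words where {x} moves to
    the left, with opposite signs but for w itself; when {x} is the last block,
    the merge with its only neighbour gives these words alone. *)
Lemma homotopy phi w : alternating phi -> wne w -> x \in flatten w ->
  uniq (flatten w) ->
  dword (hword phi) w + hword (dword phi) w =
  phi w - pword (shuf phi [:: [:: x]]) w.
Proof.
elim: w phi => [|c w IH] phi // hphi cwn; have /andP[cn wn] := cwn.
move=> xcw' cwu; have := cwu; have := xcw'.
rewrite [flatten _]/= mem_cat cat_uniq => xcw /and3P[cu cw wu].
have D1 := dword_rword (phi \o cons [:: x]) cwn xcw' cwu.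
have dx : dword phi \o cons [:: x] =
   (fun u => merge_first [:: x] phi u + dword (phi \o cons [:: x]) u).
  by apply/funext => u; rewrite /= /bdim /= /sg.
have [xc|xc] := boolP (x \in c).
  have xw : x \notin flatten w by apply: contra cw => xw; apply/hasP; exists x.
  have -> : dword (hword phi) (c :: w) = dword (rword (phi \o cons [:: x])) (c :: w).
    rewrite !dword_cons; congr (sg _ (_ + _)).
      by case: (w) => [|e w'] //; rewrite /merge_first hword_cons mem_cat xc addr0.
    by congr dword; apply/funext => u /=; rewrite xc addr0.
  rewrite hword_cons xc addr0 dx rwordD.
  rewrite [X in _ + X]addrC addrA D1.
  have p0 psi : w != [::] -> pword psi (c :: w) = 0.
    by case: (w) xw => // d w' h _; apply: (pword_out (psi \o cons c) h).
  have [cx|cx] := eqVneq c [:: x].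
    rewrite cx rword_alone /= eqxx addr0; congr (_ - _).
    case: (w) xw => [|d w'] h; first by rewrite shufs0.
    by rewrite !pword_out.
  rewrite rword_hit //.
  have -> : tword (phi \o cons [:: x]) (c :: w) = 0 by rewrite /= (negbTE cx).
  have pE psi : pword psi (c :: w) = 0.
    by case: (w) p0 => [|d w'] p0; [rewrite /= (negbTE cx) | apply: p0].
  rewrite !pE !subr0 add0r.
  case/splitPr: xc cu {cx pE p0 D1 cwn cn xcw' cwu xcw cw} => u v.
  rewrite cat_uniq /= negb_or => /and3P[_ /andP[xu _] _].
  rewrite index_pivot // rem_cat (negbTE xu) /= eqxx.
  by have := alternating_move [::] w [::] v x u hphi => /= ->; rewrite sgK.
have {}xcw : x \in flatten w by move: xcw; rewrite (negbTE xc).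
have w0 : w != [::] by case: (w) xcw.
have cx : c != [:: x] by apply: contra xc => /eqP->; rewrite mem_head.
have pc psi : pword psi (c :: w) = pword (psi \o cons c) w by case: (w) w0.
have -> : pword (shuf phi [:: [:: x]]) (c :: w) =
   pword (phi \o cons [:: x]) (c :: w) + pword (shuf (phi \o cons c) [:: [:: x]]) w.
  rewrite !pc -pwordD; congr pword; apply/funext => u /=.
  by rewrite shufSS shuf0s wdim_cons wdim_nil muln0 /sg.
have t0 : tword (phi \o cons [:: x]) (c :: w) = 0 by rewrite /= (negbTE cx).
rewrite {}t0 in D1.
have := IH _ (alternating_cons c hphi) wn xcw wu.
set L := dword (hword (phi \o cons c)) w + _ => EL.
have {EL} -> : pword (shuf (phi \o cons c) [:: [:: x]]) w = phi (c :: w) - L.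
  by rewrite EL opprB addrC subrK.
rewrite sub0r in D1; move/(congr1 -%R): D1; rewrite opprK => <-.
rewrite dword_cons hword_cons (negbTE xc) dx rwordD.
have hc : hword phi \o cons c = (fun u => rword (phi \o cons [:: x]) (c :: u)
    + sg (bdim c) (hword (phi \o cons c) u)).
  by apply/funext => u; rewrite /comp hword_cons (negbTE xc).
rewrite hc dwordD dword_sg dword_consE hword_sg hwordD.
rewrite [dword (rword _) (c :: w)]dword_cons.
set psi := fun u => phi ((c ++ [:: x]) :: u).
have -> : rword (merge_first [:: x] phi) (c :: w) = - rword psi w.
  rewrite rword_miss //.
  have -> : merge_first [:: x] phi \o cons c = fun u => sg (size c) (psi u).
    apply/funext => u; rewrite /psi /=.
    by have := alternating_move [::] u [::] [::] x c hphi => /=; rewrite cats0.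
  by rewrite rword_sg (size_bdim cn); signs.
have E : sg (bdim c) (merge_first c (hword phi) w) + hword (merge_first c phi) w =
    sg (bdim c) (merge_first c (rword (phi \o cons [:: x])) w) + rword psi w.
  case: (w) w0 wn => // e w' _ /andP[en _].
  have ME F : merge_first c F (e :: w') = F ((c ++ e) :: w') by [].
  rewrite !ME !hword_cons mem_cat (negbTE xc) orFb.
  have -> : (merge_first c phi) \o cons [:: x] = psi by [].
  have -> : (merge_first c phi) \o cons e = phi \o cons (c ++ e) by [].
  by rewrite bdim_cat //; case: ifP => _; signs.
have -> : (fun u => rword (phi \o cons [:: x]) (c :: u)) =
  rword (phi \o cons [:: x]) \o cons c by [].
rewrite /L; move/(canRL (addKr _)): E => ->; signs.
Qed.

(** Among the shuffles of {x} with A only the one where {x} comes last is kept. *)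
Lemma shuf_pword phi A : x \notin flatten A -> shuf (pword phi) [:: [:: x]] A = phi A.
Proof.
elim: A phi => [|c A IH] phi; first by rewrite shufs0 /= eqxx.
rewrite [flatten _]/= mem_cat negb_or => /andP[xc xA].
rewrite shufSS shuf0s wdim_cons wdim_nil muln0.
have -> : (pword phi \o cons [:: x]) (c :: A) = 0.
  have xcA : x \notin flatten (c :: A) by rewrite /= mem_cat negb_or xc.
  exact: (pword_out (phi \o cons [:: x]) xcA).
rewrite add0r {1}/sg /= -[RHS](IH (phi \o cons c) xA).
apply: eq_shuf => u pu; rewrite /comp /=.
case: u pu => // pu; by have := perm_size pu.
Qed.

Lemma rword_alt phi : alternating phi -> forall (A B : word X) (u v : seq X) (a b : X),
  uniq (flatten (A ++ (u ++ a :: b :: v) :: B)) ->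
  rword phi (A ++ (u ++ a :: b :: v) :: B) = - rword phi (A ++ (u ++ b :: a :: v) :: B).
Proof.
move=> hphi A B u v a b; elim: A phi hphi => [|d A IH] phi hphi; last first.
  move=> /= Uf; have U : uniq (flatten (A ++ (u ++ [:: a, b & v]) :: B)).
    by move: Uf; rewrite cat_uniq => /and3P[].
  case: ifP => _; last by rewrite IH ?sg_opp //; apply: alternating_cons.
  by case: ifP => _; rewrite ?oppr0 // -sg_opp -!cat_cons hphi.
rewrite !cat0s [flatten _]/= cat_uniq => /andP[Ub _].
have n1 y z : u ++ [:: y, z & v] != [:: x] by case: (u) => [|? [|? ?]]; rewrite /= !eqseq_cons /= ?andbF.
have E1 : (x \in u ++ [:: b, a & v]) = (x \in u ++ [:: a, b & v]).
  by rewrite !mem_cat !inE; do !bool_congr.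
have [ib|ib] := boolP (x \in u ++ [:: a, b & v]); last first.
  rewrite !rword_miss ?E1 // /bdim !size_cat /= -sg_opp; congr sg.
  rewrite -[RHS](rword_sg 1); congr rword; apply/funext => w.
  exact: (hphi [::]).
rewrite !rword_hit ?E1 //; move: Ub.
rewrite cat_uniq /= !inE negb_or => /and5P[Uu].
rewrite !negb_or => /and3P[xu yu vu] /andP[xy xv] yv Uv.
have [ix|nix] := eqVneq x a.
  rewrite !index_cat !rem_cat ix (negbTE xu) /= !eqxx [b == a]eq_sym (negbTE xy) /=.
  by rewrite !addnS sgS addn0 opprK.
have [iy|niy] := eqVneq x b.
  rewrite -iy in yu xy yv *.
  rewrite !index_cat !rem_cat (negbTE yu) /= !eqxx (negbTE xy) /=.
  by rewrite !addnS sgS addn0.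
rewrite !index_cat !rem_cat /= ![_ == x]eq_sym (negbTE nix) (negbTE niy) -sg_opp.
by case: ifP => _; rewrite (hphi [::]).
Qed.

Lemma hword_alt phi : alternating phi -> forall (A B : word X) (u v : seq X) (a b : X),
  uniq (flatten (A ++ (u ++ a :: b :: v) :: B)) ->
  hword phi (A ++ (u ++ a :: b :: v) :: B) = - hword phi (A ++ (u ++ b :: a :: v) :: B).
Proof.
move=> hphi A B u v a b; elim: A phi hphi => [|d A IH] phi hphi U.
  have E1 : (x \in u ++ [:: b, a & v]) = (x \in u ++ [:: a, b & v]).
    by rewrite !mem_cat !inE; do !bool_congr.
  rewrite !cat0s !hword_cons E1 opprD.
  have := rword_alt (alternating_cons [:: x] hphi) U; rewrite !cat0s => ->.
  congr (_ + _); case: ifP => _; rewrite ?oppr0 // /bdim !size_cat /= -sg_opp.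
  congr sg; rewrite -[RHS](hword_sg 1); congr hword; apply/funext => w.
  exact: (hphi [::]).
rewrite !cat_cons !hword_cons opprD -!cat_cons.
rewrite (rword_alt (alternating_cons [:: x] hphi) U); congr (_ + _).
case: ifP => _; rewrite ?oppr0 // -sg_opp; congr sg.
apply: IH; first exact: alternating_cons.
by move: U; rewrite /= cat_uniq => /and3P[].
Qed.

Lemma pword_alt phi : alternating phi -> alternating (pword phi).
Proof.
move=> hphi A B u v a b; elim: A phi hphi => [|d A IH] phi hphi.
  have n1 y z : u ++ [:: y, z & v] != [:: x] by case: (u) => [|? [|? ?]]; rewrite /= !eqseq_cons /= ?andbF.
  case: B => [|e B]; first by rewrite /= !(negbTE (n1 _ _)) oppr0.
  have E2 C : pword phi ([::] ++ C :: e :: B) = pword (phi \o cons C) (e :: B) by [].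
  rewrite !E2.
  have -> : phi \o cons (u ++ [:: a, b & v]) = fun w => - (phi \o cons (u ++ [:: b, a & v])) w.
    by apply/funext => w; apply: (hphi [::]).
  have nD : additive_fun (fun z : V => - z) by move=> y z; rewrite opprD.
  exact: (esym (pword_push nD (phi \o cons (u ++ [:: b, a & v])) (e :: B))).
have E C : pword phi (d :: A ++ C :: B) = pword (phi \o cons d) (A ++ C :: B).
  by case: (A).
by rewrite !cat_cons !E IH //; apply: alternating_cons.
Qed.

End Homotopy.
End Contraction.

(** * The homotopy equivalence adding a letter *)

Lemma map_map_id (X : Type) (w : word X) : map (map id) w = w.
Proof. by rewrite -[RHS]map_id; apply: eq_map => b; rewrite map_id. Qed.

(** Reduces a statement on degrees to the vanishing of an additive expression, to
    which the transport lemmas apply. *)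
Lemma degPi_eq (I : finType) n (z : PiM I) :
  deg_part n z - z = 0 -> degPi n z.
Proof. by move=> h; apply/degPiP/eqP; rewrite -subr_eq0 h. Qed.

Lemma deg_defectD (I : finType) n : additive_fun (fun z : PiM I => deg_part n z - z).
Proof. by move=> y z; rewrite deg_partD opprD addrACA. Qed.

Lemma deg_defect_cl (I : finType) (w : word I) :
  is_expr w -> deg_part (wdim w) (cl w) - cl w = 0.
Proof. by move=> hw; rewrite deg_part_cl // /degF eqxx subrr. Qed.

Section Point.
Variables (I : finType) (x : I).
Implicit Types (w u : word I) (A : word (del x)).

Let insw (w : word I) : word (del x) := map (pmap insub) w.
Let valw (A : word (del x)) : word I := map (map val) A.

Lemma valw_ins w : x \notin flatten w -> valw (insw w) = w.
Proof.
move=> xw; rewrite /valw /insw -map_comp -[RHS]map_id; apply/eq_in_map => b bw /=.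
rewrite (pmap_filter (insubK _)); apply/all_filterP/allP => y yb.
rewrite isSome_insub; apply: contra xw => /eqP <-.
by apply/flattenP; exists b.
Qed.

Lemma valw_out A : x \notin flatten (valw A).
Proof. by apply: notin_flatten_map => u; apply: (valP u). Qed.

Lemma valwK A : insw (valw A) = A.
Proof.
rewrite /valw /insw -map_comp -[RHS]map_id; apply: eq_map => b /=.
by rewrite map_pK //; apply: valK.
Qed.

Lemma insw_expr w : wne w -> x \notin flatten w ->
  perm_eq (x :: flatten w) (enum I) -> is_expr (insw w).
Proof.
move=> wn xw pw; have E := valw_ins xw.
have wu : uniq (x :: flatten w) by rewrite (perm_uniq pw) enum_uniq.
apply/is_exprP; split.
- by rewrite -E /valw wne_map in wn.
- rewrite -(map_inj_uniq val_inj) map_flatten -/(valw _) E.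
  by case/andP: wu.
- move=> u; rewrite -(mem_map val_inj) map_flatten -/(valw _) E.
  have := mem_enum I (val u); rewrite -(perm_mem pw) inE /= => /orP[/eqP ux|//].
  by have /= := valP u; rewrite ux eqxx.
Qed.

Lemma valw_expr A u : is_expr A -> perm_eq u ([:: [:: x]] ++ valw A) -> is_expr u.
Proof.
move=> /is_exprP[An Au Ai] pu; have := perm_flatten pu; rewrite /= => pf.
apply/is_exprP; split.
- by rewrite (perm_wne pu) /= wne_map.
- rewrite (perm_uniq pf) /= valw_out /valw -map_flatten map_inj_uniq //.
  exact: val_inj.
- move=> i; rewrite (perm_mem pf) inE; have [//|ix] := eqVneq i x.
  by rewrite /valw -map_flatten -[i]/(val (exist _ i ix : del x)) map_f.
Qed.

Let restr (w : word I) : PiM (del x) :=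
  if x \in flatten w then 0 else cl (insw w).

Let restr_alt : alternating restr.
Proof.
move=> A B u v a b; rewrite /restr.
have -> : (x \in flatten (A ++ (u ++ [:: b, a & v]) :: B)) =
   (x \in flatten (A ++ (u ++ [:: a, b & v]) :: B)).
  by rewrite !flatten_cat /= !mem_cat !inE; congr (_ || (_ || _ || _)); rewrite orbCA.
case: ifP => h; first by rewrite oppr0.
rewrite /insw !map_cat /= !pmap_cat /=.
have xn y : y \in u ++ [:: a, b & v] -> y != x.
  move=> yu; apply: contraFN h => /eqP <-; rewrite flatten_cat mem_cat /= mem_cat yu.
  by rewrite orbT.
have ha : a != x by apply: xn; rewrite mem_cat mem_head orbT.
have hb : b != x by apply: xn; rewrite mem_cat !inE eqxx !orbT.
by rewrite !insubT /= cl_alternating.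
Qed.

(** The homotopy, the projection and the inclusion of the homotopy equivalence
    between Pi(I) and Pi(I minus x). *)
Definition hPi : PiM I -> PiM I := lift_word (hword x (@cl I)).
Definition pPi : PiM I -> PiM (del x) := lift_word (pword x restr).
Definition kPi : PiM (del x) -> PiM I :=
  lift_word (fun A => shuf (@cl I) [:: [:: x]] (valw A)).

Let h_alt : alternating_expr (hword x (@cl I)).
Proof.
move=> A B u v a b /is_exprP[_ U _]; exact: (hword_alt x (@cl_alternating I) U).
Qed.

Let p_alt : alternating_expr (pword x restr).
Proof. exact/alternatingW/pword_alt/restr_alt. Qed.

Let k_alt : alternating_expr (fun A => shuf (@cl I) [:: [:: x]] (valw A)).
Proof.
apply: alternatingW => A B u v a b; rewrite /valw !map_cat /= !map_cat /=.
exact: (shuf_altr _ (@cl_alternating I)).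
Qed.

Lemma hPiD : additive_fun hPi. Proof. exact: lift_wordD. Qed.
Lemma pPiD : additive_fun pPi. Proof. exact: lift_wordD. Qed.
Lemma kPiD : additive_fun kPi. Proof. exact: lift_wordD. Qed.

Lemma hPi_cl w : is_expr w -> hPi (cl w) = hword x (@cl I) w.
Proof. exact: lift_wordE. Qed.
Lemma pPi_cl w : is_expr w -> pPi (cl w) = pword x restr w.
Proof. exact: lift_wordE. Qed.
Lemma kPi_cl A : is_expr A -> kPi (cl A) = shuf (@cl I) [:: [:: x]] (valw A).
Proof. exact: (lift_wordE k_alt). Qed.

Lemma kPi_push (V : zmodType) (theta : PiM I -> V) (psi : word I -> V) A :
  additive_fun theta ->
  (forall u, is_expr u -> wdim u = wdim A -> theta (cl u) = psi u) ->
  is_expr A -> theta (kPi (cl A)) = shuf psi [:: [:: x]] (valw A).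
Proof.
move=> tD h hA; rewrite kPi_cl // (shuf_push tD); apply: eq_shuf => u pu /=.
apply: h; first exact: valw_expr pu.
by rewrite (perm_wdim pu) wdim_cat wdim_cons wdim_nil wdim_map.
Qed.

Lemma Pi_homotopy z : z = dPi (hPi z) + hPi (dPi z) + kPi (pPi z).
Proof.
move: z; apply: PiM_ext => [//|y z|w hw].
  by rewrite hPiD pPiD !dPiD !hPiD kPiD; signs.
have /is_exprP[wn wu wi] := hw.
have -> : dPi (hPi (cl w)) = hword x (dword (@cl I)) w.
  rewrite hPi_cl // (hword_push x (@dPiD I)); apply: eq_hword => // u un pu _ /=.
  by rewrite dPi_cl //; apply: (is_expr_perm _ _ hw); [|rewrite perm_sym].
have -> : hPi (dPi (cl w)) = dword (hword x (@cl I)) w.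
  rewrite (@dPi_push _ I hPi I (hword x (@cl I)) id) ?map_map_id //; first exact: hPiD.
  by move=> u hu; rewrite hPi_cl // map_map_id.
have -> : kPi (pPi (cl w)) = pword x (shuf (@cl I) [:: [:: x]]) w.
  rewrite pPi_cl // (pword_push x kPiD); apply: eq_pword => // u un pu _ /=.
  have xu : x \notin flatten u.
    by move: wu; rewrite -(perm_uniq pu) => /andP[].
  rewrite /restr (negbTE xu) kPi_cl ?valw_ins //; apply: insw_expr => //.
  by apply: (perm_trans pu); case/andP: hw.
by rewrite [X in X + _]addrC (homotopy (@cl_alternating I)) // subrK.
Qed.

Lemma dPi_kPi a : dPi (kPi a) = kPi (dPi a).
Proof.
move: a; apply: PiM_ext => [y z|y z|A hA].
- by rewrite kPiD dPiD.
- by rewrite dPiD kPiD.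
have An : wne (valw A) by rewrite wne_map; case/andP: hA.
rewrite (@kPi_push _ (@dPi I) (dword (@cl I))) //; first last.
- by move=> u hu _; rewrite dPi_cl.
- exact: dPiD.
rewrite (shuf_dword (@cl_alternating I)) //.
rewrite (@dPi_push _ _ kPi _ (shuf (@cl I) [:: [:: x]]) val) //; first last.
- by move=> u hu; rewrite kPi_cl.
- exact: kPiD.
by rewrite dword_cons /= add0r wdim_cons wdim_nil /sg /= add0r.
Qed.

Lemma kPiK a : pPi (kPi a) = a.
Proof.
move: a; apply: PiM_ext => [y z|//|A hA]; first by rewrite kPiD pPiD.
rewrite (@kPi_push _ pPi (pword x restr)) //; first last.
- by move=> u hu _; rewrite pPi_cl.
- exact: pPiD.
by rewrite shuf_pword ?valw_out // /restr (negbTE (valw_out A)) valwK.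
Qed.

Lemma hPi_deg n z : degPi n z -> degPi (n - 1) (hPi z).
Proof.
move: z; apply: degPi_ind => [|y z hy hz|w hw <-].
- by rewrite (additive0 hPiD); apply: degPi0.
- by rewrite (additiveB hPiD); apply: degPiB.
have /andP[wn _] := hw.
apply: degPi_eq; rewrite hPi_cl // (hword_push x (deg_defectD _)).
have zD : additive_fun (fun _ : PiM I => 0 : PiM I) by move=> ? ?; rewrite addr0.
rewrite [RHS](hword_push x zD (@cl I) w); apply: eq_hword => // u un pu -> /=.
have -> : Posz (wdim u).+1 - 1 = wdim u by rewrite intS addrC addKr.
rewrite deg_defect_cl //.
by apply: (is_expr_perm _ _ hw); [|rewrite perm_sym].
Qed.

Lemma pPi_deg n z : degPi n z -> degPi n (pPi z).
Proof.
move: z; apply: degPi_ind => [|y z hy hz|w hw <-].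
- by rewrite (additive0 pPiD); apply: degPi0.
- by rewrite (additiveB pPiD); apply: degPiB.
have /is_exprP[wn wu wi] := hw.
apply: degPi_eq; rewrite pPi_cl // (pword_push x (deg_defectD _)).
have zD : additive_fun (fun _ : PiM (del x) => 0 : PiM (del x)) by move=> ? ?; rewrite addr0.
rewrite [RHS](pword_push x zD restr w); apply: eq_pword => // u un pu <- /=.
have xu : x \notin flatten u by move: wu; rewrite -(perm_uniq pu) => /andP[].
rewrite /restr (negbTE xu) -[in wdim u](valw_ins xu) wdim_map deg_defect_cl //.
by apply: insw_expr => //; apply: (perm_trans pu); case/andP: hw.
Qed.

Lemma kPi_deg n a : degPi n a -> degPi n (kPi a).
Proof.
move: a; apply: degPi_ind => [|y z hy hz|A hA <-].
- by rewrite (additive0 kPiD); apply: degPi0.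
- by rewrite (additiveB kPiD); apply: degPiB.
apply: degPi_eq.
rewrite (kPi_push (psi := fun=> 0) (deg_defectD _)) ?shuf_0 // => u hu <-.
exact: deg_defect_cl.
Qed.

End Point.

(** * The sum of all linear orders *)

Section LinearOrders.

(** The value of phi on the iterated shuffle of the one-letter blocks of s, which
    is the sum of all linear orders of s. *)
Fixpoint orders (X : eqType) (V : zmodType) (phi : word X -> V) (s : seq X) : V :=
  if s is x :: s' then orders (shuf phi [:: [:: x]]) s' else phi [::].

Section Basic.
Variables (X : eqType) (V : zmodType).
Implicit Types (phi psi : word X -> V) (s t : seq X).

Let singles s : word X := [seq [:: i] | i <- s].

Lemma wdim_singles s u : perm_eq u (singles s) -> wdim u = 0%N.
Proof.
move/perm_wdim ->; elim: s => [|i s IH]; first by rewrite wdim_nil.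
by rewrite /= wdim_cons IH.
Qed.

Lemma flatten_singles s u : perm_eq u (singles s) -> perm_eq (flatten u) s.
Proof.
move/perm_flatten; congr (is_true (perm_eq _ _)).
by rewrite /singles; elim: s => //= i s ->.
Qed.

Lemma eq_orders phi psi s : (forall u, perm_eq u (singles s) -> phi u = psi u) ->
  orders phi s = orders psi s.
Proof.
elim: s phi psi => [|x s IH] phi psi h /=; first exact: h.
apply: IH => u pu; apply: eq_shuf => v pv; apply: h.
by apply: (perm_trans pv); rewrite /= perm_cons.
Qed.

Lemma ordersD phi psi s : orders (fun u => phi u + psi u) s = orders phi s + orders psi s.
Proof.
elim: s phi psi => [|x s IH] phi psi //=; rewrite -IH; apply: eq_orders => u _.
exact: shufD.
Qed.

Lemma orders_sg n phi s : orders (fun u => sg n (phi u)) s = sg n (orders phi s).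
Proof.
elim: s phi => [|x s IH] phi //=; rewrite -IH; apply: eq_orders => u _.
exact: shuf_sg.
Qed.

Lemma orders_0 s : orders (fun=> 0 : V) s = 0.
Proof.
elim: s => [|x s IH] //=; rewrite -[RHS]IH; apply: eq_orders => u _.
exact: shuf_0.
Qed.

Lemma orders_sum (T : Type) (r : seq T) (F : T -> word X -> V) s :
  orders (fun u => \sum_(t <- r) F t u) s = \sum_(t <- r) orders (F t) s.
Proof.
elim: r => [|t r IH].
  rewrite big_nil -[RHS](orders_0 s); apply: eq_orders => u _; exact: big_nil.
rewrite big_cons -IH -ordersD; apply: eq_orders => u _; exact: big_cons.
Qed.

Lemma orders_shuf (Y : eqType) (g : word Y -> word X -> V) (a b : word Y) s :
  orders (fun A => shuf (fun m => g m A) a b) s = shuf (fun m => orders (g m) s) a b.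
Proof.
rewrite /shuf orders_sum; apply: eq_bigr => u _; exact: orders_sg.
Qed.

(** Blocks of dimension 0 commute for the shuffle product. *)
Lemma orders_swap phi x y s : orders phi (x :: y :: s) = orders phi (y :: x :: s).
Proof.
rewrite /=; apply: eq_orders => u _.
rewrite -(shufA phi [:: [:: x]]) shufC -(shufA phi [:: [:: y]]).
by rewrite !wdim_cons !wdim_nil.
Qed.

Lemma orders_perm phi s t : perm_eq s t -> orders phi s = orders phi t.
Proof.
have move_front psi x s1 s2 : orders psi (s1 ++ x :: s2) = orders psi (x :: s1 ++ s2).
  elim: s1 psi => [|y s1 IH] psi //.
  by rewrite [RHS]orders_swap; apply: (IH (shuf psi [:: [:: y]])).
elim: t s phi => [|x t IH] s phi pst; first by rewrite (perm_nilP pst).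
have xs : x \in s by rewrite (perm_mem pst) mem_head.
case/splitPr: xs pst => s1 s2 pst; rewrite move_front.
apply: (IH (s1 ++ s2) (shuf phi [:: [:: x]])).
by rewrite -(perm_cons x) -(permPr pst) perm_sym -cat1s perm_catCA.
Qed.

Lemma orders_cat phi s t :
  orders phi (s ++ t) = orders (fun m => orders (fun A => shuf phi A m) t) s.
Proof.
elim: s phi => [|x s IH] phi /=.
  by apply: eq_orders => u _; rewrite shufs0.
rewrite IH; apply: eq_orders => m _; rewrite -orders_shuf.
apply: eq_orders => A _.
by rewrite -(shufA phi A) [RHS]shufC !wdim_cons wdim_nil muln0 /sg /= shufA.
Qed.

End Basic.

Lemma orders_push (X : eqType) (V W : zmodType) (theta : V -> W) (phi : word X -> V) s :
  additive_fun theta -> theta (orders phi s) = orders (theta \o phi) s.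
Proof.
move=> tD; elim: s phi => [|x s IH] phi //=; rewrite IH.
by apply: eq_orders => u _ /=; rewrite (shuf_push tD).
Qed.

Lemma orders_map (X Y : eqType) (V : zmodType) (f : X -> Y) (phi : word Y -> V) s :
  orders phi (map f s) = orders (phi \o map (map f)) s.
Proof.
elim: s phi => [|x s IH] phi //=; rewrite IH; apply: eq_orders => u _ /=.
exact: (shuf_map f phi [:: [:: x]] u).
Qed.

End LinearOrders.

(** * Homology and the morphism from Com *)

Definition sum_orders (I : finType) : PiM I := orders (@cl I) (enum I).

Lemma singles_expr (I : finType) (u : word I) :
  perm_eq u [seq [:: i] | i <- enum I] -> is_expr u.
Proof.
move=> pu; apply/andP; split; last exact: flatten_singles pu.
rewrite -/(wne u) (perm_wne pu) /wne all_map; exact/allP.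
Qed.

Lemma sum_orders_deg (I : finType) : degPi 0 (sum_orders I).
Proof.
apply: degPi_eq; rewrite /sum_orders (orders_push _ _ (@deg_defectD I 0)).
rewrite -[RHS](orders_0 (PiM I) (enum I)); apply: eq_orders => u pu /=.
by have := deg_defect_cl (singles_expr pu); rewrite (wdim_singles pu).
Qed.

Lemma kPi_sum_orders (I : finType) (x : I) : kPi (sum_orders (del x)) = sum_orders I.
Proof.
rewrite /sum_orders (orders_push _ _ (@kPiD I x)).
rewrite (eq_orders (psi := shuf (@cl I) [:: [:: x]] \o map (map val))); last first.
  by move=> u pu /=; rewrite kPi_cl //; apply: singles_expr.
rewrite -orders_map -[orders _ (map _ _)]/(orders (@cl I) (x :: map val (enum (del x)))).
apply: orders_perm; apply: uniq_perm; rewrite ?enum_uniq //=.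
  rewrite map_inj_uniq ?enum_uniq ?andbT; last exact: val_inj.
  by apply/mapP => -[u _ /= E]; have /= := valP u; rewrite -E eqxx.
move=> i; rewrite inE mem_enum; have [//|ix] := eqVneq i x.
by rewrite -[i]/(val (exist _ i ix : del x)) map_f // mem_enum.
Qed.

Lemma degPi_neg (I : finType) (y : PiM I) : degPi (-1) y -> y = 0.
Proof. by move: y; apply: degPi_ind => // x y -> ->; rewrite subr0. Qed.

(** Everything about the homology of Pi(I), stated so as to be proved by induction
    on the cardinal of I. *)
Record Pi_homology (I : finType) : Prop := PiHomology {
  sum_orders_cocycle : dPi (sum_orders I) = 0;
  Pi_acyclic : forall n (z : PiM I), n != 0 -> degPi n z -> dPi z = 0 ->
    exists2 y : PiM I, degPi (n - 1) y & dPi y = z;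
  Pi_degree0 : forall z : PiM I, degPi 0 z -> dPi z = 0 ->
    exists c : int, z = sum_orders I *~ c;
  sum_orders_torsion_free : forall c : int, sum_orders I *~ c = 0 -> c = 0
}.

Lemma Pi_homology_empty (I : finType) : #|I| = 0%N -> Pi_homology I.
Proof.
move=> I0; have e0 : enum I = [::] by apply/nilP; rewrite /nilp -cardE I0.
have w0 (w : word I) : is_expr w -> w = [::].
  case: w => // b w /is_exprP[/andP[bn _] _ _]; case: b bn => // i b _.
  by have := card0_eq I0 i; rewrite inE.
have hn : @is_expr I [::] by rewrite /is_expr e0.
have fE : sum_orders I = cl [::] by rewrite /sum_orders e0.
split.
- by rewrite fE dPi_cl.
- move=> n z n0 hz _; exists 0; first exact: degPi0.
  rewrite (additive0 (@dPiD I)); apply/esym; move: z hz.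
  apply: degPi_ind => // [y z -> ->|w /w0 -> wn]; first by rewrite subr0.
  by rewrite -wn wdim_nil eqxx in n0.
- move=> z _ _; rewrite fE; move: z; apply: PiM_ind => [|y z [c ->] [d ->]|w /w0 ->].
  + by exists 0; rewrite mulr0z.
  + by exists (c - d); rewrite mulrzBr.
  + by exists 1.
- move=> c; pose F (w : word I) : int := (w == [::])%:R.
  have Fa : alternating_expr F by move=> A B u v a b /w0; case: A.
  move=> /(congr1 (lift_word F)); rewrite fE (additiveMz (lift_wordD Fa)).
  by rewrite lift_wordE // /F eqxx (additive0 (lift_wordD Fa)) intz.
Qed.

(** A cocycle z equals d(h z) + k(p z), where p z is a cocycle because k is an
    injective chain map, so the induction hypothesis applies to p z. In degree 0
    the term h z has degree -1 and vanishes. *)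
Lemma Pi_homologyP (I : finType) : Pi_homology I.
Proof.
have [n] := ubnP #|I|; elim: n I => // n IH I; rewrite ltnS => In.
have [/eqP|/card_gt0P[x _]] := posnP #|I|; first by move=> /eqP; apply: Pi_homology_empty.
have dn : (#|del x| < n)%N.
  rewrite card_sig (leq_trans _ In) //; apply: proper_card; apply/properP.
  by split; [apply/subsetP | exists x => //; rewrite inE eqxx].
have [Hc Ha H0 Hf] := IH (del x) dn.
have homot z : dPi z = 0 -> z = dPi (hPi x z) + kPi (pPi x z).
  by move=> dz; have := Pi_homotopy x z; rewrite dz (additive0 (@hPiD I x)) addr0.
have dp z : dPi z = 0 -> dPi (pPi x z) = 0.
  move=> dz; rewrite -[LHS](kPiK) -dPi_kPi.
  have -> : kPi (pPi x z) = z - dPi (hPi x z) by rewrite [X in X - _](homot z) // addrAC subrr add0r.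
  by rewrite (additiveB (@dPiD I)) dz dPi_dPi subr0 (additive0 (@pPiD I x)).
split.
- by rewrite -(kPi_sum_orders x) dPi_kPi Hc (additive0 (@kPiD I x)).
- move=> m z m0 hz dz; have [y hy dy] := Ha m _ m0 (pPi_deg x hz) (dp z dz).
  exists (hPi x z + kPi y); first by apply: degPiD; [apply: hPi_deg | apply: kPi_deg].
  by rewrite dPiD dPi_kPi dy -homot.
- move=> z hz dz; have [c Ec] := H0 _ (pPi_deg x hz) (dp z dz); exists c.
  rewrite [LHS]homot // (degPi_neg (hPi_deg x hz)) (additive0 (@dPiD I)) add0r Ec.
  by rewrite (additiveMz (@kPiD I x)) kPi_sum_orders.
- move=> c; rewrite -(kPi_sum_orders x) -(additiveMz (@kPiD I x)) => /(congr1 (pPi x)).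
  by rewrite kPiK (additive0 (@pPiD I x)); apply: Hf.
Qed.

Lemma mapPi_sum_orders (I J : finType) (f : I -> J) : bijective f -> mapPi f (sum_orders I) = sum_orders J.
Proof.
move=> fbij; rewrite /sum_orders (orders_push _ _ (mapPiD f)).
rewrite (eq_orders (psi := @cl J \o map (map f))); last first.
  by move=> u pu /=; rewrite mapPi_cl //; apply: singles_expr.
rewrite -orders_map; apply: orders_perm; have [g fK gK] := fbij.
apply: uniq_perm; first by rewrite (map_inj_uniq (bij_inj fbij)) enum_uniq.
  exact: enum_uniq.
by move=> j; rewrite mem_enum -[j]gK map_f // mem_enum.
Qed.

(** Writing the first sum as a shuffle of {i} with the orders A of the other
    letters, the composition at i turns {i} shuffled with A into m shuffled with
    A for each order m of J, by [shuf_cwordl]. *)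
Lemma compPi_sum_orders (I J : neFin) (i : I) :
  compPi i (sum_orders I) (sum_orders J) = sum_orders (subst i J).
Proof.
have k_inj := @subst_emb_inj I J i; set k := @subst_emb I J i in k_inj.
have linj := @inl_inj I J; have rinj := @inr_inj I J.
set s := map val (enum (del i)).
have Es : perm_eq (enum I) (i :: s).
  apply: uniq_perm; rewrite ?enum_uniq //=.
    rewrite map_inj_uniq ?enum_uniq ?andbT; last exact: val_inj.
    by apply/mapP => -[u _ /= E]; have /= := valP u; rewrite -E eqxx.
  move=> i'; rewrite inE mem_enum; have [//|ix] := eqVneq i' i.
  by rewrite -[i']/(val (exist _ i' ix : del i)) map_f // mem_enum.
have is_ : i \notin s by apply/mapP => -[u _ E]; have /= := valP u; rewrite -E eqxx.
rewrite {2}/sum_orders (orders_push _ _ (compPiDr i (sum_orders I))).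
rewrite (eq_orders (psi := fun m => orders (fun A =>
   shuf (cl_ext k) (map (map inl) A) (map (map inr) m)) s)); last first.
  move=> m pm /=; have hm := singles_expr pm.
  have mn0 : map (map inr) m != [::] :> word (I + J)%type by apply/map_neq0/(is_expr_neq0 hm).
  rewrite /sum_orders (orders_push _ _ (compPiDl i (cl m))) (orders_perm _ Es).
  rewrite (eq_orders (psi := fun A' => cword (inl i) (map (map inr) m) (cl_ext k)
     (map (map inl) A'))); last first.
    move=> u pu /=; have hu : is_expr u.
      apply: singles_expr; apply: (perm_trans pu).
      by apply: perm_map; rewrite perm_sym.
    apply: (@compPi_push I J i _ id _ inl inr k (cl_ext k)) => //.
    by move=> w hw; rewrite cl_extE.
  rewrite -[LHS]/(orders (shuf (fun A' => cword (inl i) (map (map inr) m) (cl_ext k)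
     (map (map inl) A')) [:: [:: i]]) s).
  apply: eq_orders => A pA.
  rewrite -[LHS](shuf_map inl (cword (inl i) _ (cl_ext k)) [:: [:: i]] A).
  rewrite shuf_cwordl //=; first last.
  - by rewrite mem_head.
  - rewrite mem_flatten_map // (perm_mem (flatten_singles pA)) //.
  - by rewrite wne_map expr_wne.
  rewrite wdim_map (wdim_singles pA) mul0n /sg /= mem_head /=.
  rewrite /after /= eqxx /= wdim_nil muln0 shuf0s /=.
  rewrite shufC !wdim_map (wdim_singles pA) muln0 /sg /=.
  by case: (m) mn0.
have E : (fun m : word J => orders (fun A => shuf (cl_ext k) (map (map inl) A) (map (map inr) m)) s) =
  (fun m' => orders (fun A' => shuf (cl_ext k) A' m') (map inl s)) \o map (map inr).
  by apply/funext => m /=; rewrite [RHS]orders_map.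
rewrite E -orders_map -orders_cat /sum_orders.
rewrite (eq_orders (phi := @cl (subst i J)) (psi := cl_ext k \o map (map k))); last first.
  by move=> u _ /=; rewrite cl_extE.
rewrite -(orders_map k (cl_ext k)); apply: orders_perm; apply: uniq_perm.
- rewrite cat_uniq; apply/and3P; split.
  + by rewrite (map_inj_uniq rinj) enum_uniq.
  + by apply/hasPn => _ /mapP[u _ ->]; apply/mapP => -[].
  + by rewrite (map_inj_uniq linj) (map_inj_uniq val_inj) enum_uniq.
- by rewrite map_inj_uniq ?enum_uniq.
case=> [i'|j]; rewrite mem_cat.
  rewrite [RHS](_ : _ = (i' != i)).
    case: (boolP (i' != i)) => hi.
      apply/orP; right; apply: map_f.
      by rewrite -[i']/(val (exist _ i' hi : del i)) map_f // mem_enum.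
    apply/negP => /orP[/mapP[]//|]; rewrite mem_map // => /mapP[u _ E'].
    by have := valP u; rewrite /= -E' (negbTE hi).
  apply/mapP/idP => [[[u|//] _ [->]]|hi]; first exact: (valP u).
  by exists (inl (exist _ i' hi : del i)); rewrite ?mem_enum.
rewrite map_f ?mem_enum //; apply/esym/mapP; exists (inr j) => //; by rewrite mem_enum.
Qed.

Lemma sum_orders_pt : sum_orders pt = cl [:: [:: tt]].
Proof. by rewrite /sum_orders enumT unlock /= shufs0. Qed.

Definition Com_to_Pi (I : neFin) (c : Com I) : Pi I := sum_orders I *~ (c : int).

Lemma Com_to_PiD (I : neFin) : additive_fun (@Com_to_Pi I).
Proof. by move=> c d; rewrite /Com_to_Pi -mulrzDr. Qed.

Lemma Com_dgOperad : is_dgOperad Com.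
Proof.
split=> //=.
- move=> I; split=> //=.
  + by move=> n; right.
  + move=> n x y [->|->] [->|->]; by [left | right].
  + move=> x; exists [:: 0], (fun n => if n == 0 then x else 0).
    split=> [n|]; last by rewrite big_seq1 eqxx.
    by case: eqP => [->|_]; [left | right].
  + move=> s c us hc; have [s0|s0] := boolP (0 \in s).
      rewrite (bigD1_seq 0) //= big1 => [|n n0]; last by have [E|//] := hc n; rewrite E eqxx in n0.
      rewrite addr0 => c0 n ns; have [->|//] := hc n; exact: c0.
    by move=> _ n ns; have [E|//] := hc n; rewrite -E ns in s0.
  + by move=> *; right.
- by move=> I J i y a b; rewrite mulrDl.
- by move=> I J i y a b; rewrite mulrDr.
- move=> I J i m n x y [->|->] [->|->]; rewrite ?mul0r ?mulr0; by [left | right].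
- by move=> I J i m x y _; rewrite mul0r mulr0 mul0rz addr0.
- by move=> *; rewrite mulrA.
- move=> I J K i i' a b h hbij _ _ _ m n x y z [->|->] [->|->];
    rewrite ?(mul0r, mulr0, mul0rz) //.
  by rewrite /= expr0 mulr1z mulrAC.
- by left.
- by move=> *; rewrite mul1r.
- by move=> *; rewrite mulr1.
Qed.

Lemma Com_to_Pi_morphism : operad_morphism Com_to_Pi.
Proof.
split.
- move=> I; have [H _ _ _] := Pi_homologyP I; split.
  + exact: Com_to_PiD.
  + move=> n x [->|->]; rewrite /Com_to_Pi ?mulr0z; last exact: degPi0.
    have := @sum_orders_deg I; case: x => k h; rewrite -?pmulrn ?NegzE ?mulrNz -?pmulrn.
      by elim: k => [|k IH]; [exact: degPi0 | rewrite mulrS; apply: degPiD].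
    by apply: degPiN; elim: k.+1 => [|j IH]; [exact: degPi0 | rewrite mulrS; apply: degPiD].
  + move=> x; rewrite /Com_to_Pi /= mulr0z (additiveMz (@dPiD I)) H.
    by rewrite mul0rz.
- move=> I J g gbij x; rewrite /Com_to_Pi /= (additiveMz (mapPiD g)) mapPi_sum_orders //.
- move=> I J i x y; rewrite /Com_to_Pi /= (additiveMz (compPiDl i _)).
  by rewrite (additiveMz (compPiDr i _)) compPi_sum_orders -mulrzA mulrC.
- by rewrite /Com_to_Pi /= sum_orders_pt.
Qed.

Lemma Com_to_Pi_quasi_iso (I : neFin) : quasi_iso (@Com_to_Pi I).
Proof.
have [Hc Ha H0 Hf] := Pi_homologyP I; move=> n; split=> [x [[n0|x0] _] [y hy dy]|y [hy dy]].
- rewrite n0 sub0r in hy; rewrite (degPi_neg hy) /= (additive0 (@dPiD I)) in dy.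
  by exists 0; [right | rewrite /= (Hf x) ].
- by exists 0; [right | rewrite /= x0].
have [n0|n0] := eqVneq n 0.
  rewrite n0 in hy *; have [c Ec] := H0 y hy dy.
  exists c; first by split=> //; left.
  exists 0; first exact: degPi0.
  by rewrite /= (additive0 (@dPiD I)) Ec subrr.
exists 0; first by split=> //; right.
have [y' hy' dy'] := Ha n y n0 hy dy; exists y' => //=.
by rewrite /Com_to_Pi mulr0z subr0.
Qed.

Lemma Pi_homology_in_degree0 (I : neFin) : homology_in_degree0 (Pi I).
Proof.
have [_ Ha _ _] := Pi_homologyP I; move=> n x n0 [hx dx].
by have [y hy dy] := Ha n x n0 hx dx; exists y.
Qed.

Lemma Pi_trivial_action : trivial_action_on_homology Pi.
Proof.
move=> I s sbij n x [hx dx]; have [Hc Ha H0 Hf] := Pi_homologyP I.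
have [n0|n0] := eqVneq n 0.
  rewrite n0 in hx *; have [c ->] := H0 x hx dx; exists 0; first exact: degPi0.
  by rewrite /= (additive0 (@dPiD I)) (additiveMz (mapPiD s)) mapPi_sum_orders // subrr.
have [_ hdeg hdiff] := Pi_map_chain sbij.
apply: Pi_homology_in_degree0 => //; split; first by apply: degPiB => //; apply: hdeg.
have dx' : dPi x = 0 := dx.
have hd : dPi (mapPi s x) = mapPi s (dPi x) := esym (hdiff x).
by rewrite /= (additiveB (@dPiD I)) hd dx' (additive0 (mapPiD s)) subrr.
Qed.

(** * Faces of the permutohedron *)

Section Faces.
Variable I : finType.
Implicit Types (c : I -> rat) (v : pvertex I) (w : word I) (i j : I).

Definition monotone_face (r : I -> I -> bool) : {set pvertex I} :=
  [set v : pvertex I | injectiveb v & [forall i, forall j, r i j ==> (v i < v j)%N]].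

Lemma monotone_faceP (r : I -> I -> bool) v :
  reflect (injective v /\ forall i j, r i j -> (v i < v j)%N) (v \in monotone_face r).
Proof.
rewrite inE; apply: (iffP andP) => [[/injectiveP vI /forallP h]|[vI h]].
  by split=> // i j; have /forallP/(_ j)/implyP := h i.
split; first exact/injectiveP.
by apply/forallP => i; apply/forallP => j; apply/implyP/h.
Qed.

(** A bijection onto {0, ..., n - 1} takes at i the number of smaller values. *)
Lemma pvertex_count v i : injective v -> (v i : nat) = (\sum_j (v j < v i)%N)%N.
Proof.
move=> vI; have vbij : bijective v by apply: inj_card_bij => //; rewrite card_ord.
rewrite -(reindex v (onW_bij _ vbij) (P := xpredT) (F := fun k => (k < v i : nat)%N)) /=.
rewrite (eq_bigr (fun k : 'I__ => if (k < v i)%N then 1%N else 0%N)); last by move=> k _; case: ltnP.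
rewrite -big_mkcond /= -(big_ord_widen _ (fun=> 1%N)) ?sum1_card ?card_ord //.
exact: ltnW.
Qed.

(** The ranks in an enumeration sorted by c. *)
Lemma exists_monotone c : exists2 v : pvertex I, injective v & forall i j, c i < c j -> (v i < v j)%N.
Proof.
pose r := relpre c <=%R; pose s := sort r (enum I).
have st : sorted r s by apply: sort_sorted => i j; apply: le_total.
have ms i : i \in s by rewrite mem_sort mem_enum.
have hs i : (index i s < #|I|)%N by rewrite cardE -(size_sort r) index_mem ms.
exists [ffun i => Ordinal (hs i)].
  move=> i j; rewrite !ffunE => /(congr1 val) /= e.
  by rewrite -(nth_index i (ms i)) e nth_index.
move=> i j; rewrite !ffunE /=; apply: contraTT; rewrite -leqNgt -leNgt.
apply: (sorted_leq_index (leT := r)) => //.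
- by move=> a b d; apply: le_trans.
- by move=> a; apply: lexx.
Qed.

Let pair_value v c i j : rat := c i * (v j < v i)%N%:R + c j * (v i < v j)%N%:R.
Let pair_max c i j : rat := if i == j then 0 else Num.max (c i) (c j).

(** Expanding v i as a number of smaller values turns the pairing into a sum over
    ordered pairs, where (i, j) contributes the value of c at the later of the
    two. *)
Lemma pairing_twice (c : {ffun I -> rat}) v : injective v ->
  pairing c v *+ 2 = \sum_i \sum_j pair_value v c i j.
Proof.
move=> vI; have E : pairing c v = \sum_i \sum_j c i * (v j < v i)%N%:R.
  apply: eq_bigr => i _; rewrite -mulr_sumr; congr (_ * _).
  by rewrite {1}(pvertex_count i vI) natr_sum.
rewrite mulr2n {2}E exchange_big /= E -big_split /=; apply: eq_bigr => i _.
by rewrite -big_split.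
Qed.

Lemma pair_value_le v c i j : injective v -> pair_value v c i j <= pair_max c i j.
Proof.
move=> vI; rewrite /pair_value /pair_max; case: eqP => [->|/eqP ij].
  by rewrite !ltnn !mulr0 addr0.
have : v i != v j by rewrite inj_eq.
rewrite -val_eqE /=; case: ltngtP => // _ _; rewrite mulr1 mulr0 ?addr0 ?add0r.
  by rewrite le_max lexx ?orbT.
by rewrite le_max lexx ?orbT.
Qed.

Lemma pair_value_eq v c i j : injective v ->
  (c i < c j -> (v i < v j)%N) -> (c j < c i -> (v j < v i)%N) ->
  pair_value v c i j = pair_max c i j.
Proof.
move=> vI hij hji; rewrite /pair_value /pair_max; case: eqP => [->|/eqP ij].
  by rewrite !ltnn !mulr0 addr0.
have : v i != v j by rewrite inj_eq.
rewrite -val_eqE /= maxEle; move: hij hji; case: ltngtP => // _ hij hji _.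
  rewrite mulr0 mulr1 add0r; case: leP => // /hji //.
rewrite mulr0 mulr1 addr0; case: leP => //; rewrite le_eqVlt => /orP[/eqP//|/hij//].
Qed.

(** Each pair contributes at most the maximum of c i and c j. A monotone vertex
    exists and reaches the bound for all pairs, so a maximizing vertex does as
    well, which forces it to be monotone. *)
Lemma face_of_functional (c : {ffun I -> rat}) :
  [set v : pvertex I | injectiveb v &
     [forall w : pvertex I, injectiveb w ==> (pairing c w <= pairing c v)]]
  = monotone_face (fun i j => c i < c j).
Proof.
pose M := \sum_i \sum_j pair_max c i j.
have le2 (a b : rat) : (a <= b) = (a *+ 2 <= b *+ 2) by rewrite lerMn2r.
have leM v : injective v -> pairing c v *+ 2 <= M.
  move=> vI; rewrite pairing_twice //; apply: ler_sum => i _; apply: ler_sum => j _.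
  exact: pair_value_le.
have eqM v : injective v -> (forall i j, c i < c j -> (v i < v j)%N) -> pairing c v *+ 2 = M.
  move=> vI h; rewrite pairing_twice //; apply: eq_bigr => i _; apply: eq_bigr => j _.
  by apply: pair_value_eq => //; apply: h.
apply/setP => v; apply/idP/idP; last first.
  move=> /monotone_faceP[vI h]; rewrite inE; apply/andP; split; first exact/injectiveP.
  by apply/forallP => w; apply/implyP => /injectiveP wI; rewrite le2 (eqM v) // leM.
rewrite inE => /andP[/injectiveP vI /forallP vmax].
apply/monotone_faceP; split=> // i j cij.
have [v0 v0I h0] := exists_monotone c.
have vM : pairing c v *+ 2 = M.
  apply/eqP; rewrite eq_le leM //= -(eqM v0) // -le2.
  by have /implyP := vmax v0; apply; apply/injectiveP.
have : \sum_i \sum_j (pair_max c i j - pair_value v c i j) = 0.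
  rewrite (eq_bigr (fun i => \sum_j pair_max c i j - \sum_j pair_value v c i j)); last first.
    by move=> k _; rewrite sumrB.
  by rewrite sumrB -pairing_twice // vM subrr.
have ge0 k l : 0 <= pair_max c k l - pair_value v c k l by rewrite subr_ge0 pair_value_le.
move/eqP; rewrite psumr_eq0 => [/allP/(_ i)|k _]; last by apply: sumr_ge0 => l _.
rewrite mem_index_enum => /(_ isT) /=; rewrite psumr_eq0 // => /allP/(_ j).
rewrite mem_index_enum => /(_ isT) /=; rewrite subr_eq0 /pair_max /pair_value.
have ij : i != j by apply: contraTneq cij => ->; rewrite ltxx.
have : v i != v j by rewrite inj_eq.
rewrite (negbTE ij) -val_eqE /= max_r ?ltW //; case: ltngtP => // _ _.
by rewrite mulr1 mulr0 addr0 => /eqP e; rewrite e ltxx in cij.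
Qed.

(** Suppose that c' i < c' j but not c i < c j. In the smaller face all vertices
    then put i before j, so that c i = c j, but exchanging i and j in one of them
    gives a vertex of this face which puts j before i. *)
Lemma monotone_face_sub c c' :
  monotone_face (fun i j => c i < c j) \subset monotone_face (fun i j => c' i < c' j) <->
  (forall i j, c' i < c' j -> c i < c j).
Proof.
split=> [/subsetP sub i j cij'|h]; last first.
  apply/subsetP => v /monotone_faceP[vI hv]; apply/monotone_faceP; split=> // i j /h.
  exact: hv.
rewrite ltNge; apply/negP => cji.
have ij : i != j by apply: contraTneq cij' => ->; rewrite ltxx.
have [v vI hv] := exists_monotone c.
have vF : v \in monotone_face (fun i j => c i < c j) by apply/monotone_faceP.
have /monotone_faceP[_ /(_ _ _ cij') vij] := sub _ vF.
have cE : c i = c j.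
  by apply/eqP; rewrite eq_le cji andbT leNgt; apply/negP => /hv; rewrite ltnNge ltnW.
pose v' : pvertex I := [ffun k => v (tperm i j k)].
have v'F : v' \in monotone_face (fun i j => c i < c j).
  have ct k : c (tperm i j k) = c k by case: tpermP => [->|->|].
  apply/monotone_faceP; split=> [k l|k l kl]; rewrite !ffunE; first by move/vI/perm_inj.
  by apply: hv; rewrite !ct.
have /monotone_faceP[_ /(_ _ _ cij')] := sub _ v'F.
by rewrite !ffunE tpermL tpermR ltnNge ltnW.
Qed.

End Faces.

Section Levels.
Variable I : finType.
Implicit Types (w : word I) (i j : I).

Definition level w i : nat := find (fun b => i \in b) w.

Definition wface w : {set pvertex I} := monotone_face (fun i j => (level w i < level w j)%N).

Lemma wfaceE w : wface w = monotone_face (fun i j => (level w i)%:R < (level w j)%:R :> rat).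
Proof. by congr monotone_face; apply/funext => i; apply/funext => j; rewrite ltr_nat. Qed.

Lemma wface_is_face w : is_face (wface w).
Proof.
exists [ffun i => (level w i)%:R]; rewrite face_of_functional wfaceE.
by congr monotone_face; apply/funext => i; apply/funext => j; rewrite !ffunE.
Qed.

Lemma wface_sub w w' : wface w \subset wface w' <->
  (forall i j, (level w' i < level w' j)%N -> (level w i < level w j)%N).
Proof.
rewrite !wfaceE; split=> [/monotone_face_sub h i j|h].
  by have := h i j; rewrite !ltr_nat.
by apply/monotone_face_sub => i j; rewrite !ltr_nat; apply: h.
Qed.

Lemma level_lt w i : is_expr w -> (level w i < size w)%N.
Proof.
move=> hw; rewrite /level -has_find; have /flattenP[b bw ib] := expr_in i hw.
by apply/hasP; exists b.
Qed.

Lemma mem_level w i : is_expr w -> i \in nth [::] w (level w i).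
Proof.
move=> hw; apply: (@nth_find _ [::] (fun b => i \in b)); rewrite has_find; exact: level_lt.
Qed.

Lemma level_unique w i k : uniq (flatten w) -> (k < size w)%N ->
  i \in nth [::] w k -> level w i = k.
Proof.
elim: w k => [|b w IH] // [|k] /=; rewrite cat_uniq => /and3P[bu bw wu].
  by move=> _ ib; rewrite /level /= ib.
rewrite ltnS => kw ik; rewrite /level /=; case: ifP => ib.
  case/negP: bw; apply/hasP; exists i => //; apply/flattenP.
  by exists (nth [::] w k) => //; apply: mem_nth.
by rewrite -/(level w i) (IH k).
Qed.

Lemma mem_block w i k : is_expr w -> (k < size w)%N ->
  (i \in nth [::] w k) = (level w i == k).
Proof.
move=> hw kw; apply/idP/eqP => [|<-]; last exact: mem_level.
exact: level_unique (expr_uniq hw) kw.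
Qed.

Lemma block_neq0 w k : is_expr w -> (k < size w)%N -> nth [::] w k != [::].
Proof. by move=> /expr_wne/allP h kw; apply/h/mem_nth. Qed.

Lemma exists_level w k : is_expr w -> (k < size w)%N -> exists i, level w i = k.
Proof.
move=> hw kw; have := block_neq0 hw kw.
case E : (nth [::] w k) => [|i b] // _; exists i; apply/eqP.
by rewrite -mem_block // E mem_head.
Qed.

(** Since no block is empty, levels are determined by the strict preorder which
    they define. *)
Lemma wface_eq w w' : is_expr w -> is_expr w' -> wface w = wface w' ->
  level w =1 level w'.
Proof.
move=> hw hw' E.
have E1 : forall i j, (level w' i < level w' j)%N -> (level w i < level w j)%N.
  by apply/wface_sub; rewrite E.
have E2 : forall i j, (level w i < level w j)%N -> (level w' i < level w' j)%N.
  by apply/wface_sub; rewrite E.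
have le u u' : is_expr u -> (forall i j, (level u i < level u j)%N -> (level u' i < level u' j)%N) ->
    forall i, (level u i <= level u' i)%N.
  move=> hu h i; have [n] := ubnP (level u i); elim: n i => // n IH i.
  rewrite ltnS => ni; case Ei : (level u i) => [|k] //.
  have [|j Ej] := @exists_level u k hu; first by rewrite (ltn_trans _ (level_lt i hu)) // Ei.
  have ji : (level u j < level u i)%N by rewrite Ej Ei.
  apply: leq_trans (h _ _ ji); rewrite ltnS -Ej; apply: IH.
  exact: leq_trans ji ni.
by move=> i; apply/eqP; rewrite eqn_leq !le.
Qed.

Lemma level_size w w' : is_expr w -> is_expr w' -> level w =1 level w' -> size w = size w'.
Proof.
have le u u' : is_expr u -> is_expr u' -> level u =1 level u' -> (size u <= size u')%N.
  move=> hu hu' E; case Eu : (size u) => [|n] //.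
  have [|i Ei] := @exists_level u n hu; first by rewrite Eu.
  by rewrite -Ei E level_lt.
by move=> hw hw' E; apply/eqP; rewrite eqn_leq !le // => i; rewrite E.
Qed.

Lemma level_blocks w w' : is_expr w -> is_expr w' -> level w =1 level w' ->
  all2 perm_eq w w'.
Proof.
move=> hw hw' E; have sE := level_size hw hw' E.
have : forall k, (k < size w)%N -> perm_eq (nth [::] w k) (nth [::] w' k).
  have bu u k : is_expr u -> uniq (nth [::] u k).
    move=> /expr_uniq; elim: u k => [|b u IH] [|k] //=; rewrite cat_uniq => /and3P[] // _ _.
    exact: IH.
  move=> k kw; apply: uniq_perm; rewrite ?bu // => i.
  by rewrite !mem_block -?sE // E.
elim: w w' sE {hw hw' E} => [|b w IH] [|b' w'] //= [sE] h.
by rewrite (h 0%N) //=; apply: IH => // k; apply: (h k.+1).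
Qed.

Lemma wdim_size w : is_expr w -> (wdim w + size w = #|I|)%N.
Proof.
case/andP => wn /perm_size; rewrite -cardE => <-.
elim: w wn => [|b w IH] /=; first by rewrite wdim_nil.
by case/andP => bn /IH; rewrite wdim_cons size_cat => <-; rewrite (size_bdim bn) addnS addSn addnA.
Qed.

(** The blocks are the level sets of the functional, in increasing order. *)
Lemma face_word (F : {set pvertex I}) : is_face F -> exists2 w, is_expr w & F = wface w.
Proof.
case=> c ->; rewrite face_of_functional.
pose ts := undup (sort <=%R (map c (enum I))).
have tsu : uniq ts by apply: undup_uniq.
have mts i : c i \in ts by rewrite mem_undup mem_sort map_f // mem_enum.
pose B t := [seq i <- enum I | c i == t].
have lE i : level (map B ts) i = index (c i) ts.
  rewrite /level find_map /index; apply: eq_find => t /=.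
  by rewrite mem_filter mem_enum andbT eq_sym.
have sts : sorted <=%R ts.
  apply: (subseq_sorted le_trans (undup_subseq _)).
  by apply: sort_sorted; apply: le_total.
exists (map B ts).
  apply/is_exprP; split.
  - rewrite /wne all_map; apply/allP => t; rewrite mem_undup mem_sort => /mapP[i _ ->] /=.
    have : i \in B (c i) by rewrite mem_filter eqxx mem_enum.
    by case: (B _).
  - elim: (ts) tsu => //= t r IH /andP[tr /IH ru]; rewrite cat_uniq filter_uniq ?enum_uniq //=.
    rewrite ru andbT; apply/hasPn => i /flattenP[_ /mapP[t' t'r ->]].
    rewrite /= !mem_filter => /andP[/eqP it' _].
    by apply: contra tr => /andP[/eqP <- _]; rewrite it'.
  - move=> i; apply/flattenP; exists (B (c i)); first exact: map_f.
    by rewrite mem_filter eqxx mem_enum.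
congr monotone_face; apply/funext => i; apply/funext => j; rewrite !lE.
apply/idP/idP; last first.
  move=> lt; rewrite lt_neqAle; apply/andP; split.
    by apply: contraTneq lt => ->; rewrite ltnn.
  by apply: (sorted_ltn_index le_trans sts).
apply: contraTT; rewrite -leqNgt -leNgt.
exact: (sorted_leq_index le_trans lexx sts).
Qed.

End Levels.

(** * Dimension of a face *)

Section Dimension.
Variables (I : finType) (w : word I).
Hypothesis hw : is_expr w.
Implicit Types (v : pvertex I) (i j : I).

Definition block_rep i : I := head i (nth [::] w (level w i)).

Lemma level_rep i : level w (block_rep i) = level w i.
Proof.
apply/eqP; rewrite -mem_block ?level_lt // /block_rep.
by have := mem_level i hw; case: (nth _ _ _) => //= a b _; rewrite mem_head.
Qed.

Lemma eq_block_rep i j : level w i = level w j -> block_rep i = block_rep j.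
Proof.
by move=> E; rewrite /block_rep E; have := mem_level j hw; case: (nth _ _ _).
Qed.

(** On a face, the values at the letters of a block fill an interval, so that
    their sum is constant; pairs inside the block are counted twice to avoid
    naming this interval. *)
Lemma block_sum v k : v \in wface w ->
  ((\sum_(i | level w i == k) v i) * 2 =
   (\sum_(i | level w i == k) \sum_j (level w j < k)%N) * 2
    + \sum_(i | level w i == k) \sum_(j | level w j == k) (i != j))%N.
Proof.
move=> /monotone_faceP[vI hv].
have E i : level w i == k -> ((v i : nat) = \sum_j (level w j < k)%N
    + \sum_(j | level w j == k) (v j < v i)%N)%N.
  move=> /eqP ik; rewrite [LHS](pvertex_count i vI) [X in (_ + X)%N]big_mkcond -big_split /=.
  apply: eq_bigr => j _; case: (ltngtP (level w j) k) => jk.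
  - by rewrite addn0 (hv j i) // ik.
  - by rewrite ltnNge ltnW // (hv i j) // ik.
  - by rewrite add0n.
rewrite (eq_bigr _ E) big_split /= mulnDl; congr (_ + _)%N.
rewrite muln2 -addnn {2}exchange_big -big_split /=; apply: eq_bigr => i _.
rewrite -big_split /=; apply: eq_bigr => j _.
have [->|ij] := eqVneq i j; first by rewrite ltnn.
have : v i != v j by rewrite inj_eq.
by rewrite -val_eqE /=; case: ltngtP.
Qed.

Let V := {ffun I -> rat^o}.
Let W := {ffun 'I_(size w) -> rat^o}.

Let sums (f : V) : W := [ffun k : 'I_(size w) => \sum_(i | level w i == k) f i].

Let sums_linear : linear sums.
Proof.
move=> a f g; apply/ffunP => k; rewrite !ffunE scaler_sumr -big_split /=.
by apply: eq_bigr => i _; rewrite !ffunE.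
Qed.

HB.instance Definition _ := GRing.isLinear.Build rat V W _ sums sums_linear.

Let g : 'Hom(V, W) := linfun sums.

Let unit_vec i : V := [ffun j => (j == i)%:R : rat^o].

(** The differences of vertices span the functions whose sum over each block is
    zero: exchanging two letters of a block in one vertex gives a multiple of
    the difference of two unit vectors. The block sums are independent linear
    forms. *)
Lemma dim_face (F : pface I) : val F = wface w -> pface_dim F = wdim w.
Proof.
move=> FE; rewrite /pface_dim FE; set X := [seq _ - _ | v <- _, v' <- _].
have rep_lt i := level_lt i hw.
suff -> : <<X>>%VS = lker g.
  have img : limg g = fullv.
    apply/eqP; rewrite eqEsubv subvf; apply/subvP => y _.
    apply/memv_imgP; exists [ffun i => if i == block_rep i then y (Ordinal (rep_lt i)) else 0].
      exact: memvf.
    rewrite lfunE; apply/ffunP => k; rewrite ffunE /=.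
    have [i ik] := exists_level hw (ltn_ord k).
    have rk : level w (block_rep i) == k by rewrite level_rep ik.
    have rr : block_rep (block_rep i) = block_rep i by apply/eq_block_rep/level_rep.
    rewrite (bigD1 (block_rep i)) //= ffunE rr eqxx big1 ?addr0.
      by congr (y _); apply: val_inj => /=; rewrite level_rep.
    move=> j /andP[/eqP jk jr]; rewrite ffunE.
    by rewrite (@eq_block_rep j i) ?jk ?ik // (negbTE jr).
  have dV : \dim {: V}%VS = #|I| by rewrite dimvf -[RHS]muln1.
  have dW : \dim {: W}%VS = size w by rewrite dimvf -[RHS]card_ord -[RHS]muln1.
  have := limg_ker_dim g fullv; rewrite capfv img dV dW.
  by rewrite -(wdim_size hw) => /addIn.
apply/eqP; rewrite eqEsubv; apply/andP; split.
  apply/span_subvP => _ /allpairsP[[v v'] /= [hv hv' ->]].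
  rewrite !mem_enum in hv hv'; rewrite memv_ker lfunE; apply/eqP/ffunP => k.
  rewrite !ffunE (eq_bigr (fun i => (v i)%:R - (v' i)%:R)); last by move=> i _; rewrite !ffunE.
  rewrite sumrB -!natr_sum; apply/eqP; rewrite subr_eq0 eqr_nat.
  by rewrite -(eqn_pmul2r (m := 2)) // !block_sum.
have [v vI hv] := exists_monotone (fun i => (level w i)%:R).
have vF : v \in wface w by apply/monotone_faceP; split=> // i j ij; apply: hv; rewrite ltr_nat.
have diffU i j : level w i = level w j -> unit_vec i - unit_vec j \in <<X>>%VS.
  have [->|ij] := eqVneq i j; first by rewrite subrr mem0v.
  move=> ijl; pose v' : pvertex I := [ffun k => v (tperm i j k)].
  have v'F : v' \in wface w.
    have lt k : level w (tperm i j k) = level w k by case: tpermP => [->|->|].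
    apply/monotone_faceP; split=> [k l|k l kl]; rewrite !ffunE; first by move/vI/perm_inj.
    by apply: hv; rewrite !lt ltr_nat.
  have : ppoint v - ppoint v' \in <<X>>%VS.
    by apply/memv_span/allpairsP; exists (v, v'); rewrite !mem_enum.
  have -> : ppoint v - ppoint v' = ((v i)%:R - (v j)%:R : rat) *: (unit_vec i - unit_vec j).
    apply/ffunP => k; rewrite !ffunE; case: tpermP => [->|->|/eqP ki /eqP kj].
    - by rewrite eqxx (negbTE ij) subr0 /GRing.scale /= mulr1.
    - by rewrite eqxx eq_sym (negbTE ij) sub0r /GRing.scale /= mulrN1 opprB.
    - by rewrite (negbTE ki) (negbTE kj) !subrr scaler0.
  have k0 : (v i)%:R - (v j)%:R != 0 :> rat.
    by rewrite subr_eq0 eqr_nat; apply: contra ij => /eqP/val_inj/vI ->.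
  by move=> /(memvZ ((v i)%:R - (v j)%:R)^-1); rewrite scalerK.
apply/subvP => f; rewrite memv_ker lfunE => /eqP f0.
have -> : f = \sum_i f i *: (unit_vec i - unit_vec (block_rep i)).
  apply/ffunP => j; rewrite sum_ffunE.
  rewrite (eq_bigr (fun i => f i * (j == i)%:R - f i * (j == block_rep i)%:R)); last first.
    by move=> i _; rewrite !ffunE /GRing.scale /= mulrBr.
  rewrite sumrB (bigD1 j) //= eqxx mulr1 big1 ?addr0; last first.
    by move=> i ij; rewrite eq_sym (negbTE ij) mulr0.
  rewrite [X in _ - X](_ : _ = 0) ?subr0 //.
  have [jr|jr] := eqVneq j (block_rep j); last first.
    rewrite big1 // => i _; case: eqP => [ji|_]; last by rewrite mulr0.
    by move: jr; rewrite ji (@eq_block_rep (block_rep i) i) ?level_rep // eqxx.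
  have := congr1 (fun y : W => y (Ordinal (rep_lt j))) f0; rewrite !ffunE /= => s0.
  rewrite -[RHS]s0 [RHS]big_mkcond; apply: eq_bigr => i _.
  case: eqP => [ji|ji]; first by rewrite mulr1 [in level w j]ji level_rep eqxx.
  rewrite mulr0; case: eqP => // lij; case: ji.
  by rewrite jr; apply: eq_block_rep.
by apply: memv_suml => i _; apply/memvZ/diffU; rewrite level_rep.
Qed.

End Dimension.

(** * Incidence numbers *)

Section Basis.
Variable I : finType.
Implicit Types (w : word I) (i j : I) (F G H : pface I).

(** Pairs in decreasing order for a fixed total order of I; their parity compares
    a block with its sorted form. *)
Fixpoint inversions (b : seq I) : nat :=
  if b is x :: b' then
    count (fun y => enum_rank y < enum_rank x)%N b' + inversions b'
  else 0.

Definition winversions w : nat := \sum_(b <- w) inversions b.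

Lemma inversions_swap (A B : word I) u v x y : uniq (u ++ x :: y :: v) ->
  odd (winversions (A ++ (u ++ x :: y :: v) :: B)) =
  ~~ odd (winversions (A ++ (u ++ y :: x :: v) :: B)).
Proof.
move=> U; rewrite /winversions !big_cat !big_cons /= !oddD -addbN -addNb; congr (_ (+) (_ (+) _)).
elim: u U => [|z u IH] /=.
  rewrite !inE negb_or => /andP[/andP[xy _] _].
  have : (enum_rank x : nat) != enum_rank y by rewrite val_eqE (inj_eq enum_rank_inj).
  rewrite !oddD; case: ltngtP => //= _ _;
  case: (odd (count (fun z => enum_rank z < enum_rank x)%N v));
  case: (odd (count (fun z => enum_rank z < enum_rank y)%N v));
  by case: (odd (inversions v)).
move=> /andP[_ /IH]; rewrite !oddD => ->; rewrite addbN; congr (~~ (odd _ (+) _)).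
by rewrite !count_cat /=; lia.
Qed.

Lemma level_swap (A B : word I) u v x y i :
  level (A ++ (u ++ x :: y :: v) :: B) i = level (A ++ (u ++ y :: x :: v) :: B) i.
Proof.
rewrite /level !find_cat /= ![i \in u ++ _]mem_cat !inE [(i == x) || _]orbCA.
by congr (if _ then _ else _); rewrite !has_cat.
Qed.

(** The coordinate on the face S: up to sign, a word is the class of its face. *)
Definition coordF (S : {set pvertex I}) w : int :=
  if wface w == S then sg (winversions w) 1 else 0.

Lemma coordF_alt S : alternating_expr (coordF S).
Proof.
move=> A B u v x y /expr_uniq; rewrite flatten_cat cat_uniq /= cat_uniq => /and3P[_ _ /and3P[U _ _]].
rewrite /coordF; have -> : wface (A ++ (u ++ [:: x, y & v]) :: B) = wface (A ++ (u ++ [:: y, x & v]) :: B).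
  by congr monotone_face; apply/funext => i; apply/funext => j; rewrite !(level_swap A B u v x y).
case: ifP => _; rewrite ?oppr0 // -sgS; apply: sg_mod => /=.
exact: inversions_swap.
Qed.

Definition coord F : PiM I -> int := lift_word (coordF (val F)).

Lemma coordD F : additive_fun (coord F).
Proof. exact/lift_wordD/coordF_alt. Qed.

Lemma coord_cl F w : is_expr w -> coord F (cl w) = coordF (val F) w.
Proof. exact/lift_wordE/coordF_alt. Qed.

Lemma face_expr_spec F : exists2 w, is_expr w & val F = wface w.
Proof. exact/face_word/asboolP/(valP F). Qed.

Definition face_expr F : word I := s2val (cid2 (face_expr_spec F)).

Lemma face_exprP F : is_expr (face_expr F).
Proof. exact: (s2valP (cid2 (face_expr_spec F))). Qed.

Lemma face_exprE F : val F = wface (face_expr F).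
Proof. exact: (s2valP' (cid2 (face_expr_spec F))). Qed.

Definition face_of w : pface I := exist _ (wface w) (asboolT (wface_is_face w)).

(** Normalized by inversions, so that it depends on the face only. *)
Definition face_class F : PiM I := sg (winversions (face_expr F)) (cl (face_expr F)).

Lemma cl_blocks w w' : all2 perm_eq w w' -> exists n, cl w = sg n (cl w').
Proof.
suff h P : all2 perm_eq w w' -> exists n, cl (P ++ w) = sg n (cl (P ++ w')) by exact: (h [::]).
elim: w w' P => [|b w IH] [|b' w'] P //=; first by exists 0%N.
move=> /andP[bb ww]; have [n En] := alternating_perm P w [::] (@cl_alternating I) bb.
have [m Em] := IH w' (rcons P b') ww; exists (n + m)%N.
by move: En; rewrite /= => ->; rewrite sgD -!cat_rcons Em.
Qed.

Lemma sg1_inj m n : sg m (1 : int) = sg n 1 -> odd m = odd n.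
Proof. by rewrite /sg; case: odd; case: odd. Qed.

(** Two expressions of a face differ by permutations of blocks, hence by a sign,
    and the coordinate of this face detects which one. *)
Lemma same_face_cl w w' : is_expr w -> is_expr w' -> wface w = wface w' ->
  sg (winversions w) (cl w) = sg (winversions w') (cl w').
Proof.
move=> hw hw' E; have [n En] := cl_blocks (level_blocks hw hw' (wface_eq hw hw' E)).
have := congr1 (coord (face_of w)) En.
rewrite (additive_sg (coordD _)) !coord_cl // /coordF /= E eqxx -sgD => /sg1_inj h.
rewrite En -sgD; apply: sg_mod; rewrite !oddD h oddD.
by case: (odd n); case: (odd _).
Qed.

Lemma coord_face F G : coord G (face_class F) = (F == G)%:R.
Proof.
rewrite /face_class (additive_sg (coordD G)) coord_cl ?face_exprP //.
rewrite /coordF -face_exprE val_eqE; case: eqP => _; last by rewrite sg_0.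
exact: sgK.
Qed.

Lemma face_span x : x = \sum_F face_class F *~ coord F x.
Proof.
move: x; apply: PiM_ext => // [x y|w hw].
  by rewrite -big_split; apply: eq_bigr => F _; rewrite coordD mulrzDr.
rewrite (bigD1 (face_of w)) //= big1 ?addr0 => [|F Fw].
  rewrite coord_cl // /coordF eqxx /face_class.
  rewrite (same_face_cl (face_exprP _) hw); last by rewrite -face_exprE.
  have -> : sg (winversions w) (1 : int) = (-1) ^+ winversions w.
    by rewrite -sgE /=; rewrite intz.
  by rewrite sgE sgK.
rewrite coord_cl // /coordF; case: eqP => [E|_]; last by rewrite mulr0z.
by case/eqP: Fw; apply: val_inj.
Qed.

Lemma face_class_deg F : degPi (pface_dim F) (face_class F).
Proof.
rewrite (dim_face (face_exprP F) (face_exprE F)).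
by apply/degPi_sg/degPi_cl/face_exprP.
Qed.

Lemma level_merge w k i : (k < (size w).-1)%N ->
  level (merge_at w k) i = if (level w i <= k)%N then level w i else (level w i).-1.
Proof.
elim: w k => [|c [|e w] IH] // [|k] /= h.
  rewrite /merge_at /= drop0 /level /= mem_cat.
  by case: (i \in c) => //=; case: (i \in e).
have := IH k h; rewrite /merge_at /= /level /=; case: (i \in c) => //= ->.
by rewrite ltnS; case: (i \in e) => //=; case: leqP => // lt; rewrite prednK //; lia.
Qed.

Lemma size_merge w k : (k < (size w).-1)%N -> size (merge_at w k) = (size w).-1.
Proof.
move=> h; rewrite /merge_at size_cat /= size_drop size_take; case: ifP; lia.
Qed.

(** Two letters in adjacent blocks k and k + 1 have the same level after the merge
    at k, and after no other merge. *)
Lemma merge_inj w k l : is_expr w -> (k < (size w).-1)%N -> (l < (size w).-1)%N ->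
  wface (merge_at w k) = wface (merge_at w l) -> k = l.
Proof.
move=> hw kw lw E; have E' := wface_eq (merge_is_expr kw hw) (merge_is_expr lw hw) E.
have [|i Ei] := @exists_level _ w k hw; first by lia.
have [|j Ej] := @exists_level _ w k.+1 hw; first by lia.
have := E' i; have := E' j; rewrite !level_merge // Ei Ej.
by case: (leqP k.+1 k); case: (leqP k.+1 l); case: (leqP k l); rewrite ?leqnn; lia.
Qed.

Lemma merge_face w k : is_expr w -> (k < (size w).-1)%N ->
  wface w \subset wface (merge_at w k).
Proof.
move=> hw kw; apply/wface_sub => i j; rewrite !level_merge //.
by case: (leqP (level w i) k); case: (leqP (level w j) k); lia.
Qed.

(** A surjection between the sets of levels, of equal cardinal, is injective. *)
Lemma sub_face_eq w w' : is_expr w -> is_expr w' -> size w = size w' ->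
  wface w \subset wface w' -> wface w = wface w'.
Proof.
move=> hw hw' sE; move/wface_sub => sub.
have mono i j : (level w i <= level w j)%N -> (level w' i <= level w' j)%N.
  by apply: contraLR; rewrite -!ltnNge; apply: sub.
have rep (k : 'I_(size w)) := cid (exists_level hw (ltn_ord k)).
pose h (k : 'I_(size w)) : 'I_(size w) :=
  Ordinal (eq_ind_r (fun n => (level w' (sval (rep k)) < n)%N) (level_lt (sval (rep k)) hw') sE).
have hE i (k : 'I_(size w)) : level w i = k -> level w' i = h k.
  by move=> ik /=; apply/eqP; rewrite eqn_leq !mono // (svalP (rep k)) ik.
have hI : injective h.
  apply/injectiveP; rewrite /injectiveb /dinjectiveb; apply/card_uniqP.
  rewrite size_map -cardE; apply: eq_card => k; rewrite inE.
  have [|i ik] := @exists_level _ w' k hw'; first by rewrite -sE.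
  apply/mapP; exists (Ordinal (level_lt i hw)); first by rewrite mem_enum.
  by apply: val_inj; rewrite -[LHS]ik; apply: hE.
apply/eqP; rewrite eqEsubset; apply/andP; split; apply/wface_sub => // i j ij.
have := hE i (Ordinal (level_lt i hw)) erefl; have := hE j (Ordinal (level_lt j hw)) erefl.
move=> Ej Ei; rewrite ltn_neqAle mono ?andbT; last exact: ltnW.
apply: contraTneq ij; rewrite Ei Ej => /val_inj/hI/(congr1 val) /= ->.
by rewrite ltnn.
Qed.

(** The coarsening from w to w' is a monotone surjection of levels onto one level
    less, so it identifies two consecutive levels k and k + 1; merging these
    blocks gives a face contained in that of w' with as many blocks. *)
Lemma facet_merge w w' : is_expr w -> is_expr w' -> wface w \subset wface w' ->
  wdim w' = (wdim w).+1 ->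
  exists2 k, (k < (size w).-1)%N & wface (merge_at w k) = wface w'.
Proof.
move=> hw hw' /wface_sub sub dE.
have sE : size w = (size w').+1.
  by have := wdim_size hw; have := wdim_size hw'; rewrite dE; lia.
have mono i j : (level w i <= level w j)%N -> (level w' i <= level w' j)%N.
  by apply: contraLR; rewrite -!ltnNge; apply: sub.
have rep (k : 'I_(size w)) := cid (exists_level hw (ltn_ord k)).
pose h (k : 'I_(size w)) : 'I_(size w') := Ordinal (level_lt (sval (rep k)) hw').
have hmono (k l : 'I_(size w)) : (k <= l)%N -> (h k <= h l)%N.
  by move=> kl /=; apply: mono; rewrite (svalP (rep k)) (svalP (rep l)).
have hE i (k : 'I_(size w)) : level w i = k -> level w' i = h k.
  by move=> ik /=; apply/eqP; rewrite eqn_leq !mono // (svalP (rep k)) ik.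
have [k [l [kl hkl]]] : exists k l : 'I_(size w), (k < l)%N /\ h k = h l.
  have /injectivePn[k [l kl hkl]] : ~~ injectiveb h.
    apply/negP => /injectiveP/leq_card; rewrite !card_ord sE; lia.
  have : (k : nat) != l by [].
  by rewrite neq_ltn => /orP[lt|lt]; [exists k, l | exists l, k].
have lw := ltn_ord l; have kw : (k < (size w).-1)%N by lia.
have k1w : (k.+1 < size w)%N by lia.
have hk : h (Ordinal k1w) = h k.
  apply/val_inj/eqP; rewrite eqn_leq {1}hkl !hmono //=.
exists k => //; apply: sub_face_eq => //.
- exact: merge_is_expr.
- by rewrite size_merge // sE.
apply/wface_sub => i j ij; have := sub i j ij; rewrite !level_merge //.
have : ~ ((level w i = k) /\ (level w j = k.+1)).
  case=> /hE ik jk; have := hE j (Ordinal k1w) jk; rewrite hk -ik => e.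
  by rewrite e ltnn in ij.
by case: (leqP (level w i) k); case: (leqP (level w j) k); lia.
Qed.

Lemma facetE F G : facet F G <->
  exists2 k, (k < (size (face_expr F)).-1)%N
    & wface (merge_at (face_expr F) k) = val G.
Proof.
have hF := face_exprP F; have hG := face_exprP G.
rewrite /facet (dim_face hF (face_exprE F)) (dim_face hG (face_exprE G)).
split=> [/andP[sub /eqP dE]|[k kw E]].
  rewrite [val G]face_exprE; apply: facet_merge => //.
  by rewrite -!face_exprE.
have hm := merge_is_expr kw hF.
rewrite -E {1}[val F]face_exprE merge_face //=; apply/eqP.
rewrite -(merge_wdim kw (expr_wne hF)).
have sE := level_size hm hG (wface_eq hm hG (etrans E (face_exprE G))).
by apply: (@addIn (size (face_expr G))); rewrite wdim_size // -sE wdim_size.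
Qed.

Definition incidence G F : int := coord G (dPi (face_class F)).

Lemma incidenceE G F : incidence G F = sg (winversions (face_expr F))
  (\sum_(k < (size (face_expr F)).-1)
     sg (wdim (take k.+1 (face_expr F))) (coordF (val G) (merge_at (face_expr F) k))).
Proof.
have hF := face_exprP F.
rewrite /incidence /face_class (additive_sg (@dPiD I)) (additive_sg (coordD G)).
congr sg; rewrite dPi_cl // -dword_sum (additive_sum (coordD G)).
apply: eq_bigr => k _; rewrite (additive_sg (coordD G)) coord_cl //.
exact: merge_is_expr.
Qed.

Lemma incidence_at G F k : (k < (size (face_expr F)).-1)%N ->
  wface (merge_at (face_expr F) k) = val G ->
  incidence G F = sg (winversions (face_expr F) + wdim (take k.+1 (face_expr F))
     + winversions (merge_at (face_expr F) k)) 1.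
Proof.
move=> kw E; rewrite incidenceE -addnA sgD; congr sg.
rewrite (bigD1 (Ordinal kw)) //= big1 ?addr0 => [|l lk].
  by rewrite /coordF E eqxx -sgD.
rewrite /coordF; case: eqP => [El|_]; last by rewrite sg_0.
case/eqP: lk; apply: val_inj; apply: (merge_inj (face_exprP F)) => //=.
by rewrite El.
Qed.

Lemma norm_sg n : `|sg n 1| = 1 :> int.
Proof. by rewrite /sg; case: odd; rewrite ?normrN normr1. Qed.

Lemma incidence_facet F G : `|incidence G F| = (facet F G)%:R.
Proof.
case: (boolP (facet F G)) => [/facetE[k kw E]|nf].
  by rewrite (incidence_at kw E) norm_sg.
rewrite incidenceE big1 ?sg_0 ?normr0 // => k _.
rewrite /coordF; case: eqP => [E|_]; last by rewrite sg_0.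
by case/negP: nf; apply/facetE; exists k.
Qed.

Lemma dPi_face F : dPi (face_class F) = \sum_G face_class G *~ incidence G F.
Proof. exact: face_span. Qed.

(** This is d(d F) = 0 read in the basis of faces. *)
Lemma incidence_diamond F H : \sum_G incidence H G * incidence G F = 0.
Proof.
have := congr1 (fun x => coord H (dPi x)) (dPi_face F).
rewrite dPi_dPi (additive0 (coordD H)) (additive_sum (@dPiD I)) (additive_sum (coordD H)).
move=> /esym E; rewrite -[RHS]E; apply: eq_bigr => G _.
by rewrite (additiveMz (@dPiD I)) (additiveMz (coordD H)) -mulrzr intz.
Qed.

Lemma wdim0 w : wne w -> wdim w = 0%N -> exists s, w = [seq [:: i] | i <- s].
Proof.
elim: w => [|b w IH] /=; first by exists [::].
case/andP; rewrite wdim_cons; case: b => [|i [|j b]] // _ wn.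
by rewrite /bdim /= add0n => /(IH wn)[s ->]; exists (i :: s).
Qed.

Lemma merge_singles (s : seq I) k : (k < (size s).-1)%N ->
  exists A a b B, s = A ++ a :: b :: B /\
    merge_at [seq [:: i] | i <- s] k = [seq [:: i] | i <- A] ++ [:: a; b] :: [seq [:: i] | i <- B].
Proof.
elim: s k => [|a [|b s] IH] // [|k] /= h.
  by exists [::], a, b, s; rewrite /merge_at /= drop0.
have [A [c [d [B [E1 E2]]]]] := IH k h; exists (a :: A), c, d, B; split; first by rewrite /= E1.
by move: E2; rewrite /merge_at /= => ->.
Qed.

Lemma inversions_singles (s : seq I) : winversions [seq [:: i] | i <- s] = 0%N.
Proof. by rewrite /winversions big_map big1. Qed.

Lemma all2_singles (s t : seq I) :
  all2 perm_eq [seq [:: i] | i <- s] [seq [:: i] | i <- t] -> s = t.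
Proof.
elim: s t => [|i s IH] [|j t] //= /andP[ij /IH->].
by have := perm_mem ij i; rewrite !inE eqxx => /esym/eqP->.
Qed.

Lemma all2_edge (A A' B B' : seq I) a b a' b' :
  all2 perm_eq ([seq [:: i] | i <- A] ++ [:: a; b] :: [seq [:: i] | i <- B])
    ([seq [:: i] | i <- A'] ++ [:: a'; b'] :: [seq [:: i] | i <- B']) ->
  [/\ A = A', B = B' & perm_eq [:: a; b] [:: a'; b']].
Proof.
elim: A A' => [|x A IH] [|x' A'] /=.
- by case/andP => h /all2_singles ->.
- by case/andP => /perm_size.
- by case/andP => /perm_size.
case/andP => xx /IH[-> -> h]; split=> //.
by have := perm_mem xx x; rewrite !inE eqxx => /esym/eqP->.
Qed.

(** Both vertices come from words with one-letter blocks whose merges have the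
    same face: the merged letters are a, b for one and b, a for the other. *)
Lemma incidence_edge F F' G : F != F' -> facet F G -> facet F' G ->
  pface_dim G = 1%N -> incidence G F + incidence G F' = 0.
Proof.
move=> FF fF fF' dG; have /facetE[k kw E] := fF; have /facetE[k' kw' E'] := fF'.
have vtx K : facet K G -> exists s, face_expr K = [seq [:: i] | i <- s].
  case/andP => _; rewrite dG (dim_face (face_exprP K) (face_exprE K)) eqSS => /eqP/esym.
  exact: wdim0 (expr_wne (face_exprP K)).
rewrite (incidence_at kw E) (incidence_at kw' E').
have [s Es] := vtx F fF; have [s' Es'] := vtx F' fF'.
have hF := face_exprP F; have hF' := face_exprP F'.
have hm := merge_is_expr kw hF; have hm' := merge_is_expr kw' hF'.
have := level_blocks hm hm' (wface_eq hm hm' (etrans E (esym E'))).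
have tdim (t : seq I) m : wdim (take m [seq [:: i] | i <- t]) = 0%N.
  by rewrite -map_take (@wdim_singles _ (take m t)).
move: kw kw' hm; rewrite Es Es' !inversions_singles !tdim !size_map !add0n.
move=> /merge_singles[A [a [b [B [sE ->]]]]] /merge_singles[A' [a' [b' [B' [sE' ->]]]]] hm.
move=> /all2_edge[AA BB ab]; have [ea|na] := eqVneq a a'.
  have bb : b = b'.
    have := perm_mem ab b; rewrite ea in hm *; rewrite !inE eqxx orbT => /esym/orP[/eqP e|/eqP//].
    have := expr_uniq hm; rewrite flatten_cat cat_uniq => /and3P[_ _].
    by rewrite /= inE e eqxx.
  case/eqP: FF; apply: val_inj; rewrite !face_exprE Es Es' sE sE'.
  by rewrite AA BB ea bb.
have ab' : a = b' by have := perm_mem ab a; rewrite !inE eqxx (negbTE na) => /esym/eqP.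
have ba' : b = a'.
  by have := perm_mem ab a'; rewrite !inE eqxx [a' == a]eq_sym (negbTE na) => /eqP.
rewrite AA BB ab' ba'; rewrite AA BB ab' ba' in hm.
have U : uniq ([::] ++ [:: b', a' & [::]]).
  by have := expr_uniq hm; rewrite flatten_cat cat_uniq /= => /and3P[_ _]; rewrite !inE => /andP[/norP[-> _] _].
by have := inversions_swap [seq [:: i] | i <- A'] [seq [:: i] | i <- B'] U;
  rewrite /= /sg => ->; case: odd; rewrite ?addNr ?subrr.
Qed.

End Basis.

Lemma Pi_permutohedron (I : neFin) : permutohedron_cochains I (Pi I).
Proof.
exists (@face_class I), (@incidence I); split.
- move=> x; exists [ffun F => coord F x]; split.
    by rewrite {1}(face_span x); apply: eq_bigr => F _; rewrite ffunE.
  move=> c xE; apply/ffunP => G; rewrite ffunE xE (additive_sum (coordD G)).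
  rewrite (bigD1 G) //= (additiveMz (coordD G)) coord_face eqxx big1 ?addr0 ?intz // => F FG.
  by rewrite (additiveMz (coordD G)) coord_face (negbTE FG) mul0rz.
- exact: face_class_deg.
- split; [exact: incidence_facet | exact: incidence_edge | exact: incidence_diamond].
- exact: dPi_face.
Qed.

Theorem mainTheorem14 :
  [/\ is_dgOperad Com,
      is_dgOperad Pi,
      exists2 f : forall I : neFin, Com I -> Pi I,
        operad_morphism f & forall I : neFin, quasi_iso (f I),
      forall I : neFin, permutohedron_cochains I (Pi I)
    & (forall I : neFin, homology_in_degree0 (Pi I)) /\
      trivial_action_on_homology Pi].
Proof.
split.
- exact: Com_dgOperad.
- exact: Pi_dgOperad.
- exists Com_to_Pi; [exact: Com_to_Pi_morphism | exact: Com_to_Pi_quasi_iso].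
- exact: Pi_permutohedron.
- by split; [exact: Pi_homology_in_degree0 | exact: Pi_trivial_action].
Qed.
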